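(* Let $\nu\in[0,1)$, $0<R<1$ and write $R=e^{-a}$ with $a>0$. There exist real coefficients $a_p(R,\nu)$, $p\ge1$, such that for all sufficiently small $t>0$, $$\mathrm{Tr}\,(e^{-t\mathcal M_\nu(R)})=\frac{\cosh\big(t(\nu-\frac12)\big)}{\sinh\frac t2}+\frac{\cosh\big(\frac tR(\nu-\frac12)\big)}{\sinh\frac t{2R}}+\sum_{p\ge1}a_p(R,\nu)\,t^p,$$ with $$a_1(R,\nu)=-\Big(1+\frac1R\Big)\sum_{m\in\mathbb Z}|m-\nu|\big(\coth(a|m-\nu|)-1\big).$$ In particular, as $t\to0^+$, $$\mathrm{Tr}\,(e^{-t\mathcal M_\nu(R)})=\frac{2+2R}{t}+\left(\frac{1+R-6\nu-6R\nu+6\nu^2+6R\nu^2}{6R}+a_1(R,\nu)\right)t+\mathcal O(t^2).$$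
   Context: Let $\Omega=\{(r,\theta):R<r<1\}\subset\mathbb R^2$ (polar coordinates) be the annulus with outer radius $1$ and inner radius $R$, with boundary $\partial\Omega=S^1\cup S^R$, where $S^\rho$ is the circle of radius $\rho$ centered at $0$. Let $A_\nu(x,y)=\frac\nu{r^2}(-y,x)$ be the Aharonov–Bohm potential and $H=(D-A_\nu)^2$, $D=-i\nabla$. $\mathcal M_\nu(R)$ is the Dirichlet-to-Neumann operator on $\partial\Omega$: it maps $\Psi=(\psi^1,\psi^R)\in H^{1/2}(S^1)\oplus H^{1/2}(S^R)$ to the outward normal derivative $(\partial_rv|_{r=1},-\partial_rv|_{r=R})$, where $v$ solves $Hv=0$ in $\Omega$, $v=\Psi$ on $\partial\Omega$. When $\nu=0$, the $m=0$ term $|m-\nu|(\coth(a|m-\nu|)-1)$ is understood as its limit $1/a$. *)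

(* Defs.v *)
From HB Require Import structures.
From mathcomp Require Import all_boot all_order all_algebra.
From mathcomp Require Import complex.
From mathcomp Require Import all_classical all_reals all_analysis.

Set Implicit Arguments.
Unset Strict Implicit.
Unset Printing Implicit Defensive.

Import Order.TTheory GRing.Theory Num.Theory.
Import numFieldNormedType.Exports.

Local Open Scope classical_set_scope.
Local Open Scope ring_scope.
Local Open Scope complex_scope.

Section Hyperbolic.
Context {R : realType}.

Definition cosh (x : R) : R := (expR x + expR (- x)) / 2.
Definition sinh (x : R) : R := (expR x - expR (- x)) / 2.
Definition coth (x : R) : R := cosh x / sinh x.

(* k (coth (a k) - 1), extended by its limit 1/a at k = 0. *)
Definition coth_defect (a k : R) : R :=
  if k == 0 then a^-1 else k * (coth (a * k) - 1).

End Hyperbolic.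

Section Fourier.
Context {R : realType}.

Definition sqmod (z : R[i]) : R := complex.Re z ^+ 2 + complex.Im z ^+ 2.

Definition cis (x : R) : R[i] := cos x +i* sin x.

(* A function on a circle centred at 0 is given as a function of the angle;
   only its values on [0, 2 pi] matter. *)
Definition period : set R := `[0, 2 * pi]%classic.

Definition circle_measurable (f : R -> R[i]) : Prop :=
  measurable_fun period (fun x => complex.Re (f x)) /\
  measurable_fun period (fun x => complex.Im (f x)).

Definition cintegral (f : R -> R[i]) : R[i] :=
  (\int[lebesgue_measure]_(x in period) complex.Re (f x)) +i*
  (\int[lebesgue_measure]_(x in period) complex.Im (f x)).

Definition fourier (f : R -> R[i]) (m : int) : R[i] :=
  (2 * pi)^-1%:C * cintegral (fun x => f x * cis (- (m%:~R * x))).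

(* Squared norm, in the Sobolev space H^s of the circle, of the distribution
   with Fourier coefficients c. *)
Definition sobolev_sqnorm (s : R) (c : int -> R[i]) : \bar R :=
  \esum_(m in [set: int]) ((1 + (m%:~R) ^+ 2) `^ s * sqmod (c m))%:E.

End Fourier.

Section MagneticOperator.
Context {R : realType}.

Definition dX (u : R * R -> R[i]) (p : R * R) : R[i] :=
  derive1 (fun s => complex.Re (u (s, p.2))) p.1 +i*
  derive1 (fun s => complex.Im (u (s, p.2))) p.1.

Definition dY (u : R * R -> R[i]) (p : R * R) : R[i] :=
  derive1 (fun s => complex.Re (u (p.1, s))) p.2 +i*
  derive1 (fun s => complex.Im (u (p.1, s))) p.2.

Fixpoint Ck_real (k : nat) (D : set (R * R)) (f : R * R -> R) : Prop :=
  (forall p, D p -> {for p, continuous f}) /\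
  (if k is k'.+1 then
     [/\ forall p, D p -> derivable (fun s => f (s, p.2)) p.1 1 /\
                          derivable (fun s => f (p.1, s)) p.2 1,
         Ck_real k' D (fun p => derive1 (fun s => f (s, p.2)) p.1)
       & Ck_real k' D (fun p => derive1 (fun s => f (p.1, s)) p.2)]
   else True).

Definition Ck (k : nat) (D : set (R * R)) (u : R * R -> R[i]) : Prop :=
  Ck_real k D (fun p => complex.Re (u p)) /\
  Ck_real k D (fun p => complex.Im (u p)).

Definition annulus (rho : R) : set (R * R) :=
  [set p | rho ^+ 2 < p.1 ^+ 2 + p.2 ^+ 2 < 1].

Definition AX (nu : R) (p : R * R) : R :=
  nu / (p.1 ^+ 2 + p.2 ^+ 2) * (- p.2).
Definition AY (nu : R) (p : R * R) : R :=
  nu / (p.1 ^+ 2 + p.2 ^+ 2) * p.1.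

Definition magX (nu : R) (u : R * R -> R[i]) (p : R * R) : R[i] :=
  (0 -i* 1) * dX u p - (AX nu p)%:C * u p.
Definition magY (nu : R) (u : R * R -> R[i]) (p : R * R) : R[i] :=
  (0 -i* 1) * dY u p - (AY nu p)%:C * u p.

(* H = (D - A_nu)^2 with D = - i grad; magX and magY are the components of
   D - A_nu. *)
Definition magH (nu : R) (u : R * R -> R[i]) (p : R * R) : R[i] :=
  magX nu (magX nu u) p + magY nu (magY nu u) p.

Definition polar (r x : R) : R * R := (r * cos x, r * sin x).

Definition dr (u : R * R -> R[i]) (r x : R) : R[i] :=
  derive1 (fun s => complex.Re (u (polar s x))) r +i*
  derive1 (fun s => complex.Im (u (polar s x))) r.

End MagneticOperator.

Section DirichletToNeumann.
Context {R : realType}.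

(* Functions on the boundary: first component on the circle of radius 1,
   second one on the circle of radius rho. *)
Local Notation bfun := ((R -> R[i]^o) * (R -> R[i]^o))%type.

Definition bnorm2 (rho : R) (Psi : bfun) : \bar R :=
  (\int[lebesgue_measure]_(x in period) (sqmod (Psi.1 x))%:E +
   rho%:E * \int[lebesgue_measure]_(x in period) (sqmod (Psi.2 x))%:E)%E.

Definition inL2 (rho : R) (Psi : bfun) : Prop :=
  [/\ circle_measurable Psi.1, circle_measurable Psi.2
    & (bnorm2 rho Psi < +oo)%E].

(* The inner product of L^2 for arc length, which is rho dx on the inner
   circle. *)
Definition binner (rho : R) (Psi Phi : bfun) : R[i] :=
  cintegral (fun x => Psi.1 x * (Phi.1 x)^*) +
  rho%:C * cintegral (fun x => Psi.2 x * (Phi.2 x)^*).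

(* Graph of M_nu(rho) : H^{1/2} -> H^{-1/2}.  The image is a pair of
   distributions on the circles, given by their Fourier coefficients phi1 and
   phi2.  The boundary values of the solution v and of its outward normal
   derivative are limits along the circles of radius r, in H^{1/2} and H^{-1/2}
   respectively. *)
Definition DtN (nu rho : R) (Psi : bfun) (phi1 phi2 : int -> R[i]) : Prop :=
  [/\ inL2 rho Psi,
      (sobolev_sqnorm 2^-1 (fourier Psi.1) < +oo)%E,
      (sobolev_sqnorm 2^-1 (fourier Psi.2) < +oo)%E
    & exists v : R * R -> R[i],
      [/\ Ck 2 (annulus rho) v,
          forall p, annulus rho p -> magH nu v p = 0,
          (sobolev_sqnorm 2^-1
             (fun m => fourier (v \o polar r) m - fourier Psi.1 m)
             @[r --> (1 : R)^'-] --> 0%E) /\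
          (sobolev_sqnorm 2^-1
             (fun m => fourier (v \o polar r) m - fourier Psi.2 m)
             @[r --> rho^'+] --> 0%E)
        & (sobolev_sqnorm (- 2^-1)
             (fun m => fourier (dr v r) m - phi1 m)
             @[r --> (1 : R)^'-] --> 0%E) /\
          (sobolev_sqnorm (- 2^-1)
             (fun m => fourier (fun x => - dr v r x) m - phi2 m)
             @[r --> rho^'+] --> 0%E)]].

Definition DtN_eigen (nu rho lambda : R) (Psi : bfun) : Prop :=
  DtN nu rho Psi (fun m => lambda%:C * fourier Psi.1 m)
                 (fun m => lambda%:C * fourier Psi.2 m).

Definition hilbert_basis (rho : R) (e : nat -> bfun) : Prop :=
  [/\ forall k, inL2 rho (e k),
      forall j k, binner rho (e j) (e k) = (j == k)%:R
    & forall Psi, inL2 rho Psi -> forall eps : R, 0 < eps ->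
      exists (n : nat) (c : nat -> R[i]),
        (bnorm2 rho (Psi - \sum_(k < n) c k *: e k)%R < eps%:E)%E].

(* Equality in L^2, i.e. almost everywhere. *)
Definition eqL2 (rho : R) (Psi Phi : bfun) : Prop := bnorm2 rho (Psi - Phi) = 0%E.

Definition bounded_operator (rho : R) (E : bfun -> bfun) : Prop :=
  [/\ forall Psi, inL2 rho Psi -> inL2 rho (E Psi),
      forall (c : R[i]) Psi Phi, inL2 rho Psi -> inL2 rho Phi ->
        eqL2 rho (E (c *: Psi + Phi)) (c *: E Psi + E Phi)
    & exists C : R, forall Psi, inL2 rho Psi ->
        (bnorm2 rho (E Psi) <= C%:E * bnorm2 rho Psi)%E].

(* E = e^{-t M_nu(rho)} on L^2 of the boundary, by the functional calculus of the
   self-adjoint operator M_nu(rho), whose spectrum is discrete. *)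
Definition DtN_heat_operator (nu rho t : R) (E : bfun -> bfun) : Prop :=
  bounded_operator rho E /\
  exists (e : nat -> bfun) (lambda : nat -> R),
    [/\ hilbert_basis rho e,
        forall k, DtN_eigen nu rho (lambda k) (e k)
      & forall k, eqL2 rho (E (e k)) ((expR (- t * lambda k))%:C *: e k)].

Definition has_trace (rho : R) (E : bfun -> bfun) (tau : R) : Prop :=
  forall f : nat -> bfun, hilbert_basis rho f ->
    series (fun k => complex.Re (binner rho (E (f k)) (f k))) @ \oo --> tau /\
    series (fun k => complex.Im (binner rho (E (f k)) (f k))) @ \oo --> (0 : R).

Definition DtN_heat_trace (nu rho t tau : R) : Prop :=
  exists2 E, DtN_heat_operator nu rho t E & has_trace rho E tau.

End DirichletToNeumann.

(* Main.v *)
(**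
Separation of variables: on the angular mode [m], with [mu = m - nu], the solutions
of [H v = 0] are spanned by [r^mu] and [r^(- mu)] ([1] and [ln r] if [mu = 0]), so
the Dirichlet-to-Neumann operator is a 2 x 2 matrix [M_m] for each [m].  The
eigenvectors of the [M_m] form a Hilbert basis of [L^2], because trigonometric
polynomials are dense, and the heat trace is [sum_k exp (- t lam_k)].  The
eigenvalues of [M_m] differ from [|mu|] and [|mu| / R], those of the two uncoupled
circles, by [O(exp (- a |mu| / 2))].  The uncoupled sums are geometric and
give the two hyperbolic quotients; the difference
[sum_k (exp (- t lam_k) - exp (- t lam0_k))] is a power series in [t] that may be
summed term by term, and its linear coefficient follows from the traces
[tr M_m = (1 + 1 / R) mu coth (a mu)].
*)

Require Import Defs.
From mathcomp Require Import all_boot all_order all_algebra.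
From mathcomp Require Import all_classical all_reals all_analysis.
From mathcomp Require Import complex measurable_realfun.
From mathcomp Require Import ring lra zify.

Set Implicit Arguments.
Unset Strict Implicit.
Unset Printing Implicit Defensive.

Import Order.TTheory GRing.Theory Num.Theory.
Import numFieldNormedType.Exports.
Local Open Scope classical_set_scope.
Local Open Scope ring_scope.

(** * Power series *)

(** The eigenvalues grow linearly with the mode, so the Taylor coefficients of a single exponential
    are unbounded over the modes; only differences with the uncoupled eigenvalues can be summed. The
    growth enters as [w^p / p! <= exp w], and with [w] about [a |mu| / 4] this costs half of the
    decay [exp (- a |mu| / 2)] and leaves a summable bound times a geometric factor [Q^p]. The
    truncation order is kept as a parameter, so that one estimate yields both the convergence of the
    series in [t] and the remainder of order two.

    On the operator side, the trace must be the same in every Hilbert basis of a space of actual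
    functions, where the inner product is only semidefinite and identities hold up to null
    functions. Positivity of the weights [exp (- t lam_k)] reduces this to Tonelli and Parseval. The
    heat operator is a pointwise sum: the eigenvectors are uniformly bounded and the weights
    summable, so the Weierstrass test applies. Each eigenvector has a single frequency, so the
    Sobolev limits in the definition of the operator are limits of one Fourier coefficient. *)

Section Series.
Context {R : realType}.
Implicit Types (f g u : R^nat) (l c F S U K Q t : R).

Lemma series_pair f n :
  series f n.*2 = series (fun j => f j.*2 + f j.*2.+1) n.
Proof.
elim: n => [|n IH]; first by rewrite !seriesEnat /= !big_nil.
by rewrite doubleS !seriesSr IH /= -addrA.
Qed.

(** Used at two levels: an eigenvalue series has two terms per mode, and the modes alternate between
    the integers [- j] and [j + 1]. *)
Lemma cvg_series_pair f l : series f @ \oo --> l ->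
  series (fun j => f j.*2 + f j.*2.+1) @ \oo --> l.
Proof.
move=> fl.
rewrite (_ : series _ = (fun n => series f n.*2)); last first.
  by apply/funext => n; rewrite series_pair.
apply: (@cvg_comp _ _ _ (fun n => n.*2) (series f) \oo \oo) => //.
apply/cvgnyPge => A; exists A => // n /= An; rewrite -addnn.
exact: leq_trans An (leq_addr _ _).
Qed.

Lemma cvg_series_dominated f u U : (forall n, `|f n| <= u n) ->
  series u @ \oo --> U -> exists2 l : R, series f @ \oo --> l & `|l| <= U.
Proof.
move=> fu uU.
have cu : cvgn (series u) by apply/cvg_ex; exists U.
have cnf : cvgn [normed series f].
  by apply: series_le_cvg cu => n /=;
    [exact: normr_ge0|exact: le_trans (fu n)|exact: fu].
have cf := normed_cvg cnf.
exists (limn (series f)) => //.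
apply: le_trans (lim_series_norm cnf) _.
by rewrite -(cvg_lim _ uU)//; exact: lim_series_le.
Qed.

Lemma cvg_seriesB f g l (k : R) : series f @ \oo --> l -> series g @ \oo --> k ->
  series (fun n => f n - g n) @ \oo --> l - k.
Proof.
move=> fl gk; rewrite (_ : series _ = (fun n => series f n - series g n)).
  exact: cvgB.
by apply/funext => n; rewrite !seriesEnat /= sumrB.
Qed.

Lemma cvg_seriesD f g l (k : R) : series f @ \oo --> l -> series g @ \oo --> k ->
  series (fun n => f n + g n) @ \oo --> l + k.
Proof.
move=> fl gk; rewrite (_ : series _ = (fun n => series f n + series g n)).
  exact: cvgD.
by apply/funext => n; rewrite !seriesEnat /= big_split.
Qed.

Lemma cvg_seriesZ f c l : series f @ \oo --> l ->
  series (fun n => c * f n) @ \oo --> c * l.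
Proof.
move=> fl; rewrite (_ : series _ = (fun n => c * series f n)).
  by apply: cvgMr.
by apply/funext => n; rewrite !seriesEnat /= big_distrr.
Qed.

Lemma cvg_series_sum (h : nat -> R^nat) (l : R^nat) P :
  (forall p, series (h p) @ \oo --> l p) ->
  series (fun n => \sum_(p < P) h p n) @ \oo --> \sum_(p < P) l p.
Proof.
move=> hl; elim: P => [|P IH].
  rewrite big_ord0 (_ : series _ = (fun=> 0)); first exact: cvg_cst.
  apply/funext => n; rewrite seriesEnat /= big1// => i _.
  by rewrite big_ord0.
rewrite big_ord_recr /=.
rewrite (_ : (fun n => _) = (fun n => \sum_(p < P) h p n + h P n)).
  exact: cvg_seriesD.
by apply/funext => n; rewrite big_ord_recr.
Qed.

(** A ratio of at most 1/2 gives [1 / (1 - x) <= 2], uniformly in [x]. *)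
Lemma cvg_geom_half (c x : R) (P : nat) : 0 <= x <= 2^-1 -> 0 <= c ->
  exists2 s : R, series (fun p => c * x ^+ (p + P)%N) @ \oo --> s &
             s <= 2 * c * x ^+ P.
Proof.
move=> /andP[x0 x1] c0.
have xlt : `|x| < 1 by rewrite ger0_norm//; lra.
have H := @cvg_geometric_series R (c * x ^+ P) x xlt.
exists (c * x ^+ P / (1 - x)).
  rewrite (_ : (fun p => _) = geometric (c * x ^+ P) x)//.
  by apply/funext => p; rewrite /= exprD [x ^+ p * _]mulrC mulrA.
rewrite ler_pdivrMr; last by lra.
have xP : 0 <= c * x ^+ P by rewrite mulr_ge0// exprn_ge0.
rewrite -[2 * c * _]mulrA; set y := c * x ^+ P in xP *; nra.
Qed.

Lemma cvg_series_tail f F P : series f @ \oo --> F ->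
  series (fun p => f (p + P)%N) @ \oo --> F - \sum_(p < P) f p.
Proof.
move=> fF.
rewrite (_ : series _ = (fun n => series f (n + P)%N - \sum_(p < P) f p)).
  apply: cvgB; last exact: cvg_cst.
  by rewrite cvg_shiftn.
apply/funext => n; elim: n => [|n IH].
  by rewrite seriesEnat /= big_nil add0n seriesEord subrr.
by rewrite addSn !seriesSr IH addrAC.
Qed.

(** From order [P] on, the terms are dominated by a geometric sequence of ratio [|t| Q <= 1 / 2];
    the factor 2 is the price of summing it. *)
Lemma power_series_tail (b : R^nat) K Q t F P : 0 <= K -> 0 <= Q ->
  (forall p, `|b p| <= K * Q ^+ p) -> `|t| * Q <= 2^-1 ->
  series (fun p => b p * t ^+ p) @ \oo --> F ->
  `|F - \sum_(p < P) b p * t ^+ p| <= 2 * K * (`|t| * Q) ^+ P.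
Proof.
move=> K0 Q0 bK tQ bF.
have [|s gs sK] := @cvg_geom_half K (`|t| * Q) P _ K0.
  by rewrite tQ mulr_ge0.
have H := @cvg_series_tail _ F P bF.
have [|l hl lK] := @cvg_series_dominated (fun p => b (p + P)%N * t ^+ (p + P)%N) _ _ _ gs.
  move=> n; rewrite normrM normrX exprMn mulrCA mulrC.
  by rewrite ler_wpM2l ?exprn_ge0.
rewrite (cvg_unique _ H hl)//; exact: le_trans lK sK.
Qed.

Lemma cvg_series_expR (x : R) : series (exp_coeff x) @ \oo --> expR x.
Proof. exact: is_cvg_series_exp_coeff. Qed.

(* No exchange of limits is needed: the tail of order [P] of the [k]-th row is at
   most [2 * u k * (`|t| * Q) ^+ P], and these tails are summed over [k]. *)
Lemma cvg_double_power_series (b : nat -> R^nat) (c F : R^nat) u U Q t S (P : nat) :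
  0 <= Q -> (forall k : nat, 0 <= u k) -> (forall (k : nat) p, `|b k p| <= u k * Q ^+ p) ->
  `|t| * Q <= 2^-1 ->
  series u @ \oo --> U ->
  (forall p, series (b ^~ p) @ \oo --> c p) ->
  (forall k : nat, series (fun p => b k p * t ^+ p) @ \oo --> F k) ->
  series F @ \oo --> S ->
  `|S - \sum_(p < P) c p * t ^+ p| <= 2 * U * (`|t| * Q) ^+ P.
Proof.
move=> Q0 u0 bu tQ uU bc bF FS.
have H1 : series (fun k => F k - \sum_(p < P) b k p * t ^+ p) @ \oo -->
    S - \sum_(p < P) c p * t ^+ p.
  apply: cvg_seriesB => //.
  apply: (cvg_series_sum (h := fun p k => b k p * t ^+ p)
    (l := fun p => c p * t ^+ p)) => p.
  rewrite (_ : (fun k => _) = (fun k => t ^+ p * b k p)); last first.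
    by apply/funext => k; rewrite mulrC.
  by rewrite mulrC; exact: cvg_seriesZ.
have H2 : series (fun k => 2 * (`|t| * Q) ^+ P * u k) @ \oo -->
    2 * (`|t| * Q) ^+ P * U by exact: cvg_seriesZ.
have [|l hl lK] := @cvg_series_dominated
    (fun k => F k - \sum_(p < P) b k p * t ^+ p) _ _ _ H2.
  by move=> k; rewrite mulrAC; exact: power_series_tail (bF k).
by rewrite (cvg_unique _ H1 hl)// mulrAC.
Qed.

End Series.

(** * Eigenvalues of the Dirichlet-to-Neumann operator *)

Section Mode.
Context {R : realType}.
Implicit Types (a rho mu x y : R) (b : bool).

Lemma sinhN x : sinh (- x) = - sinh x.
Proof. by rewrite /sinh opprK -mulNr opprB. Qed.

Lemma coshN x : cosh (- x) = cosh x.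
Proof. by rewrite /cosh opprK addrC. Qed.

Lemma cothN x : coth (- x) = - coth x.
Proof. by rewrite /coth sinhN coshN invrN mulrN. Qed.

Lemma sinh_gt0 x : 0 < x -> 0 < sinh x.
Proof.
by move=> x0; rewrite /sinh divr_gt0// subr_gt0 ltr_expR; lra.
Qed.

Lemma cosh2B x : cosh x ^+ 2 - sinh x ^+ 2 = 1.
Proof.
rewrite /cosh /sinh; have := expRxMexpNx_1 x.
by set u := expR x; set v := expR (- x) => uv; rewrite -[RHS]uv; field.
Qed.

(* On the mode [m], with [mu = m - nu], the Dirichlet-to-Neumann operator acts by
   the matrix [[A, - B], [- B / rho, A / rho]]; the values at [mu = 0] are limits. *)
Definition modeA a mu : R := if mu == 0 then a^-1 else mu * coth (a * mu).
Definition modeB a mu : R := if mu == 0 then a^-1 else mu / sinh (a * mu).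

Lemma modeA_norm a mu : modeA a `|mu| = modeA a mu.
Proof.
rewrite /modeA normr_eq0; case: ifP => // _.
by case: (ger0P mu) => // _; rewrite mulrN cothN mulrNN.
Qed.

Lemma modeB_norm a mu : modeB a `|mu| = modeB a mu.
Proof.
rewrite /modeB normr_eq0; case: ifP => // _.
by case: (ger0P mu) => // _; rewrite mulrN sinhN invrN mulrNN.
Qed.

(** This is [cosh^2 - sinh^2 = 1]; it makes the determinant of the mode matrix equal to
    [mu^2 / rho]. *)
Lemma modeABB a mu : 0 < a -> modeA a mu ^+ 2 - modeB a mu ^+ 2 = mu ^+ 2.
Proof.
move=> a0; rewrite -modeA_norm -modeB_norm -[mu ^+ 2]real_normK ?num_real//.
have := normr_ge0 mu; set x := `|mu|.
rewrite /modeA /modeB /coth le_eqVlt => /predU1P[<-|x0].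
  by rewrite eqxx subrr expr2 mul0r.
rewrite gt_eqF//; have s0 := sinh_gt0 (mulr_gt0 a0 x0).
have := cosh2B (a * x).
set c := cosh _; set s := sinh _ in s0 *; move=> cs.
have -> : (x * (c / s)) ^+ 2 - (x / s) ^+ 2 = x ^+ 2 * ((c ^+ 2 - 1) / s ^+ 2).
  by field; rewrite gt_eqF.
by rewrite -cs; field; rewrite gt_eqF.
Qed.

Lemma modeB_gt0 a mu : 0 < a -> 0 < modeB a mu.
Proof.
move=> a0; rewrite -modeB_norm; have := normr_ge0 mu; set x := `|mu|.
rewrite /modeB le_eqVlt => /predU1P[<-|x0]; first by rewrite eqxx invr_gt0.
by rewrite gt_eqF// divr_gt0// sinh_gt0// mulr_gt0.
Qed.

(** Half of the exponential growth is given up to keep the factor [y], so that [mu / sinh (a mu)] is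
    bounded down to [mu = 0]. *)
Lemma sinh_lower y : 0 <= y -> y / 4 * expR (y / 2) <= sinh y.
Proof.
move=> y0.
have -> : sinh y = expR (y / 2) * ((expR (y / 2) - expR (- y - y / 2)) / 2).
  by rewrite /sinh mulrA mulrBr -!expRD; congr ((expR _ - expR _) / 2); lra.
rewrite [leLHS]mulrC ler_wpM2l ?expR_ge0//.
have e1 := expR_ge1Dx (y / 2).
have e2 : expR (- y - y / 2) <= 1 by rewrite expR_le1; lra.
lra.
Qed.

Lemma modeB_le a mu : 0 < a ->
  modeB a mu <= 4 / a * expR (- (a / 2) * `|mu|).
Proof.
move=> a0; rewrite -modeB_norm; have := normr_ge0 mu; set x := `|mu|.
rewrite /modeB le_eqVlt => /predU1P[<-|x0].
  rewrite eqxx mulr0 expR0 mulr1 ler_peMl ?invr_ge0 ?ltW//; lra.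
have ax0 := mulr_gt0 a0 x0.
rewrite gt_eqF// ler_pdivrMr ?sinh_gt0//.
have := sinh_lower (ltW ax0).
rewrite (_ : - (a / 2) * x = - (a * x / 2)); last by field.
rewrite expRN => h.
have e0 := expR_gt0 (a * x / 2); move: (expR _) e0 h => e e0 h.
rewrite [leLHS](_ : _ = 4 / a / e * (a * x / 4 * e)); last first.
  by field; rewrite !gt_eqF.
by rewrite ler_wpM2l// !divr_ge0 ?ltW.
Qed.

Lemma modeA_defect a mu : 0 < a -> modeA a mu - `|mu| = coth_defect a `|mu|.
Proof.
move=> a0; rewrite -modeA_norm /modeA /coth_defect.
by case: ifP => [/eqP ->|_]; rewrite ?subr0// mulrBr mulr1.
Qed.

(** Both sides follow from [sinh y <= cosh y <= sinh y + 1] for [y >= 0]. *)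
Lemma modeA_bounds a mu : 0 < a ->
  `|mu| <= modeA a mu <= `|mu| + modeB a mu.
Proof.
move=> a0; rewrite -modeA_norm -modeB_norm; have := normr_ge0 mu.
set x := `|mu|.
rewrite /modeA /modeB le_eqVlt => /predU1P[<-|x0].
  by rewrite eqxx add0r lexx invr_ge0 ltW.
have ax0 := mulr_gt0 a0 x0; have s0 := sinh_gt0 ax0.
rewrite gt_eqF// /coth; apply/andP; split.
  rewrite ler_peMr ?(ltW x0)// ler_pdivlMr// mul1r /cosh /sinh.
  have := expR_gt0 (- (a * x)); lra.
have -> : x + x / sinh (a * x) = x * ((sinh (a * x) + 1) / sinh (a * x)).
  by field; rewrite gt_eqF.
rewrite ler_wpM2l ?(ltW x0)// ler_wpM2r ?invr_ge0 ?(ltW s0)// /cosh /sinh.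
have : expR (- (a * x)) <= 1 by rewrite expR_le1; lra.
lra.
Qed.

(* Discriminant of the characteristic polynomial of that matrix. *)
Definition mode_disc a rho mu : R :=
  modeA a mu ^+ 2 * (rho^-1 - 1) ^+ 2 + 4 * modeB a mu ^+ 2 / rho.

(** The value [b = true] selects the larger root, the one near [|mu| / rho]. *)
Definition mode_eig a rho mu b : R :=
  (modeA a mu * (1 + rho^-1) + (-1) ^+ (~~ b) * Num.sqrt (mode_disc a rho mu)) / 2.

Definition free_eig rho mu b : R := if b then `|mu| / rho else `|mu|.

Lemma mode_disc_gt0 a rho mu : 0 < a -> 0 < rho -> 0 < mode_disc a rho mu.
Proof.
move=> a0 r0; rewrite /mode_disc ltr_wpDl//.
  by rewrite mulr_ge0 ?sqr_ge0.
by rewrite !(divr_gt0, mulr_gt0, exprn_gt0) ?modeB_gt0.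
Qed.

(** The characteristic equation multiplied by [rho], with the determinant simplified by
    [modeABB]. *)
Lemma mode_eig_charpoly a rho mu b : 0 < a -> 0 < rho ->
  rho * mode_eig a rho mu b ^+ 2
    - modeA a mu * (1 + rho) * mode_eig a rho mu b + mu ^+ 2 = 0.
Proof.
move=> a0 r0; rewrite -(modeABB mu a0) /mode_eig.
have := sqr_sqrtr (ltW (mode_disc_gt0 mu a0 r0)).
have : ((-1) ^+ (~~ b) : R) ^+ 2 = 1 by rewrite sqrr_sign.
set e := (-1) ^+ _; set s := Num.sqrt _ => e1 s1.
have : s ^+ 2 = modeA a mu ^+ 2 * (rho^-1 - 1) ^+ 2 + 4 * modeB a mu ^+ 2 / rho.
  by rewrite s1.
move: (modeA a mu) (modeB a mu) => A B s2.
have -> : rho * ((A * (1 + rho^-1) + e * s) / 2) ^+ 2 -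
   A * (1 + rho) * ((A * (1 + rho^-1) + e * s) / 2) + (A ^+ 2 - B ^+ 2) =
   rho / 4 * (A ^+ 2 * (1 + rho^-1) ^+ 2 + 2 * A * (1 + rho^-1) * e * s
     + e ^+ 2 * s ^+ 2)
     - A * (1 + rho) * ((A * (1 + rho^-1) + e * s) / 2) + (A ^+ 2 - B ^+ 2).
  by field; rewrite gt_eqF.
by rewrite e1 s2; field; rewrite gt_eqF.
Qed.

Lemma mode_eig_lt a rho mu : 0 < a -> 0 < rho ->
  mode_eig a rho mu false < mode_eig a rho mu true.
Proof.
move=> a0 r0; rewrite /mode_eig /= expr1 expr0.
have : 0 < Num.sqrt (mode_disc a rho mu) by rewrite sqrtr_gt0 mode_disc_gt0.
by rewrite ltr_pM2r// ltrD2l mulN1r mul1r; lra.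
Qed.

Lemma mode_eig_sum a rho mu :
  mode_eig a rho mu false + mode_eig a rho mu true = modeA a mu * (1 + rho^-1).
Proof. by rewrite /mode_eig /= expr1 expr0; lra. Qed.

(** The root of the discriminant lies between [A (1 / rho - 1)] and the same plus [2 B / rho], so
    the eigenvalues are within [B / rho] of [A] and [A / rho]. By [modeA_bounds], [A] is in turn
    within [B] of [|mu|]. *)
Lemma mode_eig_approx a rho mu b : 0 < a -> 0 < rho < 1 ->
  `|mode_eig a rho mu b - free_eig rho mu b| <= 2 / rho * modeB a mu.
Proof.
move=> a0 /andP[r0 r1].
have /andP[A1 A2] := modeA_bounds mu a0.
have B0 := modeB_gt0 mu a0.
have x0 := normr_ge0 mu.
have ri1 : 1 <= rho^-1 by rewrite invr_ge1// ?unitfE ?gt_eqF// ltW.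
rewrite /mode_eig /free_eig /mode_disc.
move: (modeA a mu) (modeB a mu) `|mu| A1 A2 B0 x0 => A B x A1 A2 B0 x0.
set s := Num.sqrt _.
have A0 : 0 <= A := le_trans x0 A1.
have s1 : A * (rho^-1 - 1) <= s.
  rewrite -[leLHS]ger0_norm ?mulr_ge0 ?subr_ge0// -sqrtr_sqr ler_wsqrtr//.
  rewrite exprMn lerDl !mulr_ge0 ?sqr_ge0//; lra.
have s2 : s <= A * (rho^-1 - 1) + 2 * (B / rho).
  have h : 0 <= A * (rho^-1 - 1) + 2 * (B / rho).
    by rewrite addr_ge0// mulr_ge0 ?subr_ge0// divr_ge0// ltW.
  rewrite -[leRHS]ger0_norm// -sqrtr_sqr ler_wsqrtr//.
  have h1 : 0 <= A * (rho^-1 - 1) * (2 * (B / rho)) * 2.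
    by rewrite !mulr_ge0 ?subr_ge0// ?invr_ge0 ?(ltW r0) ?(ltW B0).
  have -> : (A * (rho^-1 - 1) + 2 * (B / rho)) ^+ 2 =
      A ^+ 2 * (rho^-1 - 1) ^+ 2 + A * (rho^-1 - 1) * (2 * (B / rho)) * 2 +
      (2 * (B / rho)) ^+ 2 by ring.
  rewrite -addrA lerD2l.
  have h2 : 4 * B ^+ 2 / rho <= (2 * (B / rho)) ^+ 2.
    rewrite !exprMn exprVn [2 ^+ 2](_ : _ = 4); last by ring.
    rewrite -!mulrA ler_pM2l// ler_pM2l ?exprn_gt0// expr2.
    by rewrite invfM mulrA ler_peMr// divr_ge0 ?ltW.
  lra.
have e1 : 2 / rho * B = 2 * (B / rho) by ring.
rewrite e1 ler_norml.
have xA : x / rho <= A / rho by rewrite ler_wpM2r// invr_ge0 ltW.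
have xAB : A / rho <= x / rho + B / rho by rewrite -mulrDl ler_wpM2r// invr_ge0 ltW.
have BB : B <= B / rho by rewrite ler_peMr// ltW.
have e2 : A * (rho^-1 - 1) = A / rho - A by ring.
have e3 : A * (1 + rho^-1) = A + A / rho by ring.
rewrite e2 in s1 s2; rewrite e3; move: s1 s2 xA xAB BB.
move: (A / rho) (B / rho) (x / rho) => Ar Br xr s1 s2 xA xAB BB.
case: b => /=; rewrite ?expr0 ?expr1 ?mul1r ?mulN1r; apply/andP; split; lra.
Qed.

End Mode.

(** * Enumeration of the modes and heat trace of the uncoupled circles *)

Section Modes.
Context {R : realType}.
Implicit Types (nu rho a t : R) (b : bool) (j k p : nat).

(** The order is 0, 1, -1, 2, -2, ...: for [0 <= nu < 1] even and odd indices then give the two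
    progressions [j + nu] and [j + 1 - nu] of values of [|m - nu|]. *)
Definition modeZ j : int := if odd j then Posz j./2.+1 else - Posz j./2.

Lemma modeZ_double j : modeZ j.*2 = - Posz j.
Proof. by rewrite /modeZ odd_double doubleK. Qed.

Lemma modeZ_doubleS j : modeZ j.*2.+1 = Posz j.+1.
Proof. by rewrite /modeZ /= odd_double /= uphalf_double. Qed.

Lemma modeZ_bij : set_bij [set: nat] [set: int] modeZ.
Proof.
split => //.
- move=> i j _ _ /=; rewrite -[in X in X -> _](odd_double_half i).
  rewrite -[in X in X -> _](odd_double_half j).
  move=> h; rewrite -(odd_double_half i) -(odd_double_half j); move: h.
  case: (odd i); case: (odd j); rewrite ?add1n ?add0n ?modeZ_double ?modeZ_doubleS; lia.
- move=> [m|m] _ /=.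
    case: m => [|m]; first by exists 0.
    by exists m.*2.+1 => //; rewrite modeZ_doubleS.
  by exists m.+1.*2 => //; rewrite modeZ_double NegzE.
Qed.

Definition mode_mu nu j : R := (modeZ j)%:~R - nu.

Lemma mode_mu_double nu j : 0 <= nu -> `|mode_mu nu j.*2| = j%:R + nu.
Proof.
move=> nu0; rewrite /mode_mu modeZ_double -normrN opprB rmorphN/= opprK addrC.
by rewrite ger0_norm// addr_ge0.
Qed.

Lemma mode_mu_doubleS nu j : nu < 1 -> `|mode_mu nu j.*2.+1| = j%:R + 1 - nu.
Proof.
move=> nu1; rewrite /mode_mu modeZ_doubleS -[_%:~R]/(j.+1%:R) -natr1.
by rewrite ger0_norm// subr_ge0; have : 0 <= j%:R :> R by []; lra.
Qed.

Lemma mode_mu_ge nu j : 0 <= nu < 1 -> j%:R / 2 - 1 <= `|mode_mu nu j|.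
Proof.
move=> /andP[nu0 nu1]; rewrite -{1 2}(odd_double_half j).
case: (odd j); rewrite ?add1n ?add0n ?mode_mu_double ?mode_mu_doubleS//.
  by rewrite -natr1 -muln2 natrM; lra.
by rewrite -muln2 natrM; lra.
Qed.

(** Each mode occurs twice, once per eigenvalue, whence [k./2]. Linear growth of [|mu|] gives a
    geometric majorant; its constant [expR (2 * c)] absorbs the rounding in [k./2] and the shift in
    [mode_mu_ge]. *)
Lemma cvg_series_exp_mode nu (c : R) : 0 <= nu < 1 -> 0 < c ->
  cvgn (series (fun k => expR (- c * `|mode_mu nu k./2|))).
Proof.
move=> hnu c0.
have z1 : `|expR (- (c / 4))| < 1.
  by rewrite ger0_norm ?expR_ge0// expR_lt1; lra.
have := @is_cvg_geometric_series R (expR (2 * c)) _ z1.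
apply: series_le_cvg => k /=; first exact: expR_ge0.
  by rewrite mulr_ge0 ?exprn_ge0 ?expR_ge0.
rewrite -expRM_natl -expRD ler_expR.
have := mode_mu_ge k./2 hnu.
have h : k%:R <= 2 * (k./2)%:R + 1 :> R.
  by rewrite -natrM natr1 ler_nat; lia.
set x := `|_|; move: h.
move: (k%:R : R) (k./2%:R : R) => kk k2 h1 h2; nra.
Qed.

(* Both families of exponents [m - nu] and [nu - m] are geometric. *)
Lemma sum_exp_mode nu t : 0 <= nu < 1 -> 0 < t ->
  series (fun j => expR (- t * `|mode_mu nu j|)) @ \oo -->
    cosh (t * (nu - 2^-1)) / sinh (t / 2).
Proof.
move=> hnu t0; have /andP[nu0 nu1] := hnu.
(* [cvg_series_exp_mode] lists every mode twice, so its pairs are twice the terms needed here. *)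
have cv : cvgn (series (fun j => expR (- t * `|mode_mu nu j|))).
  have := cvg_series_exp_mode hnu t0.
  move/cvg_series_pair.
  rewrite (_ : (fun j => _ + _) = (fun j => 2 * expR (- t * `|mode_mu nu j|))).
    move/(@cvg_seriesZ _ _ 2^-1) => h; apply/cvg_ex; eexists.
    move: h; rewrite (_ : (fun n => 2^-1 * _) = (fun j => expR (- t * `|mode_mu nu j|))).
      exact.
    by apply/funext => n; rewrite mulrA mulVf// mul1r.
  by apply/funext => j /=; rewrite doubleK uphalf_double; ring.
have z1 : `|expR (- t)| < 1.
  by rewrite ger0_norm ?expR_ge0// expR_lt1; lra.
have h := @cvg_geometric_series R (expR (- t * nu) + expR (- t * (1 - nu))) _ z1.
(* A factor [expR (t / 2)] is taken out of both [cosh] and [sinh]. *)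
have -> : cosh (t * (nu - 2^-1)) / sinh (t / 2) =
    (expR (- t * nu) + expR (- t * (1 - nu))) / (1 - expR (- t)).
  have e0 := expR_gt0 (t / 2).
  rewrite /cosh /sinh invfM invrK mulrACA mulVf// mulr1.
  have -> : expR (t * (nu - 2^-1)) + expR (- (t * (nu - 2^-1))) =
      (expR (- t * nu) + expR (- t * (1 - nu))) * expR (t / 2).
    by rewrite mulrDl -!expRD addrC; congr (expR _ + expR _); lra.
  have -> : expR (t / 2) - expR (- (t / 2)) = (1 - expR (- t)) * expR (t / 2).
    by rewrite mulrBl mul1r -expRD; congr (_ - expR _); lra.
  by rewrite invfM mulrACA divff ?mulr1// gt_eqF.
have := cvg_series_pair cv.
rewrite (_ : (fun j => _ + _) =
  geometric (expR (- t * nu) + expR (- t * (1 - nu))) (expR (- t))).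
  by move=> h'; rewrite (cvg_unique _ h h').
apply/funext => j; rewrite mode_mu_double// mode_mu_doubleS// /geometric /=.
by rewrite -expRM_natl mulrDl -!expRD; congr (expR _ + expR _); ring.
Qed.

(* [heat_free] are the eigenvalues without the coupling of the two circles. *)
Definition heat_eig nu rho a k : R := mode_eig a rho (mode_mu nu k./2) (odd k).
Definition heat_free nu rho k : R := free_eig rho (mode_mu nu k./2) (odd k).

(** The inner circle contributes the sum of the outer one at time [t / rho]. *)
Lemma sum_exp_free nu rho t : 0 <= nu < 1 -> 0 < rho < 1 -> 0 < t ->
  series (fun k => expR (- t * heat_free nu rho k)) @ \oo -->
    cosh (t * (nu - 2^-1)) / sinh (t / 2)
      + cosh (t / rho * (nu - 2^-1)) / sinh (t / (2 * rho)).
Proof.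
move=> hnu /andP[r0 r1] t0.
have tr0 : 0 < t / rho by rewrite divr_gt0.
have := cvg_seriesD (sum_exp_mode hnu t0) (sum_exp_mode hnu tr0).
have -> : t / rho / 2 = t / (2 * rho) by field; rewrite gt_eqF.
have cv : cvgn (series (fun k => expR (- t * heat_free nu rho k))).
  have := cvg_series_exp_mode hnu t0.
  apply: series_le_cvg => k; rewrite ?expR_ge0// ler_expR /heat_free /free_eig.
  case: (odd k) => //; rewrite !mulNr lerN2 ler_wpM2l ?(ltW t0)//.
  by rewrite ler_peMr// invr_ge1 ?unitfE ?gt_eqF// ltW.
have := cvg_series_pair cv.
rewrite (_ : (fun j => _ + _) = (fun n =>
  expR (- t * `|mode_mu nu n|) + expR (- (t / rho) * `|mode_mu nu n|))).
  by move=> h h'; rewrite (cvg_unique _ h' h).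
apply/funext => j; rewrite /heat_free /= odd_double uphalf_double doubleK /=.
by congr (_ + expR _); ring.
Qed.

End Modes.

(** * Expansion of the heat trace *)

Section HeatExpansion.
Context {R : realType}.
Implicit Types (nu rho a t x y : R) (b : bool) (j k p : nat).

Lemma norm_exprB x y (M : R) p : `|x| <= M -> `|y| <= M ->
  `|x ^+ p.+1 - y ^+ p.+1| <= p.+1%:R * M ^+ p * `|x - y|.
Proof.
move=> xM yM; have M0 : 0 <= M := le_trans (normr_ge0 _) xM.
elim: p => [|p IH]; first by rewrite !expr1 expr0 !mul1r.
have -> : x ^+ p.+2 - y ^+ p.+2 =
    x * (x ^+ p.+1 - y ^+ p.+1) + (x - y) * y ^+ p.+1.
  by rewrite !exprS; ring.
apply: le_trans (ler_normD _ _) _; rewrite !normrM.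
apply: (@le_trans _ _ (M * (p.+1%:R * M ^+ p * `|x - y|)
    + `|x - y| * M ^+ p.+1)).
  by rewrite lerD ?ler_pM// normrX lerXn2r ?nnegrE.
by rewrite le_eqVlt; apply/orP; left; apply/eqP; rewrite -[p.+2%:R]natr1 exprS; ring.
Qed.

Lemma expr_div_fact x p : 0 <= x -> x ^+ p / p`!%:R <= expR x.
Proof.
move=> x0; case: p => [|p].
  by rewrite expr0 fact0 divr1; have := expR_ge1Dx x; lra.
by have := expR_ge1Dxn p x0; lra.
Qed.

(** The coefficient of [t^p] in [exp (- t lam_k) - exp (- t lam0_k)]. *)
Definition heat_coef nu rho a k p : R :=
  (-1) ^+ p / p`!%:R * (heat_eig nu rho a k ^+ p - heat_free nu rho k ^+ p).

Lemma heat_coef0 nu rho a k : heat_coef nu rho a k 0 = 0.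
Proof. by rewrite /heat_coef !expr0 subrr mulr0. Qed.

Lemma heat_eig_approx nu rho a k : 0 < a -> 0 < rho < 1 ->
  `|heat_eig nu rho a k - heat_free nu rho k|
    <= 8 / (a * rho) * expR (- (a / 2) * `|mode_mu nu k./2|).
Proof.
move=> a0 hr; have /andP[r0 r1] := hr.
apply: le_trans (mode_eig_approx _ _ a0 hr) _.
apply: le_trans (ler_wpM2l _ (modeB_le _ a0)) _; first by rewrite divr_ge0// ltW.
rewrite mulrA ler_wpM2r ?expR_ge0// le_eqVlt; apply/orP; left; apply/eqP.
by field; rewrite !gt_eqF.
Qed.

Lemma heat_free_bounds nu rho k : 0 < rho < 1 ->
  `|mode_mu nu k./2| <= heat_free nu rho k <= `|mode_mu nu k./2| / rho.
Proof.
move=> /andP[r0 r1]; rewrite /heat_free /free_eig.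
have h : `|mode_mu nu k./2| <= `|mode_mu nu k./2| / rho.
  by rewrite ler_peMr// invr_ge1 ?unitfE ?gt_eqF// ltW.
by case: (odd k); rewrite lexx h.
Qed.

Lemma heat_eig_ge nu rho a k : 0 < a -> 0 < rho < 1 ->
  `|mode_mu nu k./2| - 8 / (a * rho) <= heat_eig nu rho a k.
Proof.
move=> a0 hr; have := heat_eig_approx nu k a0 hr.
have /andP[h _] := heat_free_bounds nu k hr; have /andP[r0 r1] := hr.
have : expR (- (a / 2) * `|mode_mu nu k./2|) <= 1.
  by rewrite expR_le1 mulNr oppr_le0 mulr_ge0// divr_ge0// ltW.
have : 0 < 8 / (a * rho) by rewrite divr_gt0// mulr_gt0.
move: (8 / _) (expR _) => c e c0 e1; rewrite ler_norml => /andP[h1 _].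
have : c * e <= c by rewrite ler_piMr// ltW.
lra.
Qed.

Lemma cvg_series_heat nu rho a t : 0 <= nu < 1 -> 0 < a -> 0 < rho < 1 ->
  0 < t -> cvgn (series (fun k => expR (- t * heat_eig nu rho a k))).
Proof.
move=> hnu a0 hr t0; have /cvg_ex[/= l hl] := cvg_series_exp_mode hnu t0.
have h := @cvg_seriesZ R _ (expR (t * (8 / (a * rho)))) _ hl.
have /series_le_cvg : cvgn (series (fun n =>
    expR (t * (8 / (a * rho))) * expR (- t * `|mode_mu nu n./2|))).
  by apply/cvg_ex; eexists; exact: h.
apply => k; rewrite ?mulr_ge0 ?expR_ge0//.
rewrite -expRD ler_expR.
by have := heat_eig_ge nu k a0 hr; move: (8 / _) `|_| => c x g; nra.
Qed.

(** With [x = |mu|], the eigenvalues of the mode, coupled or not, are at most [C (x + 1)] in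
    modulus. [Q] is such that [C (x + 1) = Q w] for [w = a (x + 1) / 4]; then [w^p / p! <= exp w]
    uses up half of the decay [exp (- a x / 2)], and [u] keeps the other half. The division by [Q]
    in [u] is there because a difference of powers of order [p + 1] yields only [Q^p]. *)
Let C rho a : R := (1 + 8 / a) / rho.
Let Q rho a : R := 4 * C rho a / a.
Let u nu rho a k : R := 8 / (a * rho) * expR (a / 4) / Q rho a
  * expR (- (a / 4) * `|mode_mu nu k./2|).

Let C_gt0 rho a : 0 < a -> 0 < rho < 1 -> 0 < C rho a.
Proof. by move=> a0 /andP[r0 r1]; rewrite divr_gt0// addr_gt0// divr_gt0. Qed.

Let Q_gt0 rho a : 0 < a -> 0 < rho < 1 -> 0 < Q rho a.
Proof. by move=> a0 hr; rewrite divr_gt0// mulr_gt0// C_gt0. Qed.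

Let u_ge0 nu rho a k : 0 < a -> 0 < rho < 1 -> 0 <= u nu rho a k.
Proof.
move=> a0 hr; have /andP[r0 r1] := hr; have := Q_gt0 a0 hr => Q0.
by rewrite /u !mulr_ge0 ?expR_ge0 ?invr_ge0 ?(ltW Q0)// ltW// mulr_gt0.
Qed.

Let coef_le nu rho a k p : 0 < a -> 0 < rho < 1 ->
  `|heat_coef nu rho a k p| <= u nu rho a k * Q rho a ^+ p.
Proof.
move=> a0 hr; have /andP[r0 r1] := hr; have Q0 := Q_gt0 a0 hr.
case: p => [|p].
  by rewrite heat_coef0 normr0 expr0 mulr1 u_ge0.
set x := `|mode_mu nu k./2|; have x0 : 0 <= x by exact: normr_ge0.
pose M : R := C rho a * (x + 1).
have C0 := C_gt0 a0 hr.
have M0 : 0 <= M by rewrite mulr_ge0 ?(ltW C0)// addr_ge0.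
have CE : M = x / rho + 8 / (a * rho) + (1 / rho + 8 / (a * rho) * x).
  by rewrite /M /C; field; rewrite !gt_eqF.
have c8 : 0 < 8 / (a * rho) by rewrite divr_gt0// mulr_gt0.
have c1 : 0 < 1 / rho by rewrite divr_gt0.
have c8x : 0 <= 8 / (a * rho) * x by rewrite mulr_ge0// ltW.
have /andP[f1 f2] := heat_free_bounds nu k hr; rewrite -/x in f1 f2.
have fM : `|heat_free nu rho k| <= M.
  rewrite ger0_norm ?(le_trans x0)// CE; apply: le_trans f2 _; lra.
have ap := heat_eig_approx nu k a0 hr; rewrite -/x in ap.
have lM : `|heat_eig nu rho a k| <= M.
  rewrite -[heat_eig _ _ _ _](subrK (heat_free nu rho k)).
  apply: le_trans (ler_normD _ _) _.
  rewrite [X in _ + X]ger0_norm ?(le_trans x0)//.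
  have : expR (- (a / 2) * x) <= 1.
    by rewrite expR_le1 mulNr oppr_le0 mulr_ge0// divr_ge0// ltW.
  move=> e1; have : 8 / (a * rho) * expR (- (a / 2) * x) <= 8 / (a * rho).
    by rewrite ler_piMr// ltW.
  move=> e2; have := le_trans ap e2; rewrite CE; lra.
rewrite /heat_coef normrM normrM normrX normrN1 expr1n mul1r.
rewrite ger0_norm ?invr_ge0//.
apply: le_trans (ler_wpM2l _ (norm_exprB p lM fM)) _; first by rewrite invr_ge0.
pose w : R := a / 4 * (x + 1).
have w0 : 0 < w by rewrite mulr_gt0 ?divr_gt0// ltr_wpDl.
have MQ : M = Q rho a * w by rewrite /M /Q /w; field; rewrite gt_eqF.
(* The factor [p + 1] of the mean value bound cancels against [(p + 1)!]. *)
rewrite [leLHS](_ : _ =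
  M ^+ p / p`!%:R * `|heat_eig nu rho a k - heat_free nu rho k|); last first.
  rewrite factS natrM; field.
  by rewrite nat1r !pnatr_eq0 -lt0n fact_gt0.
apply: le_trans (ler_wpM2l _ ap) _; first by rewrite divr_ge0 ?exprn_ge0.
rewrite MQ exprMn -[_ * _ / _]mulrA.
apply: le_trans (ler_wpM2r _ (ler_wpM2l _ (expr_div_fact p (ltW w0)))) _.
- by rewrite mulr_ge0 ?expR_ge0// ltW.
- by rewrite exprn_ge0// ltW.
rewrite le_eqVlt; apply/orP; left; apply/eqP.
rewrite /u -/x exprS.
have -> : expR w = expR (a / 4) * expR (a / 4 * x).
  by rewrite -expRD; congr expR; rewrite /w; ring.
have -> : expR (- (a / 2) * x) = expR (- (a / 4) * x) / expR (a / 4 * x).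
  by rewrite -expRN -expRD; congr expR; field.
have := expR_gt0 (a / 4 * x); move: (expR (a / 4 * x)) => e e0.
by field; rewrite !gt_eqF.
Qed.

Lemma cvg_series_heat_coef nu rho a : 0 <= nu < 1 -> 0 < a -> 0 < rho < 1 ->
  exists q U : R, 0 <= q /\ exists u : R^nat,
   [/\ forall k, 0 <= u k, series u @ \oo --> U &
       forall k p, `|heat_coef nu rho a k p| <= u k * q ^+ p].
Proof.
move=> hnu a0 hr; have a40 : 0 < a / 4 by rewrite divr_gt0.
have /cvg_ex[/= l hl] := cvg_series_exp_mode hnu a40.
exists (Q rho a), (8 / (a * rho) * expR (a / 4) / Q rho a * l).
split; first by rewrite ltW// Q_gt0.
exists (u nu rho a); split=> [k||k p]; [exact: u_ge0| |exact: coef_le].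
by apply: cvg_seriesZ.
Qed.

Lemma heat_coef_exp nu rho a t k :
  series (fun p => heat_coef nu rho a k p * t ^+ p) @ \oo -->
    expR (- t * heat_eig nu rho a k) - expR (- t * heat_free nu rho k).
Proof.
have := cvg_seriesB (@cvg_series_expR R (- t * heat_eig nu rho a k))
  (@cvg_series_expR R (- t * heat_free nu rho k)).
rewrite (_ : (fun n => _ - _) = (fun p => heat_coef nu rho a k p * t ^+ p))//.
apply/funext => p.
by rewrite /exp_coeff /= /heat_coef !exprMn [(- t) ^+ p]exprNn; ring.
Qed.

End HeatExpansion.

(** * Small-time asymptotics and the linear coefficient *)

Section FinalExpansion.
Context {R : realType}.
Implicit Types (nu rho a t x : R) (k p : nat).

Lemma expR_taylor3 x : `|x| <= 2^-1 ->
  `|expR x - (1 + x + x ^+ 2 / 2 + x ^+ 3 / 6)| <= 2 * `|x| ^+ 4.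
Proof.
move=> x2.
have h : series (fun p => (p`!%:R)^-1 * x ^+ p) @ \oo --> expR x.
  have := @cvg_series_expR R x.
  by rewrite (_ : exp_coeff x = (fun p => (p`!%:R)^-1 * x ^+ p))// exp_coeffE.
have := @power_series_tail R (fun p => (p`!%:R)^-1) 1 1 x (expR x) 4 ler01 ler01.
rewrite !mulr1 => /(_ _ x2 h); rewrite !big_ord_recr big_ord0 /=.
have -> : 0 + (0`!%:R)^-1 * x ^+ 0 + (1`!%:R)^-1 * x ^+ 1 + (2`!%:R)^-1 * x ^+ 2
   + (3`!%:R)^-1 * x ^+ 3 = 1 + x + x ^+ 2 / 2 + x ^+ 3 / 6 :> R.
  by rewrite !factS fact0 expr0 expr1 /=; field.
apply => p; rewrite expr1n mulr1 ger0_norm ?invr_ge0//.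
by rewrite invf_le1 ?ltr0n ?fact_gt0// ler1n fact_gt0.
Qed.

Lemma cosh_taylor x : `|x| <= 2^-1 ->
  `|cosh x - (1 + x ^+ 2 / 2)| <= 2 * `|x| ^+ 4.
Proof.
move=> x2; have h1 := expR_taylor3 x2.
have := @expR_taylor3 (- x); rewrite normrN => /(_ x2).
move: h1; rewrite /cosh (sqrrN x) [(- x) ^+ 3](_ : _ = - x ^+ 3); last by ring.
move: (x ^+ 2) (x ^+ 3) (2 * _) => x2' x3 K; rewrite !ler_norml.
by move=> /andP[? ?] /andP[? ?]; apply/andP; split; lra.
Qed.

Lemma sinh_taylor x : `|x| <= 2^-1 ->
  `|sinh x - (x + x ^+ 3 / 6)| <= 2 * `|x| ^+ 4.
Proof.
move=> x2; have h1 := expR_taylor3 x2.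
have := @expR_taylor3 (- x); rewrite normrN => /(_ x2).
move: h1; rewrite /sinh (sqrrN x) [(- x) ^+ 3](_ : _ = - x ^+ 3); last by ring.
move: (x ^+ 2) (x ^+ 3) (2 * _) => x2' x3 K; rewrite !ler_norml.
by move=> /andP[? ?] /andP[? ?]; apply/andP; split; lra.
Qed.

(** Put [s = t / 2], so that [s] and [|t b|] are at most 1/2 and the Taylor bounds apply. After
    multiplication by [sinh s] the Taylor polynomials agree up to [s^4 g / 3] with [g = b^2 - 1/12],
    and [sinh s >= s / 4] controls the division back. *)
Lemma cosh_div_sinh_expansion (b t : R) : `|b| <= 2^-1 -> 0 < t <= 1 ->
  `|cosh (t * b) / sinh (t / 2) - (2 / t + (b ^+ 2 - 12^-1) * t)| <= 8 * t ^+ 2.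
Proof.
move=> hb /andP[t0 t1]; have [s sE] : exists s, s = t / 2 by exists (t / 2).
have s0 : 0 < s by rewrite sE divr_gt0.
have s1 : s <= 2^-1 by lra.
have tE : t = 2 * s by lra.
have S0 := sinh_gt0 s0.
have S4 : s / 4 <= sinh s.
  apply: le_trans (sinh_lower (ltW s0)).
  have e1 : 1 <= expR (s / 2) by have := expR_ge1Dx (s / 2); lra.
  by apply: ler_peMr => //; lra.
have tbs : `|t * b| <= s.
  rewrite normrM ger0_norm ?(ltW t0)// tE; move: (`|b|) hb => c hc; nra.
have hc := cosh_taylor (le_trans tbs s1).
have {}hc : `|cosh (t * b) - (1 + 2 * s ^+ 2 * b ^+ 2)| <= 2 * s ^+ 4.
  rewrite [2 * s ^+ 2 * _](_ : _ = (t * b) ^+ 2 / 2); last first.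
    by rewrite tE; field.
  by apply: le_trans hc _; rewrite ler_pM2l// lerXn2r ?nnegrE// ltW.
have hs := @sinh_taylor s; rewrite ger0_norm ?(ltW s0)// in hs.
have {}hs := hs s1.
have g1 : `|b ^+ 2 - 12^-1| <= 3^-1.
  have : 0 <= b ^+ 2 <= 4^-1.
    rewrite sqr_ge0/= -real_normK ?num_real//.
    rewrite (_ : 4^-1 = 2^-1 ^+ 2 :> R); last by field.
    by rewrite lerXn2r ?nnegrE.
  by rewrite ler_norml => /andP[? ?]; apply/andP; split; lra.
rewrite -sE [2 / t](_ : _ = s^-1); last by rewrite tE; field; rewrite gt_eqF.
have -> : cosh (t * b) / sinh s - (s^-1 + (b ^+ 2 - 12^-1) * t) =
   (cosh (t * b) - sinh s * (s^-1 + (b ^+ 2 - 12^-1) * t)) / sinh s.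
  by field; rewrite !gt_eqF.
rewrite normrM normfV [X in _ / X]ger0_norm ?(ltW S0)// ler_pdivrMr//.
have : 8 * t ^+ 2 * (s / 4) <= 8 * t ^+ 2 * sinh s.
  by rewrite ler_wpM2l// mulr_ge0// sqr_ge0.
apply: le_trans.
have e8 : 8 * t ^+ 2 * (s / 4) = 8 * s ^+ 3 by rewrite tE; field.
rewrite e8.
set e1 := cosh _ - _ in hc; set e2 := sinh _ - _ in hs.
set g := b ^+ 2 - 12^-1 in g1 *.
(* The four terms are at most 1, 2, 1 and 1 times [s ^+ 3], within the available [8 * s ^+ 3]. *)
have -> : cosh (t * b) - sinh s * (s^-1 + g * t) =
   e1 - e2 / s - 2 * s * g * e2 - s ^+ 4 * g / 3.
  rewrite (_ : cosh (t * b) = e1 + (1 + 2 * s ^+ 2 * b ^+ 2)); last first.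
    by rewrite /e1 subrK.
  rewrite (_ : sinh s = e2 + (s + s ^+ 3 / 6)); last by rewrite /e2 subrK.
  by rewrite tE /g; field; rewrite gt_eqF.
have f2 : `|e2 / s| <= 2 * s ^+ 3.
  rewrite normrM normfV [X in _ / X]ger0_norm ?(ltW s0)// ler_pdivrMr//.
  by apply: le_trans hs _; rewrite le_eqVlt; apply/orP; left; apply/eqP; ring.
have s4 : s ^+ 4 <= 2^-1 * s ^+ 3.
  by rewrite exprS ler_wpM2r// exprn_ge0// ltW.
have s30 : 0 <= s ^+ 3 by rewrite exprn_ge0// ltW.
have f3 : `|2 * s * g * e2| <= s ^+ 3.
  rewrite !normrM [`|2|]ger0_norm// [`|s|]ger0_norm ?(ltW s0)//.
  apply: (@le_trans _ _ (2 * 2^-1 * 3^-1 * (2 * s ^+ 4))); last by lra.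
  by rewrite ler_pM// ?mulr_ge0// ?(ltW s0)// ler_pM// ?mulr_ge0// ?(ltW s0)//
    ler_pM// ltW.
have f4 : `|s ^+ 4 * g / 3| <= s ^+ 3.
  have s40 : 0 <= s ^+ 4 by rewrite exprn_ge0// ltW.
  have := g1; rewrite !ler_norml => /andP[? ?]; apply/andP; split; nra.
have f1 : `|e1| <= s ^+ 3 by apply: le_trans hc _; lra.
move: f1 f2 f3 f4.
move: (e2 / s) (2 * s * g * e2) (s ^+ 4 * g / 3) => ? ? ?.
by rewrite !ler_norml => /andP[? ?] /andP[? ?] /andP[? ?] /andP[? ?];
  apply/andP; split; lra.
Qed.

(** The two eigenvalues of a mode together contribute [- (1 + 1 / rho) (A - |mu|)], by the trace of
    the matrix, and [A - |mu|] is the [coth] defect. The defects are nonnegative, so summing along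
    [modeZ] gives the unordered sum over the integers. *)
Lemma esum_coth_defect nu rho a : 0 <= nu < 1 -> 0 < a -> 0 < rho < 1 ->
  forall l : R, series (fun k => heat_coef nu rho a k 1) @ \oo --> l ->
  (l%:E = (- (1 + rho^-1)%:E *
     \esum_(m in [set: int]) (coth_defect a `|m%:~R - nu|)%:E))%E.
Proof.
move=> hnu a0 hr l hl; have /andP[r0 r1] := hr.
have d0 (mu : R) : 0 <= coth_defect a `|mu|.
  by rewrite -modeA_defect// subr_ge0; have /andP[] := modeA_bounds mu a0.
have c0 : 0 < 1 + rho^-1 by rewrite addr_gt0// invr_gt0.
have h1 : series (fun j => coth_defect a `|mode_mu nu j|) @ \oo -->
    - (1 + rho^-1)^-1 * l.
  have := @cvg_seriesZ R _ (- (1 + rho^-1)^-1) _ (cvg_series_pair hl).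
  rewrite (_ : (fun n => _ * _) = (fun j => coth_defect a `|mode_mu nu j|))//.
  apply/funext => j.
  rewrite /heat_coef /heat_eig /heat_free !expr1 divr1 /= odd_double doubleK.
  rewrite uphalf_double /free_eig.
  have := mode_eig_sum a rho (mode_mu nu j).
  rewrite -modeA_defect//.
  move: (mode_eig _ _ _ true) (mode_eig _ _ _ false) (modeA _ _) => lt lf A h.
  rewrite (_ : lf = A * (1 + rho^-1) - lt); last by rewrite -h addrK.
  rewrite /=; field; apply/andP; split; lra.
rewrite (reindex_esum _ _ _ _ modeZ_bij) -nneseries_esumT; last first.
  by move=> n; rewrite lee_fin d0.
have -> : (\sum_(0 <= j <oo) (coth_defect a `|(modeZ j)%:~R - nu|)%:E =
    (- (1 + rho^-1)^-1 * l)%:E)%E.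
  apply/cvg_lim => //; rewrite -(cvg_lim _ h1)//.
  have -> : (fun n => \sum_(0 <= j < n) (coth_defect a `|(modeZ j)%:~R - nu|)%:E)%E
     = EFin \o series (fun j => coth_defect a `|mode_mu nu j|).
    by apply/funext => n; rewrite /= sumEFin.
  by apply/fine_cvgP; split; [exact: nearW|rewrite (cvg_lim _ h1)].
by rewrite -EFinN -EFinM mulrA mulrNN divff ?mul1r// gt_eqF.
Qed.

Theorem heat_trace_expansion nu rho a (Tr : R -> R) :
  0 <= nu < 1 -> 0 < a -> 0 < rho < 1 ->
  (forall t, 0 < t ->
     series (fun k => expR (- t * heat_eig nu rho a k)) @ \oo --> Tr t) ->
  exists c : nat -> R,
    [/\ \forall t \near 0^'+,
          series (fun p => c p.+1 * t ^+ p.+1) @ \oo -->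
            Tr t - cosh (t * (nu - 2^-1)) / sinh (t / 2)
                 - cosh (t / rho * (nu - 2^-1)) / sinh (t / (2 * rho)),
        (c 1)%:E = (- (1 + rho^-1)%:E *
           \esum_(m in [set: int]) (coth_defect a `|m%:~R - nu|)%:E)%E
      & exists K : R, \forall t \near 0^'+,
          `| Tr t - ((2 + 2 * rho) / t +
               ((1 + rho - 6 * nu - 6 * rho * nu + 6 * nu ^+ 2
                  + 6 * rho * nu ^+ 2) / (6 * rho) + c 1) * t) |
          <= K * t ^+ 2].
Proof.
move=> hnu a0 hr hTr; have /andP[r0 r1] := hr.
have [q [U [q0 [u [u0 uU hu]]]]] := cvg_series_heat_coef hnu a0 hr.
pose c p : R := limn (series (fun k => heat_coef nu rho a k p)).
have hc p : series (fun k => heat_coef nu rho a k p) @ \oo --> c p.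
  have h : series (fun k => q ^+ p * u k) @ \oo --> q ^+ p * U by exact: cvg_seriesZ.
  have [|l hl _] := @cvg_series_dominated R (fun k => heat_coef nu rho a k p) _ _ _ h.
    by move=> k; rewrite mulrC.
  by rewrite /c (cvg_lim _ hl).
have c0 : c 0%N = 0.
  apply/cvg_lim => //; rewrite (_ : series _ = (fun=> 0)); first exact: cvg_cst.
  apply/funext => n; rewrite seriesEnat /= big1// => i _; exact: heat_coef0.
have U0 : 0 <= U.
  rewrite -(cvg_lim _ uU)//; apply: limr_ge; first by apply/cvg_ex; exists U.
  by apply: nearW => n; rewrite seriesEnat /= sumr_ge0.
pose S t := Tr t - cosh (t * (nu - 2^-1)) / sinh (t / 2)
                 - cosh (t / rho * (nu - 2^-1)) / sinh (t / (2 * rho)).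
(* The order [P] stays free: letting it grow proves the convergence of the power series, and [P = 2]
   gives the quadratic remainder. *)
have hS t P : 0 < t -> t * q <= 2^-1 ->
    `|S t - \sum_(p < P) c p * t ^+ p| <= 2 * U * (t * q) ^+ P.
  move=> t0 tq.
  have tn : `|t| = t by rewrite ger0_norm// ltW.
  rewrite -[in leRHS]tn; apply: (@cvg_double_power_series R
    (heat_coef nu rho a) c _ u U q t (S t) P) => //.
  - by rewrite tn.
  - by move=> k; exact: heat_coef_exp.
  - rewrite /S -addrA -opprD; apply: cvg_seriesB; first exact: hTr.
    exact: sum_exp_free.
have tsmall : \forall t \near (0 : R)^'+, 0 < t /\ t * q <= 2^-1.
  near=> t; split; first by near: t; exact: nbhs_right_gt.
  have h : t <= (2 * (q + 1))^-1.
    by near: t; apply: nbhs_right_le; rewrite invr_gt0 mulr_gt0// ltr_wpDl.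
  apply: le_trans (ler_wpM2r q0 h) _.
  by rewrite ler_pdivrMl ?mulr_gt0 ?ltr_wpDl//; lra.
exists c; split.
- near=> t; rewrite -/(S t).
  have [t0 tq] : 0 < t /\ t * q <= 2^-1 by near: t; exact: tsmall.
  have hser n : series (fun p => c p.+1 * t ^+ p.+1) n =
      \sum_(p < n.+1) c p * t ^+ p.
    by rewrite big_ord_recl c0 mul0r add0r seriesEord.
  have z : (fun n => 2 * U * (t * q) ^+ n.+1) @ \oo --> (0 : R).
    rewrite (_ : (fun n => _) = geometric (2 * U * (t * q)) (t * q)).
      apply: cvg_geometric; rewrite ger0_norm ?mulr_ge0 ?(ltW t0)//; lra.
    by apply/funext => n; rewrite /= exprS; ring.
  apply/cvgrPdist_le => e e0.
  have H := @cvgr0_norm_le R R^o _ _ _ _ z e e0.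
  apply: filterS (H _) => n; rewrite hser; apply: le_trans.
  by apply: le_trans (hS t n.+1 t0 tq) _; exact: ler_norm.
- by apply: esum_coth_defect => //; exact: hc.
(* The constants bound, in order, the tail of the power series and the hyperbolic remainders of the
   outer and inner circles, the latter taken at time [t / rho]. *)
exists (2 * U * q ^+ 2 + 8 + 8 / rho ^+ 2); near=> t.
have [t0 tq] : 0 < t /\ t * q <= 2^-1 by near: t; exact: tsmall.
have tr : 0 < t <= rho by rewrite t0/=; near: t; exact: nbhs_right_le.
have /andP[_ tr1] := tr.
have b2 : `|nu - 2^-1| <= 2^-1.
  by move: hnu => /andP[? ?]; rewrite ler_norml; apply/andP; split; lra.
have := hS t 2%N t0 tq; rewrite !big_ord_recr big_ord0 /= c0 mul0r !add0r expr1.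
have /(cosh_div_sinh_expansion b2) : 0 < t <= 1 by rewrite t0 (le_trans tr1)// ltW.
have /(cosh_div_sinh_expansion b2) : 0 < t / rho <= 1.
  by rewrite divr_gt0//= ler_pdivrMr// mul1r.
rewrite (_ : t / rho / 2 = t / (2 * rho)); last by field; rewrite gt_eqF.
rewrite [X in `|X| <= 2 * U * _ -> _](_ : _ = Tr t -
   cosh (t * (nu - 2^-1)) / sinh (t / 2) -
   cosh (t / rho * (nu - 2^-1)) / sinh (t / (2 * rho)) - c 1 * t)//.
move: (_ / sinh (t / 2)) (_ / sinh (t / (2 * rho))) => A B.
(* Here [g = nu^2 - nu + 1/6], and [g (1 + 1 / rho)] is the explicit part of the coefficient of
   [t]. *)
set g := (nu - 2^-1) ^+ 2 - 12^-1.
move=> hB hA hT.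
have -> : Tr t - ((2 + 2 * rho) / t + ((1 + rho - 6 * nu - 6 * rho * nu
    + 6 * nu ^+ 2 + 6 * rho * nu ^+ 2) / (6 * rho) + c 1) * t)
  = (Tr t - A - B - c 1 * t) + (A - (2 / t + g * t))
    + (B - (2 / (t / rho) + g * (t / rho))).
  by rewrite /g; field; rewrite !gt_eqF.
apply: le_trans (ler_normD _ _) _.
apply: le_trans (lerD (ler_normD _ _) (lexx _)) _.
apply: le_trans (lerD (lerD hT hA) hB) _.
rewrite le_eqVlt; apply/orP; left; apply/eqP; field; by rewrite gt_eqF.
Unshelve. all: by end_near.
Qed.

End FinalExpansion.

(** * Magnetic operator on the Fourier modes *)

Section ComplexDerivative.
Context {R : realType}.
Local Open Scope complex_scope.
Implicit Types (f g : R -> R[i]) (x : R) (z w : R[i]).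

Lemma ReD z w : complex.Re (z + w) = complex.Re z + complex.Re w.
Proof. by case: z w => [? ?] [? ?]. Qed.
Lemma ImD z w : complex.Im (z + w) = complex.Im z + complex.Im w.
Proof. by case: z w => [? ?] [? ?]. Qed.
Lemma ReM z w : complex.Re (z * w) =
  complex.Re z * complex.Re w - complex.Im z * complex.Im w.
Proof. by case: z w => [? ?] [? ?]. Qed.
Lemma ImM z w : complex.Im (z * w) =
  complex.Re z * complex.Im w + complex.Im z * complex.Re w.
Proof. by case: z w => [? ?] [? ?]. Qed.
Lemma ReN z : complex.Re (- z) = - complex.Re z.
Proof. by case: z. Qed.
Lemma ImN z : complex.Im (- z) = - complex.Im z.
Proof. by case: z. Qed.
Lemma ReV z : complex.Re z^-1 =
  complex.Re z / (complex.Re z ^+ 2 + complex.Im z ^+ 2).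
Proof. by case: z. Qed.
Lemma ImV z : complex.Im z^-1 =
  - complex.Im z / (complex.Re z ^+ 2 + complex.Im z ^+ 2).
Proof. by case: z => a b; rewrite mulNr. Qed.

Lemma ReJ z : complex.Re (conjc z) = complex.Re z.
Proof. by case: z. Qed.
Lemma ImJ z : complex.Im (conjc z) = - complex.Im z.
Proof. by case: z. Qed.

Lemma Re_realM (a : R) z : complex.Re (a%:C * z) = a * complex.Re z.
Proof. by rewrite ReM /= mul0r subr0. Qed.
Lemma Im_realM (a : R) z : complex.Im (a%:C * z) = a * complex.Im z.
Proof. by rewrite ImM /= mul0r addr0. Qed.

Lemma complex_ext z w : complex.Re z = complex.Re w ->
  complex.Im z = complex.Im w -> z = w.
Proof. by case: z w => [? ?] [? ?] /= -> ->. Qed.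

Lemma sqmod_gt0 z : z != 0 -> 0 < sqmod z.
Proof.
rewrite eq_complex /sqmod /=; case: z => a b /= h.
rewrite lt_neqAle addr_ge0 ?sqr_ge0// andbT eq_sym paddr_eq0 ?sqr_ge0//.
by rewrite !sqrf_eq0.
Qed.

(** Derivatives in a real variable are taken on real and imaginary parts, as in [dX], [dY] and
    [dr]. *)
Definition cderiv f x (df : R[i]) :=
  is_derive x (1 : R) (fun s => complex.Re (f s)) (complex.Re df) /\
  is_derive x (1 : R) (fun s => complex.Im (f s)) (complex.Im df).

Lemma is_derive_cst (c x : R) : is_derive x (1 : R) (fun=> c) 0.
Proof. exact: is_derive_cst. Qed.

Lemma is_derive_near (f g : R -> R) x df :
  {near x, f =1 g} -> is_derive x (1 : R) f df -> is_derive x (1 : R) g df.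
Proof.
exact: near_eq_is_derive.
Qed.

Lemma cderiv_near f g x df : {near x, f =1 g} -> cderiv f x df -> cderiv g x df.
Proof.
move=> fg [h1 h2]; split.
  by apply: is_derive_near h1; apply: filterS fg => y ->.
by apply: is_derive_near h2; apply: filterS fg => y ->.
Qed.

Lemma cderiv_eq f x df dg : cderiv f x df -> df = dg -> cderiv f x dg.
Proof. by move=> h <-. Qed.

Lemma cderiv_cst z x : cderiv (fun=> z) x 0.
Proof. by split; exact: is_derive_cst. Qed.

Lemma cderiv_real (f : R -> R) x df : is_derive x (1 : R) f df ->
  cderiv (fun s => (f s)%:C) x df%:C.
Proof. by move=> h; split => //=; exact: is_derive_cst. Qed.

Lemma cderivD f g x df dg : cderiv f x df -> cderiv g x dg ->
  cderiv (fun s => f s + g s) x (df + dg).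
Proof.
move=> [f1 f2] [g1 g2]; split.
  under eq_fun do rewrite ReD.
  by rewrite ReD; exact: is_deriveD.
under eq_fun do rewrite ImD.
by rewrite ImD; exact: is_deriveD.
Qed.

Lemma cderivM f g x df dg : cderiv f x df -> cderiv g x dg ->
  cderiv (fun s => f s * g s) x (df * g x + f x * dg).
Proof.
move=> [f1 f2] [g1 g2]; split.
  under eq_fun do rewrite ReM.
  apply: is_derive_eq; rewrite ReD !ReM /GRing.scale /=; ring.
under eq_fun do rewrite ImM.
apply: is_derive_eq; rewrite ImD !ImM /GRing.scale /=; ring.
Qed.

Lemma cderivV f x df : f x != 0 -> cderiv f x df ->
  cderiv (fun s => (f s)^-1) x (- df / (f x) ^+ 2).
Proof.
move=> fx0 [f1 f2]; have n0 := sqmod_gt0 fx0.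
have n1 : complex.Re (f x) ^+ 2 + complex.Im (f x) ^+ 2 != 0.
  by rewrite gt_eqF.
have fxE : (- df / f x ^+ 2) = - df * (f x)^-1 * (f x)^-1.
  by rewrite expr2 invfM mulrA.
have dn : is_derive x (1 : R)
  (fun s => complex.Re (f s) ^+ 2 + complex.Im (f s) ^+ 2)
  (2 * complex.Re (f x) * complex.Re df + 2 * complex.Im (f x) * complex.Im df).
  apply: is_derive_eq; rewrite /GRing.scale /=; ring.
have dV : is_derive x (1 : R)
  (fun s => (complex.Re (f s) ^+ 2 + complex.Im (f s) ^+ 2)^-1)
  (- (complex.Re (f x) ^+ 2 + complex.Im (f x) ^+ 2) ^- 2 *
   (2 * complex.Re (f x) * complex.Re df + 2 * complex.Im (f x) * complex.Im df)).
  exact: (@is_deriveV R _ x _ 1 n1 dn).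
split.
  under eq_fun do rewrite ReV.
  apply: is_derive_eq; rewrite fxE !(ReM, ImM) !(ReV, ImV) ReN ImN /GRing.scale /=.
  by field.
under eq_fun do rewrite ImV.
apply: is_derive_eq; rewrite fxE !(ReM, ImM) !(ReV, ImV) ReN ImN /GRing.scale /=.
by field.
Qed.

Lemma cderivX f x df n : cderiv f x df ->
  cderiv (fun s => f s ^+ n) x (n%:R * f x ^+ n.-1 * df).
Proof.
move=> h; elim: n => [|n IH].
  by rewrite mul0r mul0r; exact: cderiv_cst.
under eq_fun do rewrite exprS.
apply: cderiv_eq (cderivM h IH) _ => /=.
case: n {IH} => [|n]; first by rewrite /= !expr0; ring.
by rewrite /= -[n.+2%:R]natr1 exprS; ring.
Qed.

Lemma cderiv_expz f x df (m : int) : f x != 0 -> cderiv f x df ->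
  cderiv (fun s => f s ^ m) x (m%:~R * f x ^ m * (f x)^-1 * df).
Proof.
move=> fx0 h; case: m => n.
  apply: cderiv_eq (cderivX n h) _; case: n => [|n].
    by rewrite /= !mul0r.
  rewrite /= -exprnP exprS -[Posz n.+1]/(n.+1%:Z) /intmul /=.
  by field.
apply: cderiv_eq (cderivV _ (cderivX n.+1 h)) _; first by rewrite expf_neq0.
rewrite NegzE -exprnN rmorphN /= -pmulrn expr2 exprS.
have q0 : f x ^+ n != 0 by rewrite expf_neq0.
by move: (f x ^+ n) q0 => q q0; field; rewrite fx0 q0.
Qed.

Lemma dX_cderiv (u : R * R -> R[i]) (p : R * R) du :
  cderiv (fun s => u (s, p.2)) p.1 du -> dX u p = du.
Proof.
move=> [h1 h2]; rewrite /dX !derive1E !derive_val; by case: du h1 h2.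
Qed.

Lemma dY_cderiv (u : R * R -> R[i]) (p : R * R) du :
  cderiv (fun s => u (p.1, s)) p.2 du -> dY u p = du.
Proof.
move=> [h1 h2]; rewrite /dY !derive1E !derive_val; by case: du h1 h2.
Qed.

End ComplexDerivative.

(** * Regularity in the plane and linearity of the magnetic derivatives *)

Section Smoothness.
Context {R : realType}.
Local Open Scope complex_scope.
Implicit Types (D : set (R * R)) (f g : R * R -> R) (u v : R * R -> R[i]).

Lemma contD f g (p : R * R) : {for p, continuous f} -> {for p, continuous g} ->
  {for p, continuous (fun q => f q + g q)}.
Proof. exact: continuousD. Qed.

Lemma contB f g (p : R * R) : {for p, continuous f} -> {for p, continuous g} ->
  {for p, continuous (fun q => f q - g q)}.
Proof. exact: continuousB. Qed.

Lemma contN f (p : R * R) : {for p, continuous f} ->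
  {for p, continuous (fun q => - f q)}.
Proof. exact: continuousN. Qed.

Lemma contM f g (p : R * R) : {for p, continuous f} -> {for p, continuous g} ->
  {for p, continuous (fun q => f q * g q)}.
Proof. exact: continuousM. Qed.

Lemma contV f (p : R * R) : f p != 0 -> {for p, continuous f} ->
  {for p, continuous (fun q => (f q)^-1)}.
Proof. exact: continuousV. Qed.

Lemma cont_cst (c : R) (p : R * R) : {for p, continuous (fun=> c)}.
Proof. exact: cst_continuous. Qed.

Definition ccont u (p : R * R) :=
  {for p, continuous (fun q => complex.Re (u q))} /\
  {for p, continuous (fun q => complex.Im (u q))}.

Lemma ccont_cst (z : R[i]) p : ccont (fun=> z) p.
Proof. by split; exact: cst_continuous. Qed.

Lemma ccontM u v p : ccont u p -> ccont v p -> ccont (fun q => u q * v q) p.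
Proof.
move=> [u1 u2] [v1 v2]; split.
  under [X in {for _, continuous X}]eq_fun do rewrite ReM.
  by apply: contB; exact: contM.
under [X in {for _, continuous X}]eq_fun do rewrite ImM.
by apply: contD; exact: contM.
Qed.

Lemma ccontV u p : u p != 0 -> ccont u p -> ccont (fun q => (u q)^-1) p.
Proof.
move=> up0 [u1 u2]; have n0 := sqmod_gt0 up0.
have n1 : complex.Re (u p) ^+ 2 + complex.Im (u p) ^+ 2 != 0 by rewrite gt_eqF.
have cV : {for p, continuous (fun q =>
    (complex.Re (u q) ^+ 2 + complex.Im (u q) ^+ 2)^-1)}.
  apply: contV => //.
  by apply: contD; [exact: (contM u1 u1)|exact: (contM u2 u2)].
split.
  under [X in {for _, continuous X}]eq_fun do rewrite ReV; exact: contM.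
under [X in {for _, continuous X}]eq_fun do rewrite ImV.
by apply: contM => //; exact: contN.
Qed.

Lemma ccontX u p n : ccont u p -> ccont (fun q => u q ^+ n) p.
Proof.
move=> h; elim: n => [|n IH]; first exact: ccont_cst.
under eq_fun do rewrite exprS; exact: ccontM.
Qed.

Lemma ccont_expz u p (m : int) : u p != 0 -> ccont u p ->
  ccont (fun q => u q ^ m) p.
Proof.
move=> up0 h; case: m => n; first exact: ccontX.
by apply: ccontV; [rewrite expf_neq0|exact: ccontX].
Qed.

Lemma ccont_real f p : {for p, continuous f} -> ccont (fun q => (f q)%:C) p.
Proof. by move=> h; split => //=; exact: cst_continuous. Qed.

Definition has_grad D u ux uy := forall p : R * R, D p ->
  cderiv (fun s => u (s, p.2)) p.1 (ux p) /\
  cderiv (fun s => u (p.1, s)) p.2 (uy p).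

Lemma open_slice1 D (p : R * R) : open D -> D p -> \forall s \near p.1, D (s, p.2).
Proof.
move=> oD Dp.
have /= h : nbhs (p.1, p.2) D by rewrite -surjective_pairing; exact: open_nbhs_nbhs.
case: h => -[A B] /= [A1 B1] AB.
by apply: filterS A1 => s As; apply: AB; split => //=; exact: nbhs_singleton.
Qed.

Lemma open_slice2 D (p : R * R) : open D -> D p -> \forall s \near p.2, D (p.1, s).
Proof.
move=> oD Dp.
have /= h : nbhs (p.1, p.2) D by rewrite -surjective_pairing; exact: open_nbhs_nbhs.
case: h => -[A B] /= [A1 B1] AB.
by apply: filterS B1 => s Bs; apply: AB; split => //=; exact: nbhs_singleton.
Qed.

Lemma near_eq_for_continuous f g p : (\forall q \near p, f q = g q) ->
  {for p, continuous f} -> {for p, continuous g}.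
Proof.
move=> fg; rewrite /prop_for /continuous_at => h.
rewrite -(nbhs_singleton fg); apply: cvg_trans h.
exact: near_eq_cvg.
Qed.

(** Openness turns equality on [D] into equality near each point along both coordinate lines, which
    is what partial derivatives see. *)
Lemma Ck_real_ext k D f g : open D -> (forall p, D p -> f p = g p) ->
  Ck_real k D f -> Ck_real k D g.
Proof.
elim: k f g => [|k IH] f g oD fg [cf hf]; split.
- move=> p Dp; apply: near_eq_for_continuous (cf p Dp).
  by apply: filterS (open_nbhs_nbhs (conj oD Dp)).
- by [].
- move=> p Dp; apply: near_eq_for_continuous (cf p Dp).
  by apply: filterS (open_nbhs_nbhs (conj oD Dp)).
case: hf => h1 h2 h3.
have e1 p : D p -> \forall s \near p.1, f (s, p.2) = g (s, p.2).
  by move=> Dp; apply: filterS (open_slice1 oD Dp) => s; exact: fg.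
have e2 p : D p -> \forall s \near p.2, f (p.1, s) = g (p.1, s).
  by move=> Dp; apply: filterS (open_slice2 oD Dp) => s; exact: fg.
split.
- move=> p Dp; have [d1 d2] := h1 p Dp; split.
    exact: near_eq_derivable (e1 p Dp) d1.
  exact: near_eq_derivable (e2 p Dp) d2.
- apply: IH h2 => // p Dp; rewrite !derive1E.
  exact: near_eq_derive (e1 p Dp).
- apply: IH h3 => // p Dp; rewrite !derive1E.
  exact: near_eq_derive (e2 p Dp).
Qed.

Lemma is_derive_lin (f g : R -> R) (x df dg c d : R) :
  is_derive x (1 : R) f df -> is_derive x (1 : R) g dg ->
  is_derive x (1 : R) (fun s => c * f s + d * g s) (c * df + d * dg).
Proof. by move=> hf hg; apply: is_derive_eq; rewrite /GRing.scale /=; ring. Qed.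

Lemma Ck_real_lin k D f g (c d : R) : open D -> Ck_real k D f -> Ck_real k D g ->
  Ck_real k D (fun p => c * f p + d * g p).
Proof.
elim: k f g => [|k IH] f g oD [cf hf] [cg hg]; split => //.
- move=> p Dp; apply: contD; apply: contM; try exact: cont_cst; [exact: cf|exact: cg].
- move=> p Dp; apply: contD; apply: contM; try exact: cont_cst; [exact: cf|exact: cg].
case: hf hg => f1 f2 f3 [g1 g2 g3].
have H1 p : D p -> is_derive p.1 (1 : R) (fun s => c * f (s, p.2) + d * g (s, p.2))
    (c * derive1 (fun s => f (s, p.2)) p.1 + d * derive1 (fun s => g (s, p.2)) p.1).
  move=> Dp; rewrite !derive1E; have [f11 _] := f1 p Dp; have [g11 _] := g1 p Dp.
  by apply: is_derive_lin; exact/derivableP.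
have H2 p : D p -> is_derive p.2 (1 : R) (fun s => c * f (p.1, s) + d * g (p.1, s))
    (c * derive1 (fun s => f (p.1, s)) p.2 + d * derive1 (fun s => g (p.1, s)) p.2).
  move=> Dp; rewrite !derive1E; have [_ f11] := f1 p Dp; have [_ g11] := g1 p Dp.
  by apply: is_derive_lin; exact/derivableP.
split.
- by move=> p Dp; split; [case: (H1 p Dp)|case: (H2 p Dp)].
- apply: (Ck_real_ext oD _ (IH _ _ oD f2 g2)) => p Dp.
  by rewrite [RHS]derive1E; have [_ ->] := H1 p Dp.
- apply: (Ck_real_ext oD _ (IH _ _ oD f3 g3)) => p Dp.
  by rewrite [RHS]derive1E; have [_ ->] := H2 p Dp.
Qed.

Lemma Ck_lin k D u v (c d : R[i]) : open D -> Ck k D u -> Ck k D v ->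
  Ck k D (fun p => c * u p + d * v p).
Proof.
move=> oD [u1 u2] [v1 v2]; split.
  have := Ck_real_lin 1 1 oD
    (Ck_real_lin (complex.Re c) (- complex.Im c) oD u1 u2)
    (Ck_real_lin (complex.Re d) (- complex.Im d) oD v1 v2).
  by apply: Ck_real_ext => // p _; rewrite ReD !ReM; ring.
have := Ck_real_lin 1 1 oD
  (Ck_real_lin (complex.Re c) (complex.Im c) oD u2 u1)
  (Ck_real_lin (complex.Re d) (complex.Im d) oD v2 v1).
by apply: Ck_real_ext => // p _; rewrite ImD !ImM; ring.
Qed.

Lemma Ck_step k D u ux uy : open D -> has_grad D u ux uy ->
  (forall p, D p -> ccont u p) -> Ck k D ux -> Ck k D uy -> Ck k.+1 D u.
Proof.
move=> oD hg cu [ux1 ux2] [uy1 uy2]; split; split; try by move=> p /cu [].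
  split.
  - by move=> p /hg[[h _] [h' _]]; split; [case: h|case: h'].
  - apply: Ck_real_ext ux1 => // p /hg[[h _] _].
    by rewrite derive1E; case: h.
  - apply: Ck_real_ext uy1 => // p /hg[_ [h _]].
    by rewrite derive1E; case: h.
split.
- by move=> p /hg[[_ h] [_ h']]; split; [case: h|case: h'].
- apply: Ck_real_ext ux2 => // p /hg[[_ h] _].
  by rewrite derive1E; case: h.
- apply: Ck_real_ext uy2 => // p /hg[_ [_ h]].
  by rewrite derive1E; case: h.
Qed.

Lemma Ck_sub k D D' u : D' `<=` D -> Ck k D u -> Ck k D' u.
Proof.
have H (f : R * R -> R) : D' `<=` D -> Ck_real k D f -> Ck_real k D' f.
  move=> DD; elim: k f => [|k IH] f [h1 h2]; split => //.
  - by move=> p /DD/h1.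
  - by move=> p /DD/h1.
  case: h2 => a b c; split; [by move=> p /DD/a|exact: IH|exact: IH].
by move=> DD [h1 h2]; split; exact: H.
Qed.

Lemma has_grad_lin D u ux uy v vx vy (c d : R[i]) :
  has_grad D u ux uy -> has_grad D v vx vy ->
  has_grad D (fun p => c * u p + d * v p) (fun p => c * ux p + d * vx p)
     (fun p => c * uy p + d * vy p).
Proof.
move=> hu hv p Dp; have [u1 u2] := hu p Dp; have [v1 v2] := hv p Dp.
split; (apply: cderiv_eq; [apply: cderivD; apply: cderivM;
  [exact: cderiv_cst|eassumption|exact: cderiv_cst|eassumption]|]);
  by rewrite !mul0r !add0r.
Qed.

Lemma has_grad_ext D u v ux uy : open D -> (forall p, D p -> u p = v p) ->
  has_grad D u ux uy -> has_grad D v ux uy.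
Proof.
move=> oD uv hu p Dp; have [u1 u2] := hu p Dp; split.
  by apply: cderiv_near u1; apply: filterS (open_slice1 oD Dp) => s; exact: uv.
by apply: cderiv_near u2; apply: filterS (open_slice2 oD Dp) => s; exact: uv.
Qed.

Lemma magX_grad nu D u ux uy p : has_grad D u ux uy -> D p ->
  magX nu u p = - 'i%C * ux p - (AX nu p)%:C * u p.
Proof.
move=> hu /hu[h _]; rewrite /magX (dX_cderiv h); congr (_ * _ - _).
by apply: complex_ext => /=; rewrite ?oppr0.
Qed.

Lemma magY_grad nu D u ux uy p : has_grad D u ux uy -> D p ->
  magY nu u p = - 'i%C * uy p - (AY nu p)%:C * u p.
Proof.
move=> hu /hu[_ h]; rewrite /magY (dY_cderiv h); congr (_ * _ - _).
by apply: complex_ext => /=; rewrite ?oppr0.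
Qed.

(** Agreement is asked on [D] only, so that [w] can be [magX nu v] or [magY nu v], whose expression
    is known on the punctured plane; this is how the second application in [magH] is computed. *)
Lemma mag_lin nu D w u ux uy v vx vy (c d : R[i]) p : open D ->
  has_grad D u ux uy -> has_grad D v vx vy ->
  (forall q, D q -> w q = c * u q + d * v q) -> D p ->
  magX nu w p = c * magX nu u p + d * magX nu v p /\
  magY nu w p = c * magY nu u p + d * magY nu v p.
Proof.
move=> oD hu hv wE Dp.
have hw := has_grad_ext oD (fun q Dq => esym (wE q Dq)) (has_grad_lin c d hu hv).
rewrite (magX_grad _ hw Dp) (magX_grad _ hu Dp) (magX_grad _ hv Dp).
rewrite (magY_grad _ hw Dp) (magY_grad _ hu Dp) (magY_grad _ hv Dp).
by rewrite !wE//; split; ring.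
Qed.

End Smoothness.

(** * The functions [r^kap e^{i m theta}] on the punctured plane *)

Section PlanarModes.
Context {R : realType}.
Local Open Scope complex_scope.
Implicit Types (kap nu : R) (m : int) (p : R * R).

Definition punctured : set (R * R) := [set p | 0 < p.1 ^+ 2 + p.2 ^+ 2].

Lemma cont_fst p : {for p, continuous (fun q : R * R => q.1)}.
Proof. by move=> A; exact: cvg_fst. Qed.

Lemma cont_snd p : {for p, continuous (fun q : R * R => q.2)}.
Proof. by move=> A; exact: cvg_snd. Qed.

Lemma cont_sqnorm p : {for p, continuous (fun q : R * R => q.1 ^+ 2 + q.2 ^+ 2)}.
Proof.
apply: contD; [exact: (contM (@cont_fst p) (@cont_fst p))|].
exact: (contM (@cont_snd p) (@cont_snd p)).
Qed.

Lemma open_punctured : open punctured.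
Proof.
have -> : punctured = (fun q : R * R => q.1 ^+ 2 + q.2 ^+ 2) @^-1` [set x | 0 < x].
  by [].
apply: open_comp; last exact: open_gt.
by move=> p _; exact: cont_sqnorm.
Qed.

(* r^kap e^{i m theta} in Cartesian coordinates *)
Definition mono kap m p : R[i] :=
  (expR ((kap - m%:~R) / 2 * ln (p.1 ^+ 2 + p.2 ^+ 2)))%:C * (p.1 +i* p.2) ^ m.

Lemma punctured_neq0 p : punctured p -> p.1 +i* p.2 != 0.
Proof.
rewrite /punctured /= => h; apply/eqP => -[p1 p2].
by move: h; rewrite p1 p2 expr0n addr0 ltxx.
Qed.

Lemma expR_ln_sqnorm p : punctured p ->
  expR (ln (p.1 ^+ 2 + p.2 ^+ 2)) = p.1 ^+ 2 + p.2 ^+ 2.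
Proof. by move=> h; rewrite lnK// posrE. Qed.

Lemma mono_up kap m p : punctured p -> mono (kap - 1) (m + 1) p =
  mono kap m p * (p.1 +i* p.2) / (p.1 ^+ 2 + p.2 ^+ 2)%:C.
Proof.
move=> h; rewrite /mono exprzDr ?unitfE ?punctured_neq0// expr1z.
have -> : (kap - 1 - (m + 1)%:~R) / 2 = (kap - m%:~R) / 2 - 1.
  by rewrite intrD; field.
rewrite mulrBl mul1r expRB expR_ln_sqnorm// rmorphM fmorphV /=; ring.
Qed.

Lemma mono_dn kap m p : punctured p -> mono (kap - 1) (m - 1) p =
  mono kap m p / (p.1 +i* p.2).
Proof.
move=> h; rewrite /mono exprzDr ?unitfE ?punctured_neq0//.
have -> : (kap - 1 - (m - 1)%:~R) / 2 = (kap - m%:~R) / 2.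
  by rewrite intrB; field.
by rewrite exprN1 mulrA.
Qed.

(** Formally [mono kap m] is [z^((kap + m) / 2) zbar^((kap - m) / 2)]. The two terms are its
    derivatives in [zbar] and in [z]; [d/dx] is their sum and [d/dy] is [i (d/dz - d/dzbar)]. The
    family is thus closed under differentiation, hence smooth. *)
Definition mono_dx kap m p : R[i] :=
  (kap%:C - m%:~R) / 2 * mono (kap - 1) (m + 1) p
  + (kap%:C + m%:~R) / 2 * mono (kap - 1) (m - 1) p.

Definition mono_dy kap m p : R[i] :=
  (- 'i%C * ((kap%:C - m%:~R) / 2)) * mono (kap - 1) (m + 1) p
  + ('i%C * ((kap%:C + m%:~R) / 2)) * mono (kap - 1) (m - 1) p.

(** With [z] and its conjugate as independent variables, the derivative identities become rational
    and are left to [field]. *)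
Lemma zzb p (z := p.1 +i* p.2) (zb := p.1 -i* p.2) :
  [/\ p.1%:C = (z + zb) / 2, p.2%:C = - 'i%C * ((z - zb) / 2) &
      (p.1 ^+ 2 + p.2 ^+ 2)%:C = z * zb].
Proof.
split; apply: complex_ext; rewrite /= ?(ReM, ImM, ReV, ImV) /=;
  by field.
Qed.

Lemma conj_neq0 p : punctured p -> p.1 -i* p.2 != 0.
Proof.
move=> h; apply: (@punctured_neq0 (p.1, - p.2)).
by rewrite /punctured /= sqrrN.
Qed.

Lemma is_derive_mono_coef (kap : R) m (f : R -> R) (x df : R) : 0 < f x ->
  is_derive x (1 : R) f df ->
  is_derive x (1 : R) (fun s => expR ((kap - m%:~R) / 2 * ln (f s)))
   (expR ((kap - m%:~R) / 2 * ln (f x)) * ((kap - m%:~R) / 2 * (df / f x))).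
Proof.
move=> f0 hf; have hl := is_derive1_ln f0.
apply: is_derive_eq; rewrite /GRing.scale /=; ring.
Qed.

Lemma mono_grad kap m : has_grad punctured (mono kap m) (mono_dx kap m)
  (mono_dy kap m).
Proof.
move=> [x y] hp; have z0 := punctured_neq0 hp; have zb0 := conj_neq0 hp.
have [XE YE SE] := zzb (x, y).
have S0 : 0 < x ^+ 2 + y ^+ 2 by [].
move: z0 zb0 XE YE SE; rewrite /= => z0 zb0 XE YE SE.
split => /=.
  have d1 : is_derive x (1 : R) (fun s => s ^+ 2 + y ^+ 2) (2 * x).
    by apply: is_derive_eq; rewrite /GRing.scale /=; ring.
  have d2 : cderiv (fun s => s +i* y) x 1.
    by split => /=; [exact: is_derive_id|exact: is_derive_cst].
  have h := cderivM (cderiv_real (@is_derive_mono_coef kap m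
    (fun s => s ^+ 2 + y ^+ 2) x _ S0 d1))
    (@cderiv_expz _ (fun s => s +i* y) x _ m z0 d2).
  apply: cderiv_eq h _.
  rewrite /mono_dx mono_up// mono_dn// /mono /=.
  rewrite !(rmorphM, rmorphB, rmorph_nat, rmorph_int, fmorphV) /= SE XE.
  move: (_ ^ m) ((expR _)%:C) => Z E.
  by field; rewrite zb0 z0.
have d1 : is_derive y (1 : R) (fun s => x ^+ 2 + s ^+ 2) (2 * y).
  by apply: is_derive_eq; rewrite /GRing.scale /=; ring.
have d2 : cderiv (fun s => x +i* s) y 'i%C.
  by split => /=; [exact: is_derive_cst|exact: is_derive_id].
have h := cderivM (cderiv_real (@is_derive_mono_coef kap m
  (fun s => x ^+ 2 + s ^+ 2) y _ S0 d1))
  (@cderiv_expz _ (fun s => x +i* s) y _ m z0 d2).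
apply: cderiv_eq h _.
rewrite /mono_dy mono_up// mono_dn// /mono /=.
rewrite !(rmorphM, rmorphB, rmorph_nat, rmorph_int, fmorphV) /= SE YE.
move: (_ ^ m) ((expR _)%:C) => Z E.
by field; rewrite zb0 z0.
Qed.

Lemma mono_ccont kap m p : punctured p -> ccont (mono kap m) p.
Proof.
move=> hp; apply: ccontM.
  apply: ccont_real; apply: continuous_comp; last exact: continuous_expR.
  apply: contM; first exact: cont_cst.
  apply: continuous_comp; first exact: cont_sqnorm.
  exact: continuous_ln.
apply: ccont_expz; first exact: punctured_neq0.
by split => /=; [exact: cont_fst|exact: cont_snd].
Qed.

Lemma mono_Ck k kap m : Ck k punctured (mono kap m).
Proof.
elim: k kap m => [|k IH] kap m.
  by split; split => // p /(mono_ccont kap m)[].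
apply: Ck_step (mono_grad kap m) _ _ _; first exact: open_punctured.
- exact: mono_ccont.
- by apply: Ck_lin; [exact: open_punctured|exact: IH|exact: IH].
- by apply: Ck_lin; [exact: open_punctured|exact: IH|exact: IH].
Qed.

(** The effect of the potential is to replace [m] by [m - nu] in the coefficients of the
    gradient. *)
Lemma magX_mono nu kap m p : punctured p -> magX nu (mono kap m) p =
  - 'i%C / 2 * ((kap - (m%:~R - nu))%:C * mono (kap - 1) (m + 1) p
              + (kap + (m%:~R - nu))%:C * mono (kap - 1) (m - 1) p).
Proof.
move=> hp; rewrite (magX_grad nu (@mono_grad kap m) hp).
have z0 := punctured_neq0 hp; have zb0 := conj_neq0 hp.
have [_ YE SE] := zzb p.
rewrite /mono_dx mono_up// mono_dn// /AX.
rewrite [X in X * mono kap m p](rmorphM, fmorphV) /= rmorphN fmorph_div /= SE YE.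
rewrite !(rmorphB, rmorphD, rmorph_int) /=; move: (mono kap m p) => E.
by field; rewrite zb0 z0.
Qed.

Lemma magY_mono nu kap m p : punctured p -> magY nu (mono kap m) p =
  - 1 / 2 * ((kap - (m%:~R - nu))%:C * mono (kap - 1) (m + 1) p
              - (kap + (m%:~R - nu))%:C * mono (kap - 1) (m - 1) p).
Proof.
move=> hp; rewrite (magY_grad nu (@mono_grad kap m) hp).
have z0 := punctured_neq0 hp; have zb0 := conj_neq0 hp.
have [XE _ SE] := zzb p.
have ii : forall u v : R[i], - 'i%C * (- 'i%C * u + 'i%C * v) = - u + v.
  move=> u v; rewrite mulrDr !mulrA mulrNN mulNr -!expr2 sqr_i; ring.
rewrite /mono_dy -!(mulrA _ _ (mono _ _ _)) ii mono_up// mono_dn// /AY.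
rewrite [X in _ - X * mono kap m p](rmorphM, fmorphV) /= fmorph_div /= SE XE.
rewrite !(rmorphB, rmorphD, rmorph_int) /=; move: (mono kap m p) => E.
by field; rewrite zb0 z0.
Qed.

Lemma cisD (x y : R) : cis (x + y) = cis x * cis y :> R[i].
Proof.
by rewrite /cis cosD sinD; apply: complex_ext; rewrite ?(ReM, ImM) /=; ring.
Qed.

Lemma cis0 : cis 0 = 1 :> R[i].
Proof. by rewrite /cis cos0 sin0. Qed.

Lemma cis_neq0 (x : R) : cis x != 0.
Proof.
apply/eqP => h; have := @cisD x (- x); rewrite subrr cis0 h mul0r.
by apply/eqP; rewrite oner_neq0.
Qed.

Lemma cisN (x : R) : cis (- x) = (cis x)^-1.
Proof.
apply: (mulIf (cis_neq0 x)); rewrite mulVf ?cis_neq0// -cisD addNr; exact: cis0.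
Qed.

Lemma cis_expz (x : R) m : cis x ^ m = cis (m%:~R * x).
Proof.
have H n : cis x ^+ n = cis (n%:R * x).
  elim: n => [|n IH]; first by rewrite expr0 mul0r cis0.
  by rewrite exprS IH -cisD -nat1r mulrDl mul1r.
case: m => n; first by rewrite -exprnP H pmulrn.
by rewrite NegzE -exprnN H -cisN rmorphN/= mulNr pmulrn.
Qed.

Lemma polar_sqnorm (r x : R) :
  (polar r x).1 ^+ 2 + (polar r x).2 ^+ 2 = r ^+ 2.
Proof. by rewrite /polar /= !exprMn -mulrDr cos2Dsin2 mulr1. Qed.

Lemma mono_polar kap m (r x : R) : 0 < r ->
  mono kap m (polar r x) = (expR (kap * ln r))%:C * cis (m%:~R * x).
Proof.
move=> r0; rewrite /mono polar_sqnorm lnXn// -cis_expz.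
have -> : (polar r x).1 +i* (polar r x).2 = r%:C * cis x.
  by apply: complex_ext; rewrite /cis ?(ReM, ImM) /=; ring.
rewrite exprzMl ?unitfE ?cis_neq0//; last first.
  by rewrite fmorph_eq0 gt_eqF.
rewrite mulrA; congr (_ * _).
have -> : r%:C ^ m = (expR (m%:~R * ln r))%:C :> R[i].
  have H n : r ^+ n = expR (n%:R * ln r) by rewrite expRM_natl lnK ?posrE.
  case: m => n; first by rewrite -exprnP -rmorphXn /= H pmulrn.
  rewrite NegzE -exprnN -rmorphXn -fmorphV /= H -expRN; congr (expR _)%:C.
  by rewrite rmorphN /= mulNr pmulrn.
rewrite -rmorphM -expRD /=; congr (expR _)%:C.
by rewrite -mulr_natr; field.
Qed.

End PlanarModes.

(** * Solutions of the magnetic equation on one angular mode *)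

Section ModeSolution.
Context {R : realType}.
Local Open Scope complex_scope.
Implicit Types (kap nu : R) (m : int) (p : R * R) (c d : R[i]).

(** One of the two terms drops out, and the remaining exponent satisfies [kap - 1 = (m - 1) - nu],
    so the lemma applies again to the result. For the opposite exponent, [m + 1] takes the place of
    [m - 1]. *)
Lemma mag_mono_p nu kap m p : punctured p -> kap = m%:~R - nu ->
  magX nu (mono kap m) p = (- 'i%C * kap%:C) * mono (kap - 1) (m - 1) p /\
  magY nu (mono kap m) p = kap%:C * mono (kap - 1) (m - 1) p.
Proof.
move=> hp kE; rewrite magX_mono// magY_mono// -kE subrr rmorphD /=.
by rewrite !mul0r; split; field.
Qed.

Lemma mag_mono_n nu kap m p : punctured p -> kap = - (m%:~R - nu) ->
  magX nu (mono kap m) p = (- 'i%C * kap%:C) * mono (kap - 1) (m + 1) p /\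
  magY nu (mono kap m) p = - kap%:C * mono (kap - 1) (m + 1) p.
Proof.
move=> hp kE; rewrite magX_mono// magY_mono//.
have -> : m%:~R - nu = - kap by rewrite kE opprK.
by rewrite opprK subrr rmorphD /= !mul0r; split; field.
Qed.

(** On each power, applying [magX] twice multiplies by [- kap (kap - 1)] and applying [magY] twice
    by [kap (kap - 1)], with the same resulting function, so the two cancel. *)
Lemma magH_mono nu m c d p : punctured p ->
  magH nu (fun q => c * mono (m%:~R - nu) m q + d * mono (- (m%:~R - nu)) m q) p = 0.
Proof.
move=> hp; set mu := m%:~R - nu; set v := fun q => _.
have H q : punctured q ->
  magX nu v q = (c * (- 'i%C * mu%:C)) * mono (mu - 1) (m - 1) q
              + (d * (- 'i%C * (- mu)%:C)) * mono (- mu - 1) (m + 1) q /\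
  magY nu v q = (c * mu%:C) * mono (mu - 1) (m - 1) q
              + (d * - (- mu)%:C) * mono (- mu - 1) (m + 1) q.
  move=> hq.
  have [-> ->] := @mag_lin _ nu _ v _ _ _ _ _ _ c d q (@open_punctured R)
     (@mono_grad R mu m) (@mono_grad R (- mu) m) (fun q _ => erefl) hq.
  have [-> ->] := @mag_mono_p nu mu m q hq erefl.
  have [-> ->] := @mag_mono_n nu (- mu) m q hq erefl.
  by rewrite !mulrA.
have e1 : mu - 1 = (m - 1)%:~R - nu by rewrite intrB /mu; ring.
have e2 : - mu - 1 = - ((m + 1)%:~R - nu) by rewrite intrD /mu; ring.
have [E1 _] := @mag_lin _ nu _ (magX nu v) _ _ _ _ _ _ _ _ p (@open_punctured R)
     (@mono_grad R (mu - 1) (m - 1)) (@mono_grad R (- mu - 1) (m + 1))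
     (fun q hq => (H q hq).1) hp.
have [_ E2] := @mag_lin _ nu _ (magY nu v) _ _ _ _ _ _ _ _ p (@open_punctured R)
     (@mono_grad R (mu - 1) (m - 1)) (@mono_grad R (- mu - 1) (m + 1))
     (fun q hq => (H q hq).2) hp.
rewrite /magH E1 E2.
have [-> ->] := mag_mono_p hp e1.
have [-> ->] := mag_mono_n hp e2.
have ii : 'i%C * 'i%C = -1 :> R[i] by rewrite -expr2 sqr_i.
rewrite (_ : forall a b c d e f g h : R[i],
  a * (- 'i%C * b) * (- 'i%C * c * d) + e * (- 'i%C * f) * (- 'i%C * g * h) =
  ('i%C * 'i%C) * (a * b * c * d + e * f * g * h)); last by move=> *; ring.
by rewrite ii; ring.
Qed.

(** This is [ln r], the second solution when the exponents [m - nu] and [nu - m] coincide. *)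
Definition logr p : R[i] := (ln (p.1 ^+ 2 + p.2 ^+ 2) / 2)%:C.

Lemma mono1E p : punctured p ->
  mono (-1) 1 p = (p.1 +i* p.2) / (p.1 ^+ 2 + p.2 ^+ 2)%:C.
Proof.
move=> hp; have := @mono_up R 0 0 p hp; rewrite add0r => ->.
by rewrite /mono subr0 mul0r mul0r expR0 !mul1r.
Qed.

Lemma monoN1E p : punctured p -> mono (-1) (-1) p = (p.1 +i* p.2)^-1.
Proof.
move=> hp; have := @mono_dn R 0 0 p hp; rewrite add0r => ->.
by rewrite /mono subr0 mul0r mul0r expR0 !mul1r.
Qed.

(** The gradient of [ln r] lies in the family [mono], so smoothness and the equation follow from the
    results on that family. *)
Lemma logr_grad : has_grad punctured logr
  (fun p => 2^-1 * mono (-1) 1 p + 2^-1 * mono (-1) (-1) p)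
  (fun p => (- 'i%C / 2) * mono (-1) 1 p + ('i%C / 2) * mono (-1) (-1) p).
Proof.
move=> [x y] hp; have z0 := punctured_neq0 hp; have zb0 := conj_neq0 hp.
have [XE YE SE] := zzb (x, y).
have S0 : 0 < x ^+ 2 + y ^+ 2 by [].
rewrite mono1E// monoN1E//.
move: z0 zb0 XE YE SE; rewrite /= => z0 zb0 XE YE SE.
split => /=.
  have d1 : is_derive x (1 : R) (fun s => ln (s ^+ 2 + y ^+ 2) / 2)
      (x / (x ^+ 2 + y ^+ 2)).
    have hl := is_derive1_ln S0.
    apply: is_derive_eq; rewrite /GRing.scale /=; field; by rewrite gt_eqF.
  apply: cderiv_eq (cderiv_real d1) _.
  rewrite fmorph_div /= SE XE.
  by field; rewrite zb0 z0.
have d1 : is_derive y (1 : R) (fun s => ln (x ^+ 2 + s ^+ 2) / 2)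
    (y / (x ^+ 2 + y ^+ 2)).
  have hl := is_derive1_ln S0.
  apply: is_derive_eq; rewrite /GRing.scale /=; field; by rewrite gt_eqF.
apply: cderiv_eq (cderiv_real d1) _.
rewrite fmorph_div /= SE YE.
by field; rewrite zb0 z0.
Qed.

Lemma logr_ccont p : punctured p -> ccont logr p.
Proof.
move=> hp; apply: ccont_real; apply: contM; last exact: cont_cst.
apply: continuous_comp; first exact: cont_sqnorm.
exact: continuous_ln.
Qed.

Lemma logr_Ck k : Ck k punctured logr.
Proof.
case: k => [|k]; first by split; split => // p /logr_ccont[].
apply: Ck_step logr_grad _ _ _; first exact: open_punctured.
- exact: logr_ccont.
- by apply: Ck_lin; [exact: open_punctured|exact: mono_Ck|exact: mono_Ck].
- by apply: Ck_lin; [exact: open_punctured|exact: mono_Ck|exact: mono_Ck].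
Qed.

Lemma logr_polar (r x : R) : 0 < r -> logr (polar r x) = (ln r)%:C.
Proof. by move=> r0; rewrite /logr polar_sqnorm lnXn// -[_ *+ 2]mulr_natr mulfK. Qed.

Lemma magH_logr c d p : punctured p ->
  magH 0 (fun q => c * mono 0 0 q + d * logr q) p = 0.
Proof.
move=> hp; set v := fun q => _.
have A0 q : AX (0 : R) q = 0 /\ AY (0 : R) q = 0.
  by rewrite /AX /AY !mul0r.
have H q : punctured q ->
  magX 0 v q = (- 'i%C / 2 * d) * mono (-1) 1 q
              + (- 'i%C / 2 * d) * mono (-1) (-1) q /\
  magY 0 v q = (- d / 2) * mono (-1) 1 q
              + (d / 2) * mono (-1) (-1) q.
  move=> hq.
  have [-> ->] := @mag_lin _ 0 _ v _ _ _ _ _ _ c d q (@open_punctured R)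
     (@mono_grad R 0 0) logr_grad (fun q _ => erefl) hq.
  have k0 : 0 = 0%:~R - 0 :> R by rewrite subrr.
  have [-> ->] := mag_mono_p hq k0.
  rewrite (magX_grad 0 logr_grad hq) (magY_grad 0 logr_grad hq).
  have [-> ->] := A0 q.
  rewrite !mulr0 !mul0r !mulr0 !add0r !subr0.
  split; first by field.
  rewrite (_ : d * _ = 'i%C * 'i%C * (d / 2 * mono (-1) 1 q - d / 2 * mono (-1) (-1) q)).
    by rewrite -expr2 sqr_i; field.
  by field.
have e1 : -1 = - (1%:~R - 0) :> R by rewrite subr0.
have e2 : -1 = (-1)%:~R - 0 :> R by rewrite subr0.
have [E1 _] := @mag_lin _ 0 _ (magX 0 v) _ _ _ _ _ _ _ _ p (@open_punctured R)
     (@mono_grad R (-1) 1) (@mono_grad R (-1) (-1))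
     (fun q hq => (H q hq).1) hp.
have [_ E2] := @mag_lin _ 0 _ (magY 0 v) _ _ _ _ _ _ _ _ p (@open_punctured R)
     (@mono_grad R (-1) 1) (@mono_grad R (-1) (-1))
     (fun q hq => (H q hq).2) hp.
rewrite /magH E1 E2.
have [-> ->] := mag_mono_n hp e1.
have [-> ->] := mag_mono_p hp e2.
rewrite rmorphN /= rmorph1.
rewrite (_ : forall a b : R[i],
  - 'i%C / 2 * d * (- 'i%C * -1 * a) + - 'i%C / 2 * d * (- 'i%C * -1 * b) =
  ('i%C * 'i%C) * (- d / 2 * (a + b))); last by move=> *; field.
by rewrite -expr2 sqr_i; field.
Qed.

Lemma annulus_punctured (rho : R) : 0 < rho -> annulus rho `<=` punctured.
Proof.
by move=> r0 p /andP[h _]; rewrite /punctured /=; apply: lt_trans h; rewrite exprn_gt0.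
Qed.

(** The radial profile [f] and its derivative [g] are continuous on all [r > 0], so boundary limits
    are plain values; the last two equations are the rows of the mode matrix. *)
Theorem mode_solution (nu rho a : R) m (alpha beta : R) : 0 <= nu < 1 ->
  0 < a -> rho = expR (- a) ->
  exists (v : R * R -> R[i]) (f g : R -> R),
  [/\ Ck 2 (annulus rho) v, forall p, annulus rho p -> magH nu v p = 0,
      forall r x : R, 0 < r -> v (polar r x) = (f r)%:C * cis (m%:~R * x),
      (forall r : R, 0 < r -> is_derive r (1 : R) f (g r)) /\
      (forall r : R, 0 < r -> {for r, continuous g}) &
      [/\ f 1 = alpha, f rho = beta,
          g 1 = modeA a (m%:~R - nu) * alpha - modeB a (m%:~R - nu) * beta &
          - g rho = (modeA a (m%:~R - nu) * beta - modeB a (m%:~R - nu) * alpha) / rho]].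
Proof.
move=> hnu a0 rE; have r0 : 0 < rho by rewrite rE expR_gt0.
have lr : ln rho = - a by rewrite rE expRK.
set mu := m%:~R - nu.
have [mu0|mu0] := eqVneq mu 0.
  (* The only integer in [[0, 1)] is 0, so the logarithm occurs on the mode [m = 0] without
     potential. *)
  have [n0 m0] : nu = 0 /\ m = 0.
    have e : m%:~R = nu by apply/eqP; rewrite -subr_eq0 -/mu mu0.
    have /andP[h1 h2] := hnu.
    suff m0 : m = 0 by split; rewrite // -e m0.
    have : 0 <= m%:~R :> R by rewrite e.
    have : m%:~R < 1%:~R :> R by rewrite e.
    by rewrite ltr_int ler0z; lia.
  pose b := (alpha - beta) / a.
  exists (fun q => alpha%:C * mono 0 0 q + b%:C * logr q),
    (fun r => alpha + b * ln r), (fun r => b / r); split.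
  - apply: (Ck_sub (annulus_punctured r0)).
    by apply: Ck_lin; [exact: open_punctured|exact: mono_Ck|exact: logr_Ck].
  - by move=> p /(annulus_punctured r0) hp; rewrite n0; exact: magH_logr.
  - move=> r x hr; rewrite mono_polar// logr_polar// m0 !mul0r expR0 cis0.
    by apply: complex_ext; rewrite ?(ReD, ImD, ReM, ImM) /=; ring.
  - split=> r hr.
      have hl := is_derive1_ln hr.
      by apply: is_derive_eq; rewrite /GRing.scale /=; ring.
    apply: continuousM; first exact: cst_continuous.
    by apply: continuousV; [rewrite gt_eqF|].
  rewrite /modeA /modeB mu0 eqxx /b lr ln1; split.
  - by rewrite mulr0 addr0.
  - by field; rewrite gt_eqF.
  - by field; rewrite gt_eqF.
  - by field; rewrite !gt_eqF.
pose S := sinh (a * mu).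
have S0 : S != 0.
  rewrite /S; have [|] := ltP 0 mu => h.
    by rewrite gt_eqF// sinh_gt0// mulr_gt0.
  rewrite -[mu]opprK mulrN sinhN oppr_eq0 gt_eqF// sinh_gt0// mulr_gt0//.
  by rewrite oppr_gt0 lt_neqAle mu0.
(* [c1] and [c2] solve [c1 + c2 = alpha] and [c1 exp (- a mu) + c2 exp (a mu) = beta], a system of
   determinant [2 S]. *)
pose c1 := (alpha * expR (a * mu) - beta) / (2 * S).
pose c2 := (beta - alpha * expR (- (a * mu))) / (2 * S).
exists (fun q => c1%:C * mono mu m q + c2%:C * mono (- mu) m q),
  (fun r => c1 * expR (mu * ln r) + c2 * expR (- mu * ln r)),
  (fun r => mu / r * (c1 * expR (mu * ln r) - c2 * expR (- mu * ln r))); split.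
- apply: (Ck_sub (annulus_punctured r0)).
  by apply: Ck_lin; [exact: open_punctured|exact: mono_Ck|exact: mono_Ck].
- by move=> p /(annulus_punctured r0) hp; exact: magH_mono.
- move=> r x hr; rewrite !mono_polar// rmorphD !rmorphM /=.
  by ring.
- split=> r hr.
    have hl := is_derive1_ln hr.
    apply: is_derive_eq; rewrite /GRing.scale /=; ring.
  have ce k : {for r, continuous (fun r => expR (k * ln r))}.
    apply: continuous_comp; last exact: continuous_expR.
    apply: continuousM; first exact: cst_continuous.
    exact: continuous_ln.
  apply: continuousM.
    apply: continuousM; first exact: cst_continuous.
    by apply: continuousV; [rewrite gt_eqF|].
  apply: continuousB; apply: continuousM; try exact: cst_continuous.
    exact: ce.
  exact: ce.
have e1 : expR (a * mu) * expR (- (a * mu)) = 1 by exact: expRxMexpNx_1.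
rewrite /modeA /modeB (negbTE mu0) /coth -/S lr ln1 !mulr0 expR0.
rewrite mulrN mulrNN !(mulrC mu a) /c1 /c2 /cosh.
(* Eliminating [exp (a mu)] leaves [S] and [V = exp (- a mu)], tied by the single relation
   [(2 S + V) V = 1]. *)
have SE : expR (a * mu) = S * 2 + expR (- (a * mu)) by rewrite /S /sinh; field.
have V0 := expR_gt0 (- (a * mu)).
move: e1; rewrite SE; clear c1 c2; clearbody S; clear SE.
move: (expR (- (a * mu))) V0 => V V0 e1.
split.
- by field.
- have -> : (alpha * (S * 2 + V) - beta) / (2 * S) * V
     + (beta - alpha * V) / (2 * S) * (S * 2 + V)
     = alpha * ((S * 2 + V) * V - (S * 2 + V) * V) / (2 * S) + beta by field.
  by rewrite subrr mulr0 mul0r add0r.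
- by field.
- have -> : (alpha * (S * 2 + V) - beta) / (2 * S) * V
     - (beta - alpha * V) / (2 * S) * (S * 2 + V)
     = (2 * alpha * ((S * 2 + V) * V) - beta * (S * 2 + V + V)) / (2 * S).
    by field.
  by rewrite e1; field; rewrite gt_eqF// S0.
Qed.

End ModeSolution.

(** * Integration on the circle *)

Section CircleIntegral.
Context {R : realType}.
Local Open Scope complex_scope.
Local Notation mu := (@lebesgue_measure R).
Local Notation D := (@period R : set (measurableTypeR R)).
Implicit Types (f g : R -> R) (u v : R -> R[i]).

Lemma pi2_gt0 : 0 < 2 * pi :> R.
Proof. by rewrite mulr_gt0// pi_gt0. Qed.

Lemma measurable_period : measurable D.
Proof. exact: measurable_itv. Qed.
Local Hint Resolve measurable_period : core.

Lemma period_measure : mu D = (2 * pi)%:E.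
Proof.
rewrite /period lebesgue_measure_itv /= lte_fin pi2_gt0.
by rewrite -EFinB subr0.
Qed.

Lemma rint_cst (c : R) : \int[mu]_(x in D) c = c * (2 * pi).
Proof.
rewrite Rintegral_cst//; congr (_ * _).
by have := congr1 fine period_measure.
Qed.

Definition rintegrable f := mu.-integrable D (EFin \o f).

Lemma rintegrable_bounded f (C : R) : measurable_fun D f ->
  (forall x, D x -> `|f x| <= C) -> rintegrable f.
Proof.
move=> mf fC; apply: measurable_bounded_integrable => //.
  by have := ltry (2 * pi : R); rewrite -period_measure.
exists C; split; first exact: num_real.
by move=> M CM x /= Dx; apply: le_trans (fC x Dx) (ltW CM).
Qed.

Lemma rintegrableD f g : rintegrable f -> rintegrable g ->
  rintegrable (fun x => f x + g x).
Proof.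
move=> hf hg; have := integrableD measurable_period hf hg.
by apply: eq_integrable.
Qed.

Lemma rintegrableZ f (c : R) : rintegrable f -> rintegrable (fun x => c * f x).
Proof.
move=> hf; have := integrableZl measurable_period c hf.
by apply: eq_integrable.
Qed.

Lemma rintegrable_le f g : measurable_fun D f -> rintegrable g ->
  (forall x, D x -> `|f x| <= g x) -> rintegrable f.
Proof.
move=> mf hg fg; apply: (le_integrable _ _ _ hg) => //.
  exact/measurable_EFinP.
move=> x Dx /=; rewrite lee_fin; apply: le_trans (fg x Dx) _.
exact: ler_norm.
Qed.

Lemma rintegrable_measurable f : rintegrable f -> measurable_fun D f.
Proof. by move=> /integrableP[/measurable_EFinP]. Qed.

Definition rl2 f := measurable_fun D f /\ rintegrable (fun x => f x ^+ 2).

Lemma rl2M f g : rl2 f -> rl2 g -> rintegrable (fun x => f x * g x).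
Proof.
move=> [mf hf] [mg hg].
apply: (@rintegrable_le _ (fun x => f x ^+ 2 + g x ^+ 2)).
- exact: measurable_funM.
- exact: rintegrableD.
- move=> x _; rewrite normrM -(real_normK (num_real (f x))).
  rewrite -(real_normK (num_real (g x))).
  have := normr_ge0 (f x); have := normr_ge0 (g x).
  move: `|f x| `|g x| => a b b0 a0; have := sqr_ge0 (a - b); nra.
Qed.

Lemma rl2D f g : rl2 f -> rl2 g -> rl2 (fun x => f x + g x).
Proof.
move=> hf hg; have [mf sf] := hf; have [mg sg] := hg.
split; first exact: measurable_funD.
have := rintegrableD (rintegrableD sf sg) (rintegrableZ 2 (rl2M hf hg)).
by apply: eq_integrable => // x _ /=; congr EFin; ring.
Qed.

Lemma rl2Z f (c : R) : rl2 f -> rl2 (fun x => c * f x).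
Proof.
move=> [mf sf]; split; first exact: measurable_funM.
have := rintegrableZ (c ^+ 2) sf.
by apply: eq_integrable => // x _ /=; congr EFin; ring.
Qed.

Lemma rl2_bounded f (C : R) : measurable_fun D f ->
  (forall x, D x -> `|f x| <= C) -> rl2 f.
Proof.
move=> mf fC; split=> //; apply: (@rintegrable_bounded _ (C ^+ 2)).
  by under eq_fun do rewrite expr2; exact: measurable_funM.
move=> x Dx; rewrite normrX lerXn2r ?nnegrE//; last exact: fC.
exact: le_trans (fC x Dx).
Qed.

Definition cintegrable u := rintegrable (fun x => complex.Re (u x)) /\
  rintegrable (fun x => complex.Im (u x)).

Definition inl2 u := rl2 (fun x => complex.Re (u x)) /\
  rl2 (fun x => complex.Im (u x)).

Lemma eq_rl2 f g : (forall x, f x = g x) -> rl2 f -> rl2 g.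
Proof. by move=> /funext ->. Qed.

Lemma inl2_lin (c : R[i]) u v : inl2 u -> inl2 v ->
  inl2 (fun x => c * u x + v x).
Proof.
move=> [u1 u2] [v1 v2]; split.
  apply: eq_rl2 (rl2D (rl2D (rl2Z (complex.Re c) u1) (rl2Z (- complex.Im c) u2)) v1).
  by move=> x; rewrite ReD ReM; ring.
apply: eq_rl2 (rl2D (rl2D (rl2Z (complex.Re c) u2) (rl2Z (complex.Im c) u1)) v2).
by move=> x; rewrite ImD ImM; ring.
Qed.

Lemma eq_rintegrable f g : (forall x, f x = g x) -> rintegrable f -> rintegrable g.
Proof. by move=> /funext ->. Qed.

Lemma inl2_mul u v : inl2 u -> inl2 v -> cintegrable (fun x => u x * (conjc (v x))).
Proof.
move=> [u1 u2] [v1 v2]; split.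
  apply: eq_rintegrable (rintegrableD (rl2M u1 v1) (rl2M u2 v2)) => x.
  by rewrite ReM ReJ ImJ; ring.
apply: eq_rintegrable
  (rintegrableD (rintegrableZ (-1) (rl2M u1 v2)) (rl2M u2 v1)) => x.
by rewrite ImM ReJ ImJ; ring.
Qed.

Lemma eq_cintegral u v : (forall x, u x = v x) -> cintegral u = cintegral v.
Proof. by move=> /funext ->. Qed.

Lemma rint_lin f g (c d : R) : rintegrable f -> rintegrable g ->
  \int[mu]_(x in D) (c * f x + d * g x) =
  c * \int[mu]_(x in D) f x + d * \int[mu]_(x in D) g x.
Proof.
move=> hf hg; rewrite RintegralD//; [|exact: rintegrableZ|exact: rintegrableZ].
by rewrite !RintegralZl.
Qed.

Lemma cintegral_lin (c : R[i]) u v : cintegrable u -> cintegrable v ->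
  cintegral (fun x => c * u x + v x) = c * cintegral u + cintegral v.
Proof.
move=> [u1 u2] [v1 v2]; rewrite /cintegral; apply: complex_ext.
  rewrite /= ReD ReM /=.
  under eq_Rintegral do rewrite ReD ReM.
  have h := rint_lin (complex.Re c) (- complex.Im c) u1 u2.
  rewrite -mulNr -h -[X in _ + X]mul1r.
  rewrite -[X in X + _]mul1r -rint_lin//; last first.
    exact: rintegrableD (rintegrableZ _ _) (rintegrableZ _ _).
  by apply: eq_Rintegral => x _; rewrite mulNr !mul1r.
rewrite /= ImD ImM /=.
under eq_Rintegral do rewrite ImD ImM.
have h := rint_lin (complex.Re c) (complex.Im c) u2 u1.
rewrite -h -[X in _ + X]mul1r.
rewrite -[X in X + _]mul1r -rint_lin//; last first.
  exact: rintegrableD (rintegrableZ _ _) (rintegrableZ _ _).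
by apply: eq_Rintegral => x _; rewrite !mul1r.
Qed.

Lemma cintegral0 : cintegral (fun=> 0) = 0 :> R[i].
Proof.
by rewrite /cintegral; apply: complex_ext; rewrite /= rint_cst mul0r.
Qed.

Lemma cintegrable0 : cintegrable (fun=> 0).
Proof. by split; apply: (@rintegrable_bounded _ 0) => //= x _; rewrite normr0. Qed.

Lemma cintegralZ (c : R[i]) u : cintegrable u ->
  cintegral (fun x => c * u x) = c * cintegral u.
Proof.
move=> hu; have := cintegral_lin c hu cintegrable0.
by rewrite cintegral0 addr0 => <-; apply: eq_cintegral => x; rewrite addr0.
Qed.

Lemma cintegralJ u : cintegrable u -> cintegral (fun x => (conjc (u x))) = (conjc (cintegral u)).
Proof.
move=> [u1 u2]; rewrite /cintegral; apply: complex_ext => /=.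
  by apply: eq_Rintegral => x _; rewrite ReJ.
rewrite -mulN1r -RintegralZl//.
by apply: eq_Rintegral => x _; rewrite ImJ mulN1r.
Qed.

Lemma measurable_cos_sin (c : R) :
  measurable_fun D (fun x => cos (c * x)) /\ measurable_fun D (fun x => sin (c * x)).
Proof.
split; apply: measurable_funTS; apply: continuous_measurable_fun => x /=.
  apply: continuous_comp; last exact: continuous_cos.
  exact: mulrl_continuous.
apply: continuous_comp; last exact: continuous_sin.
exact: mulrl_continuous.
Qed.

Lemma norm_cos_le1 (x : R) : `|cos x| <= 1.
Proof. by rewrite ler_norml cos_geN1 cos_le1. Qed.
Lemma norm_sin_le1 (x : R) : `|sin x| <= 1.
Proof. by rewrite ler_norml sin_geN1 sin_le1. Qed.

Lemma inl2_cis (c : R) : inl2 (fun x => cis (c * x)).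
Proof.
have [mc ms] := measurable_cos_sin c.
split=> /=; apply: (@rl2_bounded _ 1) => // x _; [exact: norm_cos_le1|].
exact: norm_sin_le1.
Qed.

Lemma cintegrable_cis (c : R) : cintegrable (fun x => cis (c * x)).
Proof.
have [mc ms] := measurable_cos_sin c.
split=> /=; apply: (@rintegrable_bounded _ 1) => // x _; [exact: norm_cos_le1|].
exact: norm_sin_le1.
Qed.

Lemma cos_sin_2pi (m : int) : cos (m%:~R * (2 * pi)) = 1 :> R /\
  sin (m%:~R * (2 * pi)) = 0 :> R.
Proof.
have h : cis (m%:~R * (2 * pi)) = 1 :> R[i].
  rewrite -cis_expz /cis mulr_natl cos2pi sin2pi.
  exact: exp1rz.
by move: h; rewrite /cis => -[-> ->].
Qed.

Lemma cintegral_cis (m : int) :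
  cintegral (fun x => cis (m%:~R * x)) = if m == 0 then (2 * pi)%:C else 0 :> R[i].
Proof.
case: eqP => [->|/eqP m0].
  rewrite /cintegral; apply: complex_ext => /=.
    under eq_Rintegral do rewrite mul0r cos0.
    by rewrite rint_cst mul1r.
  under eq_Rintegral do rewrite mul0r sin0.
  by rewrite rint_cst mul0r.
have M0 : m%:~R != 0 :> R by rewrite intr_eq0.
have [c2 s2] := cos_sin_2pi m.
have cc : {within `[0, 2 * pi], continuous (fun x : R => cos (m%:~R * x))}.
  apply: continuous_subspaceT => x; apply: continuous_comp; last exact: continuous_cos.
  exact: mulrl_continuous.
have cs : {within `[0, 2 * pi], continuous (fun x : R => sin (m%:~R * x))}.
  apply: continuous_subspaceT => x; apply: continuous_comp; last exact: continuous_sin.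
  exact: mulrl_continuous.
have dS (x : R) : is_derive x (1 : R) (fun x => sin (m%:~R * x) / m%:~R) (cos (m%:~R * x)).
  by apply: is_derive_eq; rewrite /GRing.scale /=; field.
have dC (x : R) : is_derive x (1 : R) (fun x => - (cos (m%:~R * x) / m%:~R)) (sin (m%:~R * x)).
  by apply: is_derive_eq; rewrite /GRing.scale /=; field.
have dd (F G : R -> R) : (forall x, is_derive x (1 : R) F (G x)) ->
   derivable_oo_LRcontinuous F 0 (2 * pi).
  move=> FG; have cF x : {for x, continuous F}.
    by apply: differentiable_continuous; apply/derivable1_diffP; case: (FG x).
  split; [by move=> x _; case: (FG x)| |].
    exact: cvg_at_right_filter (cF 0).
  exact: cvg_at_left_filter (cF (2 * pi)).
rewrite /cintegral; apply: complex_ext => /=.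
  rewrite /Rintegral (continuous_FTC2 pi2_gt0 cc (dd _ _ dS)).
    by rewrite /= s2 mulr0 sin0 !mul0r subrr.
  by move=> x _; rewrite derive1E; case: (dS x).
rewrite /Rintegral (continuous_FTC2 pi2_gt0 cs (dd _ _ dC)).
  by rewrite /= c2 mulr0 cos0 subrr.
by move=> x _; rewrite derive1E; case: (dC x).
Qed.

Lemma fourier_mode (c : R[i]) (m n : int) :
  fourier (fun x => c * cis (m%:~R * x)) n = if n == m then c else 0.
Proof.
rewrite /fourier.
rewrite (@eq_cintegral _ (fun x => c * cis ((m - n)%:~R * x))); last first.
  by move=> x; rewrite -mulrA -cisD intrB; congr (_ * cis _); ring.
rewrite cintegralZ; last exact: cintegrable_cis.
rewrite cintegral_cis subr_eq0 eq_sym; case: eqP => _; last by rewrite !mulr0.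
rewrite mulrCA -rmorphM /= mulVf ?mulr1//.
by rewrite gt_eqF// pi2_gt0.
Qed.

End CircleIntegral.

(** * Diagonal operators on a pre-Hilbert space *)

Section PreHilbert.
Context {R : realType}.
Local Open Scope complex_scope.
Context {V : lmodType R[i]} (P : V -> Prop) (ip : V -> V -> R[i]).

(** Vectors are cut out of a larger space by a predicate and the form is only semidefinite:
    functions equal almost everywhere stay distinct, so identities for operators are stated through
    [sqnorm]. *)
Definition pre_hilbert := [/\ P 0,
  forall c u v, P u -> P v -> P (c *: u + v),
  forall c u v w, P u -> P v -> P w -> ip (c *: u + v) w = c * ip u w + ip v w,
  forall u v, P u -> P v -> ip v u = (conjc (ip u v)) &
  forall u, P u -> 0 <= complex.Re (ip u u)].

Context (H : pre_hilbert).

Definition sqnorm u : R := complex.Re (ip u u).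
Local Notation nrm2 := sqnorm.

Let P0 : P 0. Proof. by case: H. Qed.
Let Plin c u v : P u -> P v -> P (c *: u + v). Proof. by case: H => _ + _ _ _; exact. Qed.
Let iplin c u v w : P u -> P v -> P w -> ip (c *: u + v) w = c * ip u w + ip v w.
Proof. by case: H => _ _ + _ _; exact. Qed.
Let ipJ u v : P u -> P v -> ip v u = (conjc (ip u v)).
Proof. by case: H => _ _ _ + _; exact. Qed.
Lemma nrm2_ge0 u : P u -> 0 <= nrm2 u. Proof. by case: H => _ _ _ _; exact. Qed.

Lemma preZ c u : P u -> P (c *: u).
Proof. by move=> hu; rewrite -[_ *: _]addr0; exact: Plin. Qed.
Lemma preD u v : P u -> P v -> P (u + v).
Proof. by move=> hu hv; rewrite -[u]scale1r; exact: Plin. Qed.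
Lemma preB u v : P u -> P v -> P (u - v).
Proof. by move=> hu hv; rewrite addrC -scaleN1r; exact: Plin. Qed.
Lemma pre_sum n (f : nat -> V) : (forall k, P (f k)) -> P (\sum_(k < n) f k).
Proof.
move=> hf; elim: n => [|n IH]; first by rewrite big_ord0.
by rewrite big_ord_recr; exact: preD.
Qed.

Lemma ip0l w : P w -> ip 0 w = 0.
Proof.
move=> hw; have := iplin 1 P0 P0 hw; rewrite scaler0 addr0 mul1r.
by move=> /(congr1 (fun z => z - ip 0 w)); rewrite subrr addrK.
Qed.
Lemma ipZl c u w : P u -> P w -> ip (c *: u) w = c * ip u w.
Proof. by move=> hu hw; rewrite -[_ *: _]addr0 iplin// ip0l// addr0. Qed.
Lemma ipDl u v w : P u -> P v -> P w -> ip (u + v) w = ip u w + ip v w.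
Proof. by move=> hu hv hw; rewrite -{1}[u]scale1r iplin// mul1r. Qed.
Lemma ipBl u v w : P u -> P v -> P w -> ip (u - v) w = ip u w - ip v w.
Proof. by move=> hu hv hw; rewrite addrC -scaleN1r iplin// mulN1r addrC. Qed.
Lemma ip_suml n (f : nat -> V) w : (forall k, P (f k)) -> P w ->
  ip (\sum_(k < n) f k) w = \sum_(k < n) ip (f k) w.
Proof.
move=> hf hw; elim: n => [|n IH]; first by rewrite !big_ord0 ip0l.
by rewrite !big_ord_recr ipDl ?IH//; exact: pre_sum.
Qed.
Lemma ipDr u v w : P u -> P v -> P w -> ip w (u + v) = ip w u + ip w v.
Proof.
move=> hu hv hw; rewrite (ipJ (preD hu hv) hw) ipDl// rmorphD /=.
by rewrite -!ipJ.
Qed.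
Lemma ipZr c u w : P u -> P w -> ip w (c *: u) = (conjc c) * ip w u.
Proof.
by move=> hu hw; rewrite (ipJ (preZ c hu) hw) ipZl// rmorphM /= -ipJ.
Qed.

Lemma Re_conjM (z : R[i]) : complex.Re (z * (conjc z)) = sqmod z.
Proof. by case: z => a b; rewrite /sqmod /= !expr2 mulrN opprK. Qed.

Lemma nrm2D u v : P u -> P v ->
  nrm2 (u + v) = nrm2 u + nrm2 v + 2 * complex.Re (ip u v).
Proof.
move=> hu hv; rewrite /sqnorm ipDl ?ipDr//; try exact: preD.
rewrite (ipJ hu hv) !ReD ReJ; ring.
Qed.

Lemma nrm2Z c u : P u -> nrm2 (c *: u) = sqmod c * nrm2 u.
Proof.
move=> hu; rewrite /sqnorm ipZl ?ipZr//; last exact: preZ.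
rewrite mulrA ReM Re_conjM.
have -> : complex.Im (c * (conjc c)) = 0 by case: c => a b; rewrite /= mulrC; ring.
by rewrite mul0r subr0.
Qed.

Lemma nrm2B u v : P u -> P v ->
  nrm2 (u - v) = nrm2 u + nrm2 v - 2 * complex.Re (ip u v).
Proof.
move=> hu hv; rewrite -scaleN1r nrm2D ?nrm2Z ?ipZr//; try exact: preZ.
rewrite (_ : sqmod (-1) = 1); last by rewrite /sqmod /= oppr0; ring.
rewrite mul1r rmorphN rmorph1 mulN1r ReN; ring.
Qed.

Lemma nrm2D_le u v : P u -> P v -> nrm2 (u + v) <= 2 * nrm2 u + 2 * nrm2 v.
Proof.
move=> hu hv; have := nrm2_ge0 (preB hu hv).
by rewrite nrm2B// nrm2D//; lra.
Qed.

Lemma nrm2B_le u v : P u -> P v -> nrm2 (u - v) <= 2 * nrm2 u + 2 * nrm2 v.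
Proof.
move=> hu hv; have := nrm2_ge0 (preD hu hv).
by rewrite nrm2B// nrm2D//; lra.
Qed.

(* Testing against the real multiples of [<u,v> *: v] makes the cross term real. *)
Lemma cauchy_schwarz u v : P u -> P v -> sqmod (ip u v) <= nrm2 u * nrm2 v.
Proof.
move=> hu hv; set z := ip u v.
have n0 := nrm2_ge0 hu; have m0 := nrm2_ge0 hv.
have key (s : R) : 0 <= nrm2 u + s ^+ 2 * sqmod z * nrm2 v - 2 * s * sqmod z.
  have := nrm2_ge0 (preB hu (preZ (s%:C * z) hv)).
  rewrite nrm2B ?nrm2Z ?ipZr//; last exact: preZ.
  rewrite -/z; clearbody z.
  have -> : complex.Re ((conjc (s%:C * z)) * z) = s * sqmod z.
    by rewrite /sqmod !(ReM, ReJ, ImJ, ImM) /=; ring.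
  have -> : sqmod (s%:C * z) = s ^+ 2 * sqmod z.
    by rewrite /sqmod ReM ImM /=; ring.
  by rewrite mulrA.
have z0 : 0 <= sqmod z by rewrite /sqmod addr_ge0 ?sqr_ge0.
move: m0; rewrite le_eqVlt => /predU1P[m0|m0].
  (* If [v] has norm zero, [key] is affine in [s] with slope [- 2 sqmod z]; the [s] chosen next
     would make it equal to -1. *)
  rewrite -m0 mulr0; have [//|zp] := leP (sqmod z) 0.
  have := key ((nrm2 u + 1) / (2 * sqmod z)); rewrite -m0 mulr0 addr0.
  have -> : 2 * ((nrm2 u + 1) / (2 * sqmod z)) * sqmod z = nrm2 u + 1.
    by field; rewrite gt_eqF.
  by lra.
have := key (nrm2 v)^-1.
have -> : nrm2 u + (nrm2 v)^-1 ^+ 2 * sqmod z * nrm2 v - 2 * (nrm2 v)^-1 * sqmod z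
  = (nrm2 u * nrm2 v - sqmod z) / nrm2 v by field; rewrite gt_eqF.
by rewrite pmulr_lge0 ?invr_gt0// subr_ge0.
Qed.

Definition orthonormal (e : nat -> V) := (forall k, P (e k)) /\
  forall j k, ip (e j) (e k) = (j == k)%:R.

(** The error splits into a part independent of [c] and the squared distance from [c] to the Fourier
    coefficients. Bessel, Parseval and the norm of a finite sum all come from this identity. *)
Lemma nrm2_sub_sum e u (c : nat -> R[i]) n : orthonormal e -> P u ->
  nrm2 (u - \sum_(k < n) c k *: e k) = nrm2 u - \sum_(k < n) sqmod (ip u (e k))
    + \sum_(k < n) sqmod (c k - ip u (e k)).
Proof.
move=> [he ho] hu; have hce k : P (c k *: e k) by exact: preZ.
elim: n => [|n IH]; first by rewrite !big_ord0 !subr0 addr0.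
have pS := @pre_sum n (fun k => c k *: e k) hce.
rewrite !big_ord_recr /= opprD addrA nrm2B//; last exact: preB.
rewrite IH ipZr//; last exact: preB.
rewrite ipBl// (@ip_suml n (fun k => c k *: e k))//.
rewrite [X in ip u (e n) - X]big1 ?subr0; last first.
  by move=> i _; rewrite ipZl// ho ltn_eqF// mulr0.
rewrite nrm2Z// /sqnorm ho eqxx /= mulr1.
have -> : sqmod (c n - ip u (e n)) = sqmod (c n) + sqmod (ip u (e n))
    - 2 * complex.Re ((conjc (c n)) * ip u (e n)).
  by rewrite /sqmod ReM ReJ ImJ ReD ImD ReN ImN; ring.
by ring.
Qed.

Lemma bessel e u n : orthonormal e -> P u ->
  \sum_(k < n) sqmod (ip u (e k)) <= nrm2 u.
Proof.
move=> he hu; have := @nrm2_sub_sum e u (fun k => ip u (e k)) n he hu.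
rewrite [X in _ - _ + X]big1 ?addr0; last first.
  by move=> i _; rewrite subrr /sqmod /= expr0n addr0.
have : 0 <= nrm2 (u - \sum_(k < n) ip u (e k) *: e k).
  apply/nrm2_ge0/preB => //; apply: (@pre_sum n (fun k => ip u (e k) *: e k)) => k.
  by apply: preZ; case: he.
lra.
Qed.

Definition complete (e : nat -> V) := forall u, P u -> forall eps : R, 0 < eps ->
  exists n (c : nat -> R[i]), nrm2 (u - \sum_(k < n) c k *: e k) < eps.

Lemma sqmod_ge0 (z : R[i]) : 0 <= sqmod z.
Proof. by rewrite /sqmod addr_ge0 ?sqr_ge0. Qed.

(** [complete] provides some coefficients; the Fourier coefficients do at least as well, so the
    Bessel sums come within [eps] of the squared norm. *)
Lemma parseval e u : orthonormal e -> complete e -> P u ->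
  series (fun k => sqmod (ip u (e k))) @ \oo --> nrm2 u.
Proof.
move=> he hc hu; apply/cvgrPdist_lt => eps eps0.
have [n [c hn]] := hc u hu eps eps0.
exists n => // m /= nm.
have hm := bessel m he hu; rewrite seriesEord /= ger0_norm ?subr_ge0//.
apply: le_lt_trans hn; rewrite (nrm2_sub_sum _ _ he hu) -addrA lerD2l.
have : \sum_(k < n) sqmod (ip u (e k)) <= \sum_(k < m) sqmod (ip u (e k)).
  rewrite -(subnKC nm) big_split_ord /= lerDl sumr_ge0// => i _; exact: sqmod_ge0.
have : 0 <= \sum_(k < n) sqmod (c k - ip u (e k)).
  by apply: sumr_ge0 => i _; exact: sqmod_ge0.
lra.
Qed.

End PreHilbert.

(** * Nonnegative series and limits at zero *)

Section NonnegSeries.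
Context {R : realType}.
Implicit Types (f : R^nat) (l : R).

Lemma nneseries_EFin f l : series f @ \oo --> l ->
  (\sum_(0 <= i <oo) (f i)%:E)%E = l%:E.
Proof.
move=> fl; apply/cvg_lim => //.
rewrite (_ : (fun n => _) = EFin \o series f).
  by apply/fine_cvgP; split; [exact: nearW|].
by apply/funext => n /=; rewrite sumEFin.
Qed.

Lemma cvg_series_EFin f l : (forall n, 0 <= f n) ->
  (\sum_(0 <= i <oo) (f i)%:E)%E = l%:E -> series f @ \oo --> l.
Proof.
move=> f0 fl.
have : (fun n => \sum_(0 <= i < n) (f i)%:E)%E @ \oo --> l%:E.
  by rewrite -fl; apply: is_cvg_nneseries => n _ _; rewrite lee_fin.
rewrite (_ : (fun n => _) = EFin \o series f); last first.
  by apply/funext => n /=; rewrite sumEFin.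
by move=> /fine_cvgP[].
Qed.

Lemma cvg0_sqr (x b : R^nat) : (forall n, x n ^+ 2 <= b n) ->
  b @ \oo --> (0 : R) -> x @ \oo --> (0 : R).
Proof.
move=> xb b0; apply/cvgrPdist_lt => eps eps0.
have e2 : 0 < eps ^+ 2 by rewrite exprn_gt0.
move/cvgrPdist_lt : b0 => /(_ _ e2); apply: filterS => n.
rewrite !sub0r !normrN => h.
rewrite -(@ltr_pXn2r _ 2)// ?nnegrE ?ltW// -normrX ger0_norm ?sqr_ge0//.
exact: le_lt_trans (xb n) (le_lt_trans (ler_norm _) h).
Qed.

Lemma cvg0_cst (c : R) (b : R^nat) : 0 <= c -> (\forall n \near \oo, c <= b n) ->
  b @ \oo --> (0 : R) -> c = 0.
Proof.
move=> c0 cb b0; apply/eqP; rewrite eq_le c0 andbT.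
apply/ler_addgt0Pr => eps eps0; rewrite add0r.
move/cvgrPdist_lt : b0 => /(_ _ eps0) h.
have [n [h1 h2]] := filter_ex (filterI cb h).
move: h2; rewrite sub0r normrN => h2.
exact: le_trans h1 (le_trans (ler_norm _) (ltW h2)).
Qed.

End NonnegSeries.

(** * Bounds, linearity and trace of a limit of finite diagonal sums *)

Section DiagonalOperator.
Context {R : realType}.
Local Open Scope complex_scope.
Context {V : lmodType R[i]} (P : V -> Prop) (ip : V -> V -> R[i]).
Context (H : pre_hilbert P ip) (e : nat -> V) (he : orthonormal P ip e).
Context (w : nat -> R) (W : R) (w0 : forall k, 0 <= w k)
  (wW : series w @ \oo --> W).
Local Notation nrm2 := (sqnorm ip).

Definition diag_sum u n := \sum_(k < n) ((w k)%:C * ip u (e k)) *: e k.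

Context (E : V -> V) (PE : forall u, P u -> P (E u))
  (Elim : forall u, P u -> (fun n => nrm2 (E u - diag_sum u n)) @ \oo --> (0 : R)).

Let Pe k : P (e k). Proof. by case: he. Qed.

Lemma diag_sum_pre u n : P u -> P (diag_sum u n).
Proof.
move=> hu; apply: (@pre_sum _ _ _ _ H n (fun k => ((w k)%:C * ip u (e k)) *: e k)).
by move=> k; exact: (preZ H).
Qed.

Lemma ip_diag_sum u n : P u ->
  ip (diag_sum u n) u = (\sum_(k < n) w k * sqmod (ip u (e k)))%:C.
Proof.
move=> hu; rewrite /diag_sum.
rewrite (@ip_suml _ _ _ _ H n (fun k => ((w k)%:C * ip u (e k)) *: e k))//; last first.
  by move=> k; exact: (preZ H).
rewrite rmorph_sum; apply: eq_bigr => k _ /=.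
rewrite (ipZl H)//; have -> : ip (e k) u = (conjc (ip u (e k))).
  by case: H => _ _ _ + _; apply.
rewrite rmorphM -mulrA; congr (_ * _).
by apply: complex_ext; rewrite ?Re_conjM// ImM ReJ ImJ /=; ring.
Qed.

Lemma cvg_ip_diag u : P u ->
  series (fun k => w k * sqmod (ip u (e k))) @ \oo --> complex.Re (ip (E u) u) /\
  complex.Im (ip (E u) u) = 0.
Proof.
move=> hu; pose d n := ip (E u) u - ip (diag_sum u n) u.
have dle n : sqmod (d n) <= nrm2 (E u - diag_sum u n) * nrm2 u.
  rewrite /d -(ipBl H)//; [|exact: PE|exact: diag_sum_pre].
  by apply: (cauchy_schwarz H) => //; apply: (preB H); [exact: PE|exact: diag_sum_pre].
have b0 : (fun n => nrm2 (E u - diag_sum u n) * nrm2 u) @ \oo --> (0 : R).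
  by rewrite -[X in _ --> X](mul0r (nrm2 u)); apply: cvgMl; exact: Elim.
split; last first.
  apply/eqP; rewrite -sqrf_eq0; apply/eqP.
  apply: (cvg0_cst (sqr_ge0 _) _ b0); apply: nearW => n; apply: le_trans (dle n).
  rewrite /d ip_diag_sum// /sqmod ReD ReN ImD ImN /= oppr0 addr0.
  by rewrite lerDr sqr_ge0.
apply/subr_cvg0.
have h : (fun n => complex.Re (d n)) @ \oo --> (0 : R).
  apply: cvg0_sqr b0 => n; apply: le_trans (dle n).
  by rewrite /sqmod lerDl sqr_ge0.
have := cvgN h; rewrite oppr0.
rewrite (_ : - _ = (fun n => series (fun k => w k * sqmod (ip u (e k))) n
   - complex.Re (ip (E u) u))); first exact.
apply/funext => n; rewrite [LHS](_ : _ = - complex.Re (d n))//.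
by rewrite /d ip_diag_sum// ReD ReN /= seriesEord /= opprB.
Qed.

(** The diagonal entry at [f k] is the sum over [j] of [w j |<f k, e j>|^2]. All terms are
    nonnegative, so the sums may be exchanged, and the sum over [k] is the squared norm of [e j],
    that is 1, by Parseval in the basis [f]. *)
Lemma diag_trace (f : nat -> V) : orthonormal P ip f -> complete P ip f ->
  series (fun k => complex.Re (ip (E (f k)) (f k))) @ \oo --> W /\
  series (fun k => complex.Im (ip (E (f k)) (f k))) @ \oo --> (0 : R).
Proof.
move=> hf cf; have Pf k : P (f k) by case: hf.
split; last first.
  rewrite (_ : series _ = (fun=> 0)); first exact: cvg_cst.
  apply/funext => n; rewrite seriesEnat /= big1// => k _.
  by have [_ ->] := cvg_ip_diag (Pf k).
have a0 k j : (0 <= (w j * sqmod (ip (f k) (e j)))%:E)%E.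
  by rewrite lee_fin mulr_ge0// sqmod_ge0.
apply: cvg_series_EFin.
  move=> k; have [h _] := cvg_ip_diag (Pf k).
  rewrite -(cvg_lim _ h)//; apply: limr_ge; first by apply/cvg_ex; eexists; exact: h.
  apply: nearW => n; rewrite seriesEnat /= sumr_ge0// => i _.
  by rewrite mulr_ge0// sqmod_ge0.
rewrite (eq_eseriesr (g := fun k =>
  (\sum_(0 <= j <oo) (w j * sqmod (ip (f k) (e j)))%:E)%E)); last first.
  by move=> k _; have [h _] := cvg_ip_diag (Pf k); rewrite (nneseries_EFin h).
rewrite (nneseries_interchange xpredT xpredT a0).
rewrite (eq_eseriesr (g := fun j => (w j)%:E)); first exact: nneseries_EFin.
move=> j _; apply: nneseries_EFin; rewrite -[X in _ --> X]mulr1.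
have -> : 1 = nrm2 (e j).
  by rewrite /sqnorm; case: he => _ ->; rewrite eqxx.
apply: cvg_seriesZ.
have := parseval H hf cf (Pe j).
rewrite (_ : (fun k => sqmod (ip (e j) (f k))) = (fun k => sqmod (ip (f k) (e j))))//.
apply/funext => k.
have -> : ip (e j) (f k) = (conjc (ip (f k) (e j))).
  by case: H => _ _ _ + _; apply.
by rewrite /sqmod ReJ ImJ sqrrN.
Qed.

Lemma nrm2N u : P u -> nrm2 (- u) = nrm2 u.
Proof.
move=> hu; rewrite -scaleN1r (nrm2Z H)//.
by rewrite (_ : sqmod (-1) = 1) ?mul1r// /sqmod /= oppr0; ring.
Qed.

Lemma w_le k : w k <= W.
Proof.
have h : series w k.+1 <= W.
  rewrite -(cvg_lim _ wW)//; apply: nondecreasing_cvgn_le.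
    apply/nondecreasing_seqP => n; rewrite seriesSr lerDl//.
  by apply/cvg_ex; exists W.
apply: le_trans h; rewrite seriesSr lerDr seriesEnat /= sumr_ge0//.
Qed.

Lemma nrm2_diag_sum u n : P u -> nrm2 (diag_sum u n) <= W ^+ 2 * nrm2 u.
Proof.
move=> hu.
have H0 : P 0 by case: H.
(* At the vector 0 this identity computes the squared norm of the finite sum itself. *)
have := @nrm2_sub_sum _ _ _ _ H e 0 (fun k => (w k)%:C * ip u (e k)) n he H0.
rewrite sub0r nrm2N; last exact: diag_sum_pre.
rewrite /diag_sum => ->.
rewrite {1}/sqnorm (ip0l H)// sub0r big1 ?oppr0 ?add0r; last first.
  by move=> k _; rewrite (ip0l H)// /sqmod /= expr0n addr0.
apply: (@le_trans _ _ (W ^+ 2 * \sum_(k < n) sqmod (ip u (e k)))); last first.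
  by rewrite ler_wpM2l ?sqr_ge0// (bessel H).
rewrite big_distrr /=; apply: ler_sum => k _.
rewrite (ip0l H)// subr0.
have -> : sqmod ((w k)%:C * ip u (e k)) = w k ^+ 2 * sqmod (ip u (e k)).
  by rewrite /sqmod ReM ImM /=; ring.
rewrite ler_wpM2r ?sqmod_ge0// lerXn2r ?nnegrE// ?w_le//.
exact: le_trans (w0 k) (w_le k).
Qed.

Lemma nrm2_diag u : P u -> nrm2 (E u) <= 2 * W ^+ 2 * nrm2 u.
Proof.
move=> hu; apply/ler_addgt0Pr => eps eps0.
have e2 : 0 < eps / 2 by rewrite divr_gt0.
have /cvgrPdist_lt /(_ _ e2) /filter_ex[n] := Elim hu.
rewrite sub0r normrN => h.
have h' := le_lt_trans (ler_norm _) h.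
have PS := diag_sum_pre n hu.
have := nrm2D_le H (preB H (PE hu) PS) PS; rewrite subrK => h1.
apply: (le_trans h1); rewrite -mulrA addrC lerD//.
  by rewrite ler_wpM2l// nrm2_diag_sum.
by rewrite mulrC -ler_pdivlMr// ltW.
Qed.

(** The finite sums are exactly linear; [E] is determined by them only up to null vectors, and so is
    its linearity. *)
Lemma diag_linear c u v : P u -> P v ->
  nrm2 (E (c *: u + v) - (c *: E u + E v)) = 0.
Proof.
move=> hu hv; have hcuv : P (c *: u + v) by case: H => _ + _ _ _; apply.
have Pcomb x y : P x -> P y -> P (c *: x + y).
  by case: H => _ + _ _ _; apply.
have Slin n : diag_sum (c *: u + v) n = c *: diag_sum u n + diag_sum v n.
  rewrite /diag_sum scaler_sumr -big_split /=; apply: eq_bigr => k _.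
  have -> : ip (c *: u + v) (e k) = c * ip u (e k) + ip v (e k).
    by case: H => _ _ + _ _; apply.
  by rewrite scalerA -scalerDl; congr (_ *: _); ring.
pose b n := 2 * nrm2 (E (c *: u + v) - diag_sum (c *: u + v) n)
  + 2 * (2 * (sqmod c * nrm2 (E u - diag_sum u n)) + 2 * nrm2 (E v - diag_sum v n)).
have b0 : b @ \oo --> (0 : R).
  have z : 0 = 2 * 0 + 2 * (2 * (sqmod c * 0) + 2 * 0) :> R by ring.
  rewrite [X in _ --> X]z.
  apply: cvgD; first by apply: cvgMr; exact: Elim.
  apply: cvgMr; apply: cvgD; first by do 2! apply: cvgMr; exact: Elim.
  by apply: cvgMr; exact: Elim.
have PA := PE hcuv; have Pu := PE hu; have Pv := PE hv.
apply: (cvg0_cst _ _ b0).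
  by apply: (nrm2_ge0 H); apply: (preB H) => //; exact: Pcomb.
apply: nearW => n.
have Q1 := diag_sum_pre n hu; have Q2 := diag_sum_pre n hv.
have Q3 := diag_sum_pre n hcuv.
have D1 : P (E u - diag_sum u n) by exact: (preB H).
have D2 : P (E v - diag_sum v n) by exact: (preB H).
have D3 : P (E (c *: u + v) - diag_sum (c *: u + v) n) by exact: (preB H).
have -> : E (c *: u + v) - (c *: E u + E v) =
  (E (c *: u + v) - diag_sum (c *: u + v) n)
  - (c *: (E u - diag_sum u n) + (E v - diag_sum v n)).
  rewrite Slin scalerBr.
  move: (E _) (E v) (c *: E u) (c *: diag_sum u n) (diag_sum v n) => x1 x2 x3 x4 x5.
  by rewrite [x3 - x4 + _]addrACA -[- x4 - x5]opprD opprB addrA subrK.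
apply: le_trans (nrm2B_le H D3 (Pcomb _ _ D1 D2)) _.
rewrite /b lerD2l ler_wpM2l// -(nrm2Z H)//.
by apply: (nrm2D_le H) => //; exact: (preZ H).
Qed.

Lemma diag_eigen k : nrm2 (E (e k) - (w k)%:C *: e k) = 0.
Proof.
apply: (cvg0_cst _ _ (Elim (Pe k))).
  by apply: (nrm2_ge0 H); apply: (preB H); [exact: PE|exact: (preZ H)].
exists k.+1 => // n /= kn; rewrite /diag_sum (bigD1 (Ordinal kn))//= big1 ?addr0.
  by case: he => _ ->; rewrite eqxx mulr1.
move=> i /eqP ik; case: he => _ ->; case: eqP => [ki|_].
  by exfalso; apply: ik; apply: val_inj.
by rewrite mulr0 scale0r.
Qed.

End DiagonalOperator.

(** * The space L^2 of the boundary *)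

Section BoundaryL2.
Context {R : realType}.
Local Open Scope complex_scope.
Local Notation mu := (@lebesgue_measure R).
Local Notation D := (@period R : set (measurableTypeR R)).
Local Hint Resolve measurable_period : core.
Local Notation bfun := ((R -> R[i]^o) * (R -> R[i]^o))%type.
Implicit Types (rho : R) (Psi Phi : bfun) (u v : R -> R[i]).

Lemma rint_EFin (f : R -> R) : rintegrable f ->
  (\int[mu]_(x in D) (f x)%:E)%E = (\int[mu]_(x in D) f x)%:E.
Proof.
move=> hf; rewrite /Rintegral fineK//.
exact: (integrable_fin_num (@measurable_period R) hf).
Qed.

Lemma inl2_sqmod u : inl2 u -> rintegrable (fun x => sqmod (u x)).
Proof. by move=> [[_ h1] [_ h2]]; exact: rintegrableD. Qed.

Lemma measurable_sqmod u : circle_measurable u ->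
  measurable_fun D (fun x => sqmod (u x)).
Proof.
move=> [m1 m2]; apply: measurable_funD.
  by under eq_fun do rewrite expr2; exact: measurable_funM.
by under eq_fun do rewrite expr2; exact: measurable_funM.
Qed.

Lemma inl2P u : circle_measurable u ->
  (\int[mu]_(x in D) (sqmod (u x))%:E < +oo)%E -> inl2 u.
Proof.
move=> [m1 m2] fin.
have h : rintegrable (fun x => sqmod (u x)).
  apply/integrableP; split; first by apply/measurable_EFinP; exact: measurable_sqmod.
  apply: le_lt_trans fin; rewrite le_eqVlt; apply/orP; left; apply/eqP.
  by apply: eq_integral => x _ /=; rewrite ger0_norm ?sqmod_ge0.
split; split => //.
  apply: rintegrable_le h _.
    by under eq_fun do rewrite expr2; exact: measurable_funM.
  by move=> x _; rewrite ger0_norm ?sqr_ge0// /sqmod lerDl sqr_ge0.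
apply: rintegrable_le h _.
  by under eq_fun do rewrite expr2; exact: measurable_funM.
by move=> x _; rewrite ger0_norm ?sqr_ge0// /sqmod lerDr sqr_ge0.
Qed.

Lemma inl2_circle_measurable u : inl2 u -> circle_measurable u.
Proof. by move=> [[m1 _] [m2 _]]; split. Qed.

Lemma bnorm2_fin rho Psi : 0 < rho -> inl2 Psi.1 -> inl2 Psi.2 ->
  bnorm2 rho Psi = (\int[mu]_(x in D) sqmod (Psi.1 x)
    + rho * \int[mu]_(x in D) sqmod (Psi.2 x))%:E.
Proof.
move=> r0 h1 h2; rewrite /bnorm2 !rint_EFin//; exact: inl2_sqmod.
Qed.

Lemma inL2P rho Psi : 0 < rho -> inL2 rho Psi <-> inl2 Psi.1 /\ inl2 Psi.2.
Proof.
move=> r0; split=> [[m1 m2 fin]|[h1 h2]].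
  have i1 : (0 <= \int[mu]_(x in D) (sqmod (Psi.1 x))%:E)%E.
    by apply: integral_ge0 => x _; rewrite lee_fin sqmod_ge0.
  have i2 : (0 <= \int[mu]_(x in D) (sqmod (Psi.2 x))%:E)%E.
    by apply: integral_ge0 => x _; rewrite lee_fin sqmod_ge0.
  split; apply: inl2P => //.
    by apply: le_lt_trans fin; rewrite /bnorm2 leeDl// mule_ge0// lee_fin ltW.
  have : (rho%:E * \int[mu]_(x in D) (sqmod (Psi.2 x))%:E < +oo)%E.
    by apply: le_lt_trans fin; rewrite /bnorm2 leeDr.
  rewrite !ltey; apply: contra => /eqP ->.
  by rewrite gt0_muley// lte_fin.
split; [exact: inl2_circle_measurable|exact: inl2_circle_measurable|].
by rewrite bnorm2_fin// ltry.
Qed.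

Lemma Re_cintegral_sqmod u :
  complex.Re (cintegral (fun x => u x * (conjc (u x)))) = \int[mu]_(x in D) sqmod (u x).
Proof. by rewrite /cintegral /=; apply: eq_Rintegral => x _; rewrite Re_conjM. Qed.

Lemma binnerE rho Psi Phi : binner rho Psi Phi =
  cintegral (fun x => Psi.1 x * conjc (Phi.1 x)) +
  rho%:C * cintegral (fun x => Psi.2 x * conjc (Phi.2 x)).
Proof. by []. Qed.

Lemma sqnorm_binner rho Psi : sqnorm (binner rho) Psi =
  \int[mu]_(x in D) sqmod (Psi.1 x) + rho * \int[mu]_(x in D) sqmod (Psi.2 x).
Proof.
rewrite /sqnorm binnerE ReD ReM !Re_cintegral_sqmod /= mul0r subr0.
by [].
Qed.

Lemma bnorm2E rho Psi : 0 < rho -> inL2 rho Psi ->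
  bnorm2 rho Psi = (sqnorm (binner rho) Psi)%:E.
Proof. by move=> r0 /(inL2P _ r0)[h1 h2]; rewrite sqnorm_binner bnorm2_fin. Qed.

Lemma inL2_pre_hilbert rho : 0 < rho ->
  @pre_hilbert R bfun (inL2 rho) (binner rho).
Proof.
move=> r0; have rl0 : inl2 (fun=> 0 : R[i]).
  by split; apply: (@rl2_bounded _ _ 0) => //= x _; rewrite normr0.
split.
- by apply/inL2P => //; split.
- move=> c u v /(inL2P _ r0)[u1 u2] /(inL2P _ r0)[v1 v2]; apply/inL2P => //.
  by split; exact: inl2_lin.
- move=> c u v w /(inL2P _ r0)[u1 u2] /(inL2P _ r0)[v1 v2] /(inL2P _ r0)[w1 w2].
  rewrite !binnerE.
  rewrite (@eq_cintegral _ _ (fun x => c * (u.1 x * (conjc (w.1 x))) + v.1 x * (conjc (w.1 x)))).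
    rewrite (@eq_cintegral _ (fun x => (c *: u + v).2 x * (conjc (w.2 x)))
      (fun x => c * (u.2 x * (conjc (w.2 x))) + v.2 x * (conjc (w.2 x)))).
      by rewrite !cintegral_lin; try exact: inl2_mul; ring.
    by move=> x; rewrite mulrA -mulrDl.
  by move=> x; rewrite mulrA -mulrDl.
- move=> u v /(inL2P _ r0)[u1 u2] /(inL2P _ r0)[v1 v2].
  have cE (z w : R[i]) : (conjc (z + rho%:C * w)) = (conjc z) + rho%:C * (conjc w).
    by apply: complex_ext; rewrite !(ReJ, ImJ, ReD, ImD, ReM, ImM) /=; ring.
  have cM (z w : R[i]) : (conjc (z * (conjc w))) = w * (conjc z).
    by apply: complex_ext; rewrite !(ReJ, ImJ, ReM, ImM) /=; ring.
  rewrite !binnerE cE -!cintegralJ; try exact: inl2_mul.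
  by congr (_ + _ * _); apply: eq_cintegral => x; rewrite cM.
- move=> u _; rewrite -/(sqnorm _ _) sqnorm_binner addr_ge0//.
    by apply: Rintegral_ge0 => x _; exact: sqmod_ge0.
  apply: mulr_ge0; [exact: ltW|]; apply: Rintegral_ge0 => x _; exact: sqmod_ge0.
Qed.

(** The Weierstrass test, with the tail of the majorant as remainder. *)
Lemma series_uniform_tail (a : nat -> R -> R) (b : R^nat) (U : R) :
  (forall k x, `|a k x| <= b k) -> series b @ \oo --> U ->
  (forall x, series (a ^~ x) @ \oo --> limn (series (a ^~ x))) /\
  forall n x, `|limn (series (a ^~ x)) - \sum_(k < n) a k x| <= U - \sum_(k < n) b k.
Proof.
move=> ab bU; have cv x : series (a ^~ x) @ \oo --> limn (series (a ^~ x)).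
  have [|l hl _] := @cvg_series_dominated R (a ^~ x) b U _ bU => //.
  by apply/cvg_ex; exists l.
split=> // n x.
have h1 := @cvg_series_tail R _ _ n (cv x).
have h2 := @cvg_series_tail R _ _ n bU.
have [|l hl lU] := @cvg_series_dominated R (fun p => a (p + n)%N x) _ _ _ h2 => //.
by rewrite (cvg_unique _ h1 hl).
Qed.

Lemma measurable_limn_series (a : nat -> R -> R) :
  (forall k, measurable_fun D (a k)) ->
  (forall x, series (a ^~ x) @ \oo --> limn (series (a ^~ x))) ->
  measurable_fun D (fun x => limn (series (a ^~ x))).
Proof.
move=> ma ca.
apply: (@measurable_fun_cvg _ _ _ D (fun n x => series (a ^~ x) n)) => //.
  move=> n; under eq_fun do rewrite seriesEnat /=.
  exact: measurable_sum.
Qed.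

(** Uniform convergence on an interval of finite length gives convergence in [L^2]; the factor 2
    counts real and imaginary parts, and [2 * pi] is the length. *)
Lemma inl2_series (g : nat -> R -> R[i]) (b : R^nat) (U : R) :
  (forall k x, `|complex.Re (g k x)| <= b k /\ `|complex.Im (g k x)| <= b k) ->
  (forall k, inl2 (g k)) -> series b @ \oo --> U ->
  exists F : R -> R[i], inl2 F /\
    forall n, \int[mu]_(x in D) sqmod (F x - \sum_(k < n) g k x)
       <= 2 * (U - \sum_(k < n) b k) ^+ 2 * (2 * pi).
Proof.
move=> gb gl bU.
have [c1 t1] := series_uniform_tail (fun k x => (gb k x).1) bU.
have [c2 t2] := series_uniform_tail (fun k x => (gb k x).2) bU.
pose F x : R[i] := limn (series (fun k => complex.Re (g k x)))
  +i* limn (series (fun k => complex.Im (g k x))).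
have mF : circle_measurable F.
  split; apply: measurable_limn_series => // k; first by case: (gl k) => -[].
  by case: (gl k) => _ [].
have ReS n x : complex.Re (\sum_(k < n) g k x) = \sum_(k < n) complex.Re (g k x).
  by elim: n => [|n IH]; rewrite ?big_ord0// !big_ord_recr ReD IH.
have ImS n x : complex.Im (\sum_(k < n) g k x) = \sum_(k < n) complex.Im (g k x).
  by elim: n => [|n IH]; rewrite ?big_ord0// !big_ord_recr ImD IH.
have FU x : `|complex.Re (F x)| <= U /\ `|complex.Im (F x)| <= U.
  have := t1 0%N x; have := t2 0%N x; rewrite !big_ord0 !subr0.
  by split.
have lF : inl2 F.
  by case: mF => ? ?; split; apply: (@rl2_bounded _ _ U) => // x _; case: (FU x).
exists F; split=> // n.
have lS : inl2 (fun x => \sum_(k < n) g k x).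
  elim: n => [|n IH].
    under eq_fun do rewrite big_ord0.
    by split; apply: (@rl2_bounded _ _ 0) => //= x _; rewrite normr0.
  have := inl2_lin 1 IH (gl n).
  rewrite (_ : (fun x => _ + _) = (fun x => \sum_(k < n.+1) g k x))//.
  by apply/funext => x; rewrite big_ord_recr mul1r.
have ld : inl2 (fun x => F x - \sum_(k < n) g k x).
  have := inl2_lin (-1) lS lF.
  rewrite (_ : (fun x => _) = (fun x => F x - \sum_(k < n) g k x))//.
  by apply/funext => x; rewrite mulN1r addrC.
rewrite -rint_cst; apply: le_Rintegral.
- exact: measurable_period.
- exact: inl2_sqmod.
- by apply: (@rintegrable_bounded _ _ `|2 * (U - \sum_(k < n) b k) ^+ 2|).
move=> x _; rewrite /sqmod ReD ReN ImD ImN ReS ImS.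
have sq (y T : R) : `|y| <= T -> y ^+ 2 <= T ^+ 2.
  move=> yT; rewrite -[y ^+ 2]real_normK ?num_real//.
  by rewrite lerXn2r ?nnegrE// (le_trans _ yT).
by have := sq _ _ (t1 n x); have := sq _ _ (t2 n x); rewrite /F /=; lra.
Qed.

End BoundaryL2.

(** * The heat operator built from bounded eigenvectors *)

Section HeatOperator.
Context {R : realType}.
Local Open Scope complex_scope.
Local Notation mu := (@lebesgue_measure R).
Local Notation D := (@period R : set (measurableTypeR R)).
Local Notation bfun := ((R -> R[i]^o) * (R -> R[i]^o))%type.
Implicit Types (rho : R) (Psi Phi : bfun) (u v : R -> R[i]).

Definition cbounded (C : R) u := forall x,
  `|complex.Re (u x)| <= C /\ `|complex.Im (u x)| <= C.

Lemma cboundedZ (c : R[i]) (s C : R) u : `|complex.Re c| <= s -> `|complex.Im c| <= s ->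
  cbounded C u -> cbounded (2 * s * C) (fun x => c * u x).
Proof.
move=> cr ci hu x; have [h1 h2] := hu x.
have s0 : 0 <= s := le_trans (normr_ge0 _) cr.
rewrite ReM ImM; split.
  apply: le_trans (ler_normB _ _) _; rewrite !normrM -mulrA mulr2n mulrDl !mul1r.
  by rewrite lerD// ler_pM.
apply: le_trans (ler_normD _ _) _; rewrite !normrM -mulrA mulr2n mulrDl !mul1r.
by rewrite lerD// ler_pM.
Qed.

Lemma sum_fst n (f : nat -> bfun) x :
  ((\sum_(k < n) f k).1 : R -> R[i]) x = \sum_(k < n) (f k).1 x.
Proof. by elim: n => [|n IH]; rewrite ?big_ord0// !big_ord_recr /= -IH. Qed.

Lemma sum_snd n (f : nat -> bfun) x :
  ((\sum_(k < n) f k).2 : R -> R[i]) x = \sum_(k < n) (f k).2 x.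
Proof. by elim: n => [|n IH]; rewrite ?big_ord0// !big_ord_recr /= -IH. Qed.

(** By Cauchy-Schwarz the coefficients of [Psi] are at most its norm [s]; the vectors are bounded by
    [C] and the weights are summable, so the series for [E Psi] converges uniformly and its
    pointwise sum represents the limit. *)
Lemma diag_operator_exists rho (e : nat -> bfun) (C : R) (w : R^nat) (W : R) :
  0 < rho -> orthonormal (inL2 rho) (binner rho) e ->
  (forall k, cbounded C (e k).1 /\ cbounded C (e k).2) ->
  (forall k, 0 <= w k) -> series w @ \oo --> W ->
  exists E : bfun -> bfun, (forall Psi, inL2 rho Psi -> inL2 rho (E Psi)) /\
    forall Psi, inL2 rho Psi ->
      (fun n => sqnorm (binner rho) (E Psi - diag_sum (binner rho) e w Psi n)) @ \oo
        --> (0 : R).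
Proof.
move=> r0 he hb w0 wW; have H := inL2_pre_hilbert r0.
suff /choice[E hE] : forall Psi : bfun, exists F : bfun, inL2 rho Psi ->
    inL2 rho F /\
    (fun n => sqnorm (binner rho) (F - diag_sum (binner rho) e w Psi n)) @ \oo
        --> (0 : R).
  by exists E; split=> Psi /(hE Psi)[].
(* The value outside [L^2] is arbitrary; [Psi] itself is taken. *)
move=> Psi; have [hP|] := pselect (inL2 rho Psi); last by exists Psi.
have [Pe oe] := he.
pose s := Num.sqrt (sqnorm (binner rho) Psi).
have s0 : 0 <= s by exact: sqrtr_ge0.
have n0 : 0 <= sqnorm (binner rho) Psi by exact: (nrm2_ge0 H).
have cs k : sqmod (binner rho Psi (e k)) <= s ^+ 2.
  rewrite sqr_sqrtr//; have := cauchy_schwarz H hP (Pe k).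
  by rewrite [X in _ * X]/sqnorm oe eqxx /= mulr1.
have le_s (y : R) : y ^+ 2 <= s ^+ 2 -> `|y| <= s.
  by move=> h; rewrite -(@ler_pXn2r _ 2)// ?nnegrE// real_normK ?num_real.
have cr k : `|complex.Re (binner rho Psi (e k))| <= s.
  by apply: le_s; apply: le_trans (cs k); rewrite /sqmod lerDl sqr_ge0.
have ci k : `|complex.Im (binner rho Psi (e k))| <= s.
  by apply: le_s; apply: le_trans (cs k); rewrite /sqmod lerDr sqr_ge0.
pose d k := (w k)%:C * binner rho Psi (e k).
have dr k : `|complex.Re (d k)| <= w k * s.
  by rewrite /d Re_realM normrM ger0_norm ?w0// ler_wpM2l.
have di k : `|complex.Im (d k)| <= w k * s.
  by rewrite /d Im_realM normrM ger0_norm ?w0// ler_wpM2l.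
pose b k := 2 * s * C * w k.
have bU : series b @ \oo --> 2 * s * C * W by exact: cvg_seriesZ.
have bE k : b k = 2 * (w k * s) * C by rewrite /b; ring.
have Pe' k : inl2 (e k).1 /\ inl2 (e k).2 by have /(inL2P _ r0) := Pe k.
have rl0 : inl2 (fun=> 0 : R[i]).
  by split; apply: (@rl2_bounded _ _ 0) => //= x _; rewrite normr0.
have gl1 k : inl2 (fun x => d k * (e k).1 x).
  have := inl2_lin (d k) (Pe' k).1 rl0.
  by under eq_fun do rewrite addr0.
have gl2 k : inl2 (fun x => d k * (e k).2 x).
  have := inl2_lin (d k) (Pe' k).2 rl0.
  by under eq_fun do rewrite addr0.
have [F1 [lF1 hF1]] := @inl2_series R (fun k x => d k * (e k).1 x) b _
  (fun k => eq_rect_r (fun z => cbounded z _)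
     (cboundedZ (dr k) (di k) (hb k).1) (bE k)) gl1 bU.
have [F2 [lF2 hF2]] := @inl2_series R (fun k x => d k * (e k).2 x) b _
  (fun k => eq_rect_r (fun z => cbounded z _)
     (cboundedZ (dr k) (di k) (hb k).2) (bE k)) gl2 bU.
exists (F1, F2) => _; split; first by apply/(inL2P _ r0).
have z : (fun n => (1 + rho) * (2 * (2 * pi)) * (2 * s * C * W - series b n) ^+ 2) @ \oo
    --> (0 : R).
  have z1 : (fun n => 2 * s * C * W - series b n) @ \oo --> (0 : R).
    by rewrite -(subrr (2 * s * C * W)); apply: cvgB => //; exact: cvg_cst.
  have -> : 0 = (1 + rho) * (2 * (2 * pi)) * (0 * 0) :> R by ring.
  by apply: cvgMr; under eq_fun do rewrite expr2; exact: cvgM.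
apply: (squeeze_cvgr _ (cvg_cst 0) z).
apply: nearW => n; apply/andP; split.
  apply: (nrm2_ge0 H); apply: (preB H); first by apply/(inL2P _ r0).
  exact: diag_sum_pre.
rewrite sqnorm_binner.
have sE : series b n = \sum_(k < n) b k by rewrite seriesEord.
have E1 : \int[mu]_(x in D)
    sqmod (((F1, F2) - diag_sum (binner rho) e w Psi n).1 x) <=
    2 * (2 * s * C * W - series b n) ^+ 2 * (2 * pi).
  rewrite sE; apply: le_trans (hF1 n); rewrite le_eqVlt; apply/orP; left; apply/eqP.
  apply: eq_Rintegral => x _; congr sqmod.
  transitivity (F1 x - (diag_sum (binner rho) e w Psi n).1 x) => //.
  congr (_ - _); exact: (@sum_fst n (fun k => d k *: e k) x).
have E2 : \int[mu]_(x in D)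
    sqmod (((F1, F2) - diag_sum (binner rho) e w Psi n).2 x) <=
    2 * (2 * s * C * W - series b n) ^+ 2 * (2 * pi).
  rewrite sE; apply: le_trans (hF2 n); rewrite le_eqVlt; apply/orP; left; apply/eqP.
  apply: eq_Rintegral => x _; congr sqmod.
  transitivity (F2 x - (diag_sum (binner rho) e w Psi n).2 x) => //.
  congr (_ - _); exact: (@sum_snd n (fun k => d k *: e k) x).
apply: le_trans (lerD E1 (ler_wpM2l (ltW r0) E2)) _.
by rewrite le_eqVlt; apply/orP; left; apply/eqP; ring.
Qed.

Lemma hilbert_basisP rho (f : nat -> bfun) : 0 < rho -> hilbert_basis rho f ->
  orthonormal (inL2 rho) (binner rho) f /\ complete (inL2 rho) (binner rho) f.
Proof.
move=> r0 [h1 h2 h3]; have H := inL2_pre_hilbert r0.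
split; first by split.
move=> Psi hP eps eps0; have [n [c hc]] := h3 Psi hP eps eps0.
exists n, c; rewrite -lte_fin -bnorm2E//.
apply: (preB H) => //; apply: (@pre_sum _ _ _ _ H n (fun k => c k *: f k)) => k.
exact: (preZ H).
Qed.

Theorem DtN_heat_trace_basis nu rho t (e : nat -> bfun) (lam : nat -> R) (C W : R) :
  0 < rho -> hilbert_basis rho e ->
  (forall k, DtN_eigen nu rho (lam k) (e k)) ->
  (forall k, cbounded C (e k).1 /\ cbounded C (e k).2) ->
  series (fun k => expR (- t * lam k)) @ \oo --> W ->
  DtN_heat_trace nu rho t W.
Proof.
move=> r0 hb heig hC hW; have H := inL2_pre_hilbert r0.
have [he hc] := hilbert_basisP r0 hb.
have w0 k : 0 <= expR (- t * lam k) by exact: expR_ge0.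
have [E [PE Elim]] := diag_operator_exists r0 he hC w0 hW.
have Pcomb c (u v : bfun) : inL2 rho u -> inL2 rho v -> inL2 rho (c *: u + v).
  by case: H => _ + _ _ _; apply.
have [Pe oe] := he.
exists E; last first.
  move=> f hf; have [ho hcf] := hilbert_basisP r0 hf.
  exact: (diag_trace H he w0 hW PE Elim ho hcf).
split; first split.
- exact: PE.
- move=> c u v hu hv; rewrite /eqL2 bnorm2E//; last first.
    by apply: (preB H); [apply: PE|apply: Pcomb; exact: PE]; exact: Pcomb.
  by rewrite (diag_linear H he PE Elim).
- exists (2 * W ^+ 2) => u hu; rewrite !bnorm2E//; last exact: PE.
  by rewrite -EFinM lee_fin; exact: (nrm2_diag H he w0 hW PE Elim).
exists e, lam; split=> // k; rewrite /eqL2 bnorm2E//; last first.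
  by apply: (preB H); [exact: PE|exact: (preZ H)].
by rewrite (diag_eigen H he PE Elim).
Qed.

End HeatOperator.

(** * Density of trigonometric polynomials *)

Section TrigDensity.
Context {R : realType}.
Local Open Scope complex_scope.
Local Notation mu := (@lebesgue_measure R).
Local Notation D := (@period R : set (measurableTypeR R)).
Local Hint Resolve measurable_period : core.
Implicit Types (u v p q : R -> R[i]) (f g : R -> R) (m : int).

Inductive trigpoly : (R -> R[i]) -> Prop :=
| trigpoly_mode (c : R[i]) m : trigpoly (fun x => c * cis (m%:~R * x))
| trigpoly_add p q : trigpoly p -> trigpoly q -> trigpoly (fun x => p x + q x).

Lemma trigpolyM p q : trigpoly p -> trigpoly q -> trigpoly (fun x => p x * q x).
Proof.
have H (c : R[i]) m r : trigpoly r -> trigpoly (fun x => c * cis (m%:~R * x) * r x).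
  move=> hr; elim: hr => {r} [d n|r s _ IHr _ IHs].
    rewrite (_ : (fun x => _) = (fun x => (c * d) * cis ((m + n)%:~R * x))).
      exact: trigpoly_mode.
    by apply/funext => x; rewrite intrD mulrDl cisD; ring.
  rewrite (_ : (fun x => _) = (fun x => c * cis (m%:~R * x) * r x +
     c * cis (m%:~R * x) * s x)); first exact: trigpoly_add.
  by apply/funext => x; rewrite mulrDr.
move=> hp hq; elim: hp => {p} [c m|p r _ IHp _ IHr]; first exact: H.
rewrite (_ : (fun x => _) = (fun x => p x * q x + r x * q x)).
  exact: trigpoly_add.
by apply/funext => x; rewrite mulrDl.
Qed.

Lemma trigpoly_cst (c : R[i]) : trigpoly (fun=> c).
Proof.
have := trigpoly_mode c 0; rewrite (_ : (fun x => _) = (fun=> c))//.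
by apply/funext => x; rewrite mul0r cis0 mulr1.
Qed.

Lemma trigpoly_lin (c : R[i]) p q : trigpoly p -> trigpoly q ->
  trigpoly (fun x => c * p x + q x).
Proof.
move=> hp hq; apply: trigpoly_add => //; apply: trigpolyM => //; exact: trigpoly_cst.
Qed.

Lemma inl2_cst0 : inl2 (fun=> 0 : R[i]).
Proof. by split; apply: (@rl2_bounded _ _ 0) => //= x _; rewrite normr0. Qed.

Lemma trigpoly_inl2 p : trigpoly p -> inl2 p.
Proof.
elim=> {p} [c m|p q _ hp _ hq].
  have := inl2_lin c (@inl2_cis R m%:~R) inl2_cst0.
  by under eq_fun do rewrite addr0.
by have := inl2_lin 1 hp hq; under eq_fun do rewrite mul1r.
Qed.

Lemma sqmodM (z w : R[i]) : sqmod (z * w) = sqmod z * sqmod w.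
Proof. by rewrite /sqmod ReM ImM; ring. Qed.

Lemma sqmodD_le (z w : R[i]) : sqmod (z + w) <= 2 * sqmod z + 2 * sqmod w.
Proof.
rewrite /sqmod ReD ImD.
have := sqr_ge0 (complex.Re z - complex.Re w).
have := sqr_ge0 (complex.Im z - complex.Im w).
nra.
Qed.

Lemma sqmod_cis (x : R) : sqmod (cis x) = 1.
Proof. by rewrite /sqmod /= cos2Dsin2. Qed.

Definition sbounded u := exists2 M : R, 0 <= M & forall x, sqmod (u x) <= M.

Lemma trigpoly_bounded p : trigpoly p -> sbounded p.
Proof.
elim=> {p} [c m|p q _ [M M0 hp] _ [N N0 hq]].
  exists (sqmod c); first exact: sqmod_ge0.
  by move=> x; rewrite sqmodM sqmod_cis mulr1.
exists (2 * M + 2 * N); first by rewrite addr_ge0// mulr_ge0.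
move=> x; apply: le_trans (sqmodD_le _ _) _.
by rewrite lerD// ler_wpM2l.
Qed.

Definition l2d u := \int[mu]_(x in D) sqmod (u x).

Lemma l2d_ge0 u : 0 <= l2d u.
Proof. by apply: Rintegral_ge0 => x _; exact: sqmod_ge0. Qed.

Lemma l2d_le u (h : R -> R) (c : R) : inl2 u -> rintegrable h ->
  (forall x, D x -> sqmod (u x) <= c * h x) -> l2d u <= c * \int[mu]_(x in D) h x.
Proof.
move=> hu hh le; rewrite -RintegralZl//; apply: le_Rintegral => //.
  exact: inl2_sqmod.
exact: rintegrableZ.
Qed.

Lemma inl2B u v : inl2 u -> inl2 v -> inl2 (fun x => u x - v x).
Proof.
move=> hu hv; have := inl2_lin (-1) hv hu.
rewrite (_ : (fun x => _) = (fun x => u x - v x))//.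
by apply/funext => x; rewrite mulN1r addrC.
Qed.

Lemma l2d_lin (c : R[i]) u v : inl2 u -> inl2 v ->
  l2d (fun x => c * u x + v x) <= 2 * sqmod c * l2d u + 2 * l2d v.
Proof.
move=> hu hv; have iu := inl2_sqmod hu; have iv := inl2_sqmod hv.
rewrite /l2d -rint_lin//; apply: le_Rintegral => //.
- by apply: inl2_sqmod; exact: inl2_lin.
- by apply: rintegrableD; exact: rintegrableZ.
by move=> x _; apply: le_trans (sqmodD_le _ _) _; rewrite sqmodM mulrA.
Qed.

(** The closure of the trigonometric polynomials in [L^2]; the aim is that it is everything. *)
Definition approx u := inl2 u /\ forall eps : R, 0 < eps ->
  exists2 p, trigpoly p & l2d (fun x => u x - p x) < eps.

Lemma approx_trig p : trigpoly p -> approx p.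
Proof.
move=> hp; split; first exact: trigpoly_inl2.
move=> eps e0; exists p => //; rewrite /l2d.
under eq_Rintegral do rewrite subrr /sqmod /= expr0n addr0.
by rewrite rint_cst mul0r.
Qed.

Lemma approx_lin (c : R[i]) u v : approx u -> approx v ->
  approx (fun x => c * u x + v x).
Proof.
move=> [lu hu] [lv hv]; split; first exact: inl2_lin.
move=> eps e0.
have c0 : 0 <= sqmod c := sqmod_ge0 c.
have [p tp hp] := hu (eps / (4 * (sqmod c + 1))) ltac:(by rewrite divr_gt0// mulr_gt0// ltr_wpDl).
have [q tq hq] := hv (eps / 4) ltac:(by rewrite divr_gt0).
exists (fun x => c * p x + q x); first exact: trigpoly_lin.
have lp := trigpoly_inl2 tp; have lq := trigpoly_inl2 tq.
have := l2d_lin c (inl2B lu lp) (inl2B lv lq).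
rewrite (_ : (fun x => c * (u x - p x) + (v x - q x)) =
   (fun x => c * u x + v x - (c * p x + q x))); last first.
  by apply/funext => x; ring.
move=> /le_lt_trans; apply.
have h : 2 * sqmod c * l2d (fun x => u x - p x) <= eps / 2.
  apply: (@le_trans _ _ (2 * sqmod c * (eps / (4 * (sqmod c + 1))))).
    by rewrite ler_wpM2l ?mulr_ge0// ltW.
  have -> : 2 * sqmod c * (eps / (4 * (sqmod c + 1))) =
     eps / 2 * (sqmod c / (sqmod c + 1)) by field; lra.
  rewrite ler_piMr ?divr_ge0 ?(ltW e0)// ler_pdivrMr; last by lra.
  by lra.
lra.
Qed.

Lemma approx_lim u : inl2 u -> (forall eps : R, 0 < eps ->
  exists2 v, approx v & l2d (fun x => u x - v x) < eps) -> approx u.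
Proof.
move=> lu hu; split=> // eps e0.
have [v [lv hv] huv] := hu (eps / 4) ltac:(by rewrite divr_gt0).
have [p tp hp] := hv (eps / 4) ltac:(by rewrite divr_gt0).
exists p => //; have lp := trigpoly_inl2 tp.
have := l2d_lin 1 (inl2B lu lv) (inl2B lv lp).
rewrite (_ : (fun x => 1 * (u x - v x) + (v x - p x)) = (fun x => u x - p x)); last first.
  by apply/funext => x; ring.
rewrite (_ : sqmod 1 = 1); last by rewrite /sqmod /= expr0n expr1n addr0.
move=> /le_lt_trans; apply; lra.
Qed.

Lemma approx_ext u v : (forall x, u x = v x) -> approx u -> approx v.
Proof. by move=> /funext ->. Qed.

Lemma inl2M_bounded u v : inl2 u -> inl2 v -> sbounded v -> inl2 (fun x => u x * v x).
Proof.
move=> hu hv [M M0 hM]; apply: inl2P.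
  have [m1 m2] := inl2_circle_measurable hu; have [n1 n2] := inl2_circle_measurable hv.
  split.
    under eq_fun do rewrite ReM.
    by apply: measurable_funB; exact: measurable_funM.
  under eq_fun do rewrite ImM.
  by apply: measurable_funD; exact: measurable_funM.
have i1 := rintegrableZ M (inl2_sqmod hu).
apply: (@le_lt_trans _ _ (\int[mu]_(x in D) (M * sqmod (u x))%:E)%E); last first.
  by rewrite rint_EFin// ltry.
apply: ge0_le_integral => //.
- by move=> x _; rewrite lee_fin sqmod_ge0.
- apply/measurable_EFinP; under eq_fun do rewrite sqmodM.
  apply: measurable_funM; apply: measurable_sqmod; exact: inl2_circle_measurable.
- by apply/measurable_EFinP; exact: rintegrable_measurable.
by move=> x _; rewrite lee_fin sqmodM mulrC ler_wpM2r// sqmod_ge0.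
Qed.

Lemma approxM_trig u p : approx u -> trigpoly p -> approx (fun x => u x * p x).
Proof.
move=> [lu hu] tp; have lp := trigpoly_inl2 tp; have bp := trigpoly_bounded tp.
have [M M0 hM] := bp.
split; first exact: inl2M_bounded.
move=> eps e0.
have M1 : 0 < M + 1 by lra.
have [q tq hq] := hu (eps / (M + 1)) ltac:(by rewrite divr_gt0).
have lq := trigpoly_inl2 tq.
exists (fun x => q x * p x); first exact: trigpolyM.
apply: (@le_lt_trans _ _ ((M + 1) * l2d (fun x => u x - q x))); last first.
  by rewrite -ltr_pdivlMl// mulrC.
rewrite (_ : (fun x => _) = (fun x => (u x - q x) * p x)); last first.
  by apply/funext => x; ring.
apply: l2d_le.
- by apply: inl2M_bounded => //; exact: inl2B.
- by apply: inl2_sqmod; exact: inl2B.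
move=> x _; rewrite sqmodM mulrC ler_wpM2r ?sqmod_ge0//.
by apply: le_trans (hM x) _; lra.
Qed.

(** Replacing [u] by a trigonometric polynomial [p] costs at most the bound of [v] times the error;
    since [p] is bounded too, [v * p] falls under [approxM_trig]. *)
Lemma approxM u v : approx u -> approx v -> sbounded v ->
  approx (fun x => u x * v x).
Proof.
move=> [lu hu] av bv; have [lv hv] := av; have [M M0 hM] := bv.
apply: approx_lim; first exact: inl2M_bounded.
move=> eps e0; have M1 : 0 < M + 1 by lra.
have [p tp hp] := hu (eps / (M + 1)) ltac:(by rewrite divr_gt0).
have lp := trigpoly_inl2 tp.
exists (fun x => v x * p x); first exact: approxM_trig.
apply: (@le_lt_trans _ _ ((M + 1) * l2d (fun x => u x - p x))); last first.
  by rewrite -ltr_pdivlMl// mulrC.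
rewrite (_ : (fun x => _) = (fun x => (u x - p x) * v x)); last first.
  by apply/funext => x; ring.
apply: l2d_le.
- by apply: inl2M_bounded => //; exact: inl2B.
- by apply: inl2_sqmod; exact: inl2B.
move=> x _; rewrite sqmodM mulrC ler_wpM2r ?sqmod_ge0//.
by apply: le_trans (hM x) _; lra.
Qed.

Lemma approx_dominated (un : nat -> R -> R[i]) u (h : R -> R) : inl2 u ->
  (forall n, approx (un n)) -> rintegrable h ->
  (forall n x, D x -> sqmod (u x - un n x) <= h x) ->
  (forall x, D x -> (fun n => sqmod (u x - un n x)) @ \oo --> (0 : R)) ->
  approx u.
Proof.
move=> lu au ih le cv; apply: approx_lim => // eps e0.
have mn n : measurable_fun D (fun x => sqmod (u x - un n x)).
  by apply: measurable_sqmod; apply: inl2_circle_measurable; apply: inl2B => //; case: (au n).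
have [] := @dominated_convergence _ _ R mu D measurable_period
  (fun n x => (sqmod (u x - un n x))%:E) (fun=> 0%:E) (EFin \o h).
- by move=> n; apply/measurable_EFinP.
- by apply/measurable_EFinP.
- by apply: aeW => x Dx; apply: cvg_EFin; [exact: nearW|exact: cv].
- exact: ih.
- apply: aeW => x n Dx /=; rewrite lee_fin ger0_norm ?sqmod_ge0//; exact: le.
move=> _ _ H.
have z0 : (\int[mu]_(x in D) (0%:E : \bar R) = 0)%E by apply: integral0_eq.
have {}H : (fun n => (l2d (fun x => u x - un n x))%:E) @ \oo --> 0%E.
  move: H; rewrite z0; apply: cvg_trans; apply: near_eq_cvg; apply: nearW => n.
  by rewrite /l2d -rint_EFin//; apply: inl2_sqmod; apply: inl2B => //; case: (au n).
have {}H : (fun n => l2d (fun x => u x - un n x)) @ \oo --> (0 : R).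
  by move/fine_cvgP : H => [].
move/cvgrPdist_lt : H => /(_ _ e0) /filter_ex[n].
rewrite sub0r normrN ger0_norm ?l2d_ge0// => hn.
by exists (un n).
Qed.

End TrigDensity.

(** * Indicators of rays as limits of trigonometric polynomials *)

Section TrigDensityReal.
Context {R : realType}.
Local Open Scope complex_scope.
Local Notation mu := (@lebesgue_measure R).
Local Notation D := (@period R : set (measurableTypeR R)).
Local Hint Resolve measurable_period : core.
Implicit Types (f g : R -> R).

Definition rapprox f := approx (fun x => (f x)%:C).

Lemma sqmod_real (x : R) : sqmod (x%:C) = x ^+ 2.
Proof. by rewrite /sqmod /= [0 ^+ 2]expr0n addr0. Qed.

Lemma rapprox_cst (c : R) : rapprox (fun=> c).
Proof. by apply: approx_trig; exact: trigpoly_cst. Qed.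

Lemma rapprox_ext f g : (forall x, f x = g x) -> rapprox f -> rapprox g.
Proof. by move=> /funext ->. Qed.

Lemma rapprox_lin (c : R) f g : rapprox f -> rapprox g ->
  rapprox (fun x => c * f x + g x).
Proof.
move=> hf hg; apply: approx_ext (approx_lin c%:C hf hg) => x.
by rewrite rmorphD rmorphM.
Qed.

Definition unit_valued f := forall x, 0 <= f x <= 1.

Lemma rapproxM f g : rapprox f -> rapprox g -> unit_valued g ->
  rapprox (fun x => f x * g x).
Proof.
move=> hf hg ug; apply: approx_ext (approxM hf hg _) => [x|].
  by rewrite rmorphM.
exists 1 => // x; rewrite sqmod_real; have /andP[g0 g1] := ug x.
by rewrite expr_le1.
Qed.

Lemma rapproxX f n : rapprox f -> unit_valued f ->
  rapprox (fun x => f x ^+ n) /\ unit_valued (fun x => f x ^+ n).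
Proof.
move=> hf uf; have uX k : unit_valued (fun x => f x ^+ k).
  by move=> x; have /andP[f0 f1] := uf x; rewrite exprn_ge0// exprn_ile1.
split=> //; elim: n => [|n IH]; first exact: rapprox_cst.
by apply: rapprox_ext (rapproxM hf IH (uX n)) => x; rewrite exprS.
Qed.

Lemma rapprox1B f : rapprox f -> unit_valued f ->
  rapprox (fun x => 1 - f x) /\ unit_valued (fun x => 1 - f x).
Proof.
move=> hf uf; split; last by move=> x; have /andP[? ?] := uf x; apply/andP; split; lra.
by apply: rapprox_ext (rapprox_lin (-1) hf (rapprox_cst 1)) => x; ring.
Qed.

Lemma rapprox_inl2 f : rapprox f -> rl2 f.
Proof. by move=> [[h _] _]. Qed.

Lemma rl2_inl2 f : rl2 f -> inl2 (fun x => (f x)%:C).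
Proof. by move=> h; split => //=; apply: (@rl2_bounded _ _ 0) => // x _; rewrite normr0. Qed.

Lemma rapprox_dominated (fn : nat -> R -> R) f (h : R -> R) : rl2 f ->
  (forall n, rapprox (fn n)) -> rintegrable h ->
  (forall n x, D x -> (f x - fn n x) ^+ 2 <= h x) ->
  (forall x, D x -> fn ^~ x @ \oo --> f x) -> rapprox f.
Proof.
move=> lf af ih le cv; apply: (@approx_dominated _ (fun n x => (fn n x)%:C) _ h) => //.
- exact: rl2_inl2.
- by move=> n x Dx; rewrite -rmorphB sqmod_real; exact: le.
move=> x Dx; under eq_fun do rewrite -rmorphB sqmod_real expr2.
have z : (fun n => f x - fn n x) @ \oo --> (0 : R).
  by rewrite -(subrr (f x)); apply: cvgB; [exact: cvg_cst|exact: cv].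
by rewrite -(mulr0 (0 : R)); exact: cvgM.
Qed.

Lemma bernoulli_1B (y : R) N : 0 <= y <= 1 -> 1 - N%:R * y <= (1 - y) ^+ N.
Proof.
move=> /andP[y0 y1]; elim: N => [|N IH]; first by rewrite expr0 mul0r subr0.
rewrite exprS -natr1.
have : (1 - y) * (1 - N%:R * y) <= (1 - y) * (1 - y) ^+ N.
  by rewrite ler_wpM2l// subr_ge0.
have : 0 <= N%:R * y * y :> R by rewrite !mulr_ge0.
move: ((1 - y) * (1 - y) ^+ N) (N%:R : R) => A n; lra.
Qed.

(** With [w = sqrt z], [n w^n] is at most the geometric sum, hence at most [1 / (1 - w)], and the
    other factor [w^n] tends to 0. *)
Lemma cvg_natM_expr (z : R) : 0 <= z < 1 -> (fun n => n%:R * z ^+ n) @ \oo --> (0 : R).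
Proof.
move=> /andP[z0 z1]; pose w := Num.sqrt z.
have w0 : 0 <= w by exact: sqrtr_ge0.
have w2 : w ^+ 2 = z by rewrite sqr_sqrtr.
have w1 : w < 1 by rewrite -(@ltr_pXn2r _ 2)// ?nnegrE// w2 expr1n.
have le n : n%:R * w ^+ n <= (1 - w)^-1.
  have h : \sum_(k < n) w ^+ k <= (1 - w)^-1.
    have e : (1 - w) * \sum_(k < n) w ^+ k = 1 - w ^+ n by rewrite -opprB mulNr -subrX1 opprB.
    rewrite -(@ler_pM2l _ (1 - w)); last by lra.
    rewrite e divff; last by lra.
    by have := exprn_ge0 n w0; lra.
  apply: le_trans h; rewrite -[n in n%:R]card_ord mulr_natl -sumr_const.
  by apply: ler_sum => k _; exact: (ler_wiXn2l w0 (ltW w1) (ltnW (ltn_ord k))).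
have c1 : (fun n => (1 - w)^-1 * w ^+ n) @ \oo --> (0 : R).
  by apply: (@cvg_geometric R); rewrite ger0_norm.
apply: (squeeze_cvgr _ (cvg_cst 0) c1); apply: nearW => n.
rewrite mulr_ge0 ?exprn_ge0//= -w2 -exprM mulnC exprM expr2 mulrA.
by rewrite ler_wpM2r ?exprn_ge0.
Qed.

(* Brosowski-Deutsch polynomials: Bernoulli's inequality gives the limit for
   [y < 1/2], and [1 - x <= exp (- x)] gives it for [y >= 1/2]. *)
Lemma step_limit (y : R) : 0 <= y <= 1 ->
  (fun n => (1 - y ^+ n) ^+ (n * 2 ^ n)) @ \oo --> ((y < 2^-1)%R%:R : R).
Proof.
move=> /andP[y0 y1].
have yn n : 0 <= y ^+ n <= 1 by rewrite exprn_ge0// exprn_ile1.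
have Ne n : (n * 2 ^ n)%:R * y ^+ n = n%:R * (2 * y) ^+ n :> R.
  by rewrite natrM natrX exprMn mulrA.
case: ltP => hy.
  have c : (fun n => 1 - n%:R * (2 * y) ^+ n) @ \oo --> (1 - 0 : R).
    apply: cvgB; first exact: cvg_cst.
    by apply: cvg_natM_expr; apply/andP; split; lra.
  rewrite subr0 in c; rewrite (_ : true%:R = 1 :> R)//.
  apply: (squeeze_cvgr _ c (cvg_cst (1 : R))); apply: nearW => n.
  rewrite -Ne bernoulli_1B//=; have /andP[h0 h1] := yn n.
  by rewrite exprn_ile1// ?subr_ge0// gerBl.
have c := @cvgn_expR R.
rewrite (_ : false%:R = 0 :> R)//.
apply: (squeeze_cvgr _ (cvg_cst (0 : R)) c); apply: nearW => n; have /andP[h0 h1] := yn n.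
rewrite exprn_ge0 ?subr_ge0//=.
apply: (@le_trans _ _ (expR (- y ^+ n) ^+ (n * 2 ^ n))).
  by rewrite lerXn2r ?nnegrE ?subr_ge0 ?expR_ge0//; have := expR_ge1Dx (- y ^+ n).
rewrite -expRM_natl ler_expR mulrN lerN2 Ne ler_peMr//.
by apply: exprn_ege1; lra.
Qed.

Lemma rl2_indic (A : set (measurableTypeR R)) : measurable A -> rl2 (\1_A : R -> R).
Proof.
move=> mA; apply: (@rl2_bounded _ _ 1); first exact: measurable_indic.
by move=> x _; rewrite indicE normr_nat lern1 leq_b1.
Qed.

(** The polynomials of [step_limit] in [g] keep values in [[0, 1]] and converge pointwise to the
    indicator of [g < 1 / 2], so dominated convergence applies. *)
Lemma rapprox_step g : rapprox g -> unit_valued g ->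
  measurable_fun D g -> rapprox (fun x => (g x < 2^-1)%R%:R).
Proof.
move=> hg ug mg.
have a n : rapprox (fun x => (1 - g x ^+ n) ^+ (n * 2 ^ n)) /\
    unit_valued (fun x => (1 - g x ^+ n) ^+ (n * 2 ^ n)).
  have [h1 h2] := rapproxX n hg ug.
  have [h3 h4] := rapprox1B h1 h2.
  exact: rapproxX.
have cv x : (fun n => (1 - g x ^+ n) ^+ (n * 2 ^ n)) @ \oo --> ((g x < 2^-1)%R%:R : R).
  exact: step_limit.
apply: (@rapprox_dominated (fun n x => (1 - g x ^+ n) ^+ (n * 2 ^ n)) _ (fun=> 1)).
- apply: (@rl2_bounded _ _ 1).
    apply: (@measurable_fun_cvg _ _ _ D (fun n x => (1 - g x ^+ n) ^+ (n * 2 ^ n))).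
      by move=> n; case: (a n) => /rapprox_inl2[].
    by move=> x _; exact: cv.
  by move=> x _; rewrite normr_nat lern1 leq_b1.
- by move=> n; case: (a n).
- by apply: (@rintegrable_bounded _ _ 1) => // x _; rewrite normr1.
- move=> n x _; have [_ /(_ x)/andP[h0 h1]] := a n.
  rewrite -[X in X <= _]real_normK ?num_real// expr_le1// ler_norml.
  by case: (g x < 2^-1); rewrite /=; apply/andP; split; lra.
by move=> x _; exact: cv.
Qed.

(** Trigonometric polynomials agree at 0 and [2 pi]; dropping the null point 0 makes room for
    functions, such as indicators of rays, that do not. *)
Lemma approx_ae (u v : R -> R[i]) : inl2 u -> approx v ->
  (forall x, 0 < x <= 2 * pi -> u x = v x) -> approx u.
Proof.
move=> lu av uv; apply: approx_lim => // eps e0; exists v => //.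
have lv : inl2 v by case: av.
have i1 := inl2_sqmod (inl2B lu lv).
rewrite /l2d /period -Rintegral_itv_obnd_cbnd; last first.
  apply: (integrableS _ _ _ i1) => //.
  by move=> x; rewrite /period /= !in_itv /= => /andP[/ltW -> ->].
apply: le_lt_trans e0.
have z : \int[mu]_(x in `]0, 2 * pi]) (0 : R) = 0 by rewrite Rintegral_cst// mul0r.
rewrite -[X in _ <= X]z; clear z.
rewrite le_eqVlt; apply/orP; left; apply/eqP; apply: eq_Rintegral => x; rewrite inE /= in_itv /= => hx.
by rewrite uv// subrr /sqmod /= expr0n addr0.
Qed.

Lemma cos_trigpoly (b : R) : trigpoly (fun x => (cos (x - b))%:C).
Proof.
have := trigpoly_add (trigpoly_mode (cis (- b) / 2) 1) (trigpoly_mode (cis b / 2) (-1)).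
rewrite (_ : (fun x => _ + _) = (fun x => (cos (x - b))%:C))//.
apply/funext => x; rewrite mulr1z mul1r mulrN1z mulN1r.
have -> : cis (- b) / 2 * cis x + cis b / 2 * cis (- x) =
   (cis (x - b) + cis (- (x - b))) / 2 :> R[i].
  by rewrite opprB !cisD; field.
rewrite /cis cosN sinN; apply: complex_ext; rewrite !(ReM, ImM, ReD, ImD, ReV, ImV) /=; by field.
Qed.

(* For [0 < c <= 2 pi] and [0 < x <= 2 pi], one has [x < c] if and only if
   [cos (x - c / 2) > cos (c / 2)]. *)
Lemma rapprox_ray (c : R) : rapprox (\1_(`]-oo, c[%classic : set (measurableTypeR R)) : R -> R).
Proof.
have li : inl2 (fun x => ((\1_(`]-oo, c[%classic : set R) : R -> R) x)%:C : R[i]).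
  by apply: rl2_inl2; apply: rl2_indic; exact: measurable_itv.
have iE x : (\1_(`]-oo, c[%classic : set R) : R -> R) x = (x < c)%R%:R.
  rewrite indicE; case: ltP => h; first by rewrite mem_set//= in_itv.
  by rewrite memNset//= in_itv /= ltNge h.
have [c0|c0] := leP c 0.
  apply: approx_ae li (rapprox_cst 0) _ => x /andP[x0 _].
  by rewrite iE ltNge (le_trans c0 (ltW x0)).
have [c2|c2] := ltP (2 * pi) c.
  apply: approx_ae li (rapprox_cst 1) _ => x /andP[_ x2].
  by rewrite iE (le_lt_trans x2 c2).
(* Scaled into [[0, 1]] so that [g x < 1 / 2] reads [cos (c / 2) < cos (x - c / 2)]. *)
pose g (x : R) : R := (2 + cos (c / 2) - cos (x - c / 2)) / 4.
have hg : rapprox g.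
  have h := rapprox_lin (- 4^-1) (approx_trig (cos_trigpoly (c / 2)))
    (rapprox_cst ((2 + cos (c / 2)) / 4)).
  by apply: rapprox_ext h => x; rewrite /g; ring.
have ug : unit_valued g.
  move=> x; rewrite /g; have := cos_le1 (c / 2); have := cos_geN1 (c / 2).
  have := cos_le1 (x - c / 2); have := cos_geN1 (x - c / 2).
  by move=> ? ? ? ?; apply/andP; split; lra.
have mg : measurable_fun D g by case: (rapprox_inl2 hg).
apply: approx_ae li (rapprox_step hg ug mg) _ => x /andP[x0 x2].
rewrite iE; congr (_%:R)%:C; congr nat_of_bool.
rewrite /g; have pi0 := @pi_gt0 R.
have dec (s t : R) : 0 <= s -> s <= t -> t <= pi -> cos t <= cos s.
  move=> s0 st tp; rewrite leNgt; apply/negP => h.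
  have s1 : s \in `[0, pi] by rewrite in_itv /= s0 (le_trans st tp).
  have t1 : t \in `[0, pi] by rewrite in_itv /= tp (le_trans s0 st).
  by move: h; rewrite ltr_cos// ltNge st.
have sdec (s t : R) : 0 <= s -> s < t -> t <= pi -> cos t < cos s.
  move=> s0 st tp.
  have s1 : s \in `[0, pi] by rewrite in_itv /= s0 (le_trans (ltW st) tp).
  have t1 : t \in `[0, pi] by rewrite in_itv /= tp (le_trans s0 (ltW st)).
  by rewrite ltr_cos.
have [xc|cx] := ltP x c.
  have h : cos (c / 2) < cos (x - c / 2).
    have [p|n] := leP 0 (x - c / 2); first by apply: sdec; lra.
    by rewrite -(cosN (x - c / 2)); apply: sdec; lra.
  by apply/esym; rewrite -/(is_true _); lra.
have h : cos (x - c / 2) <= cos (c / 2).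
  have [p|n] := leP (x - c / 2) pi; first by apply: dec; lra.
  (* Past [pi], the reflection brings the argument back to [[c / 2, pi]], where [cos] decreases. *)
  have -> : cos (x - c / 2) = cos (2 * pi - (x - c / 2)).
    by rewrite [RHS]cosB mulr_natl cos2pi sin2pi mul1r mul0r addr0.
  by apply: dec; lra.
by apply/esym/negbTE; rewrite -leNgt; lra.
Qed.

End TrigDensityReal.

(** * From indicators to all of [L^2] *)

Section TrigDensityL2.
Context {R : realType}.
Local Open Scope complex_scope.
Local Notation mu := (@lebesgue_measure R).
Local Notation D := (@period R : set (measurableTypeR R)).
Local Hint Resolve measurable_period : core.
Implicit Types (f g : R -> R).

Lemma rapprox_sum n (g : nat -> R -> R) : (forall k, rapprox (g k)) ->
  rapprox (fun x => \sum_(k < n) g k x).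
Proof.
move=> hg; elim: n => [|n IH].
  by apply: rapprox_ext (rapprox_cst 0) => x; rewrite big_ord0.
by apply: rapprox_ext (rapprox_lin 1 IH (hg n)) => x; rewrite big_ord_recr mul1r.
Qed.

(** The boolean [v n] records that the partial sums take only the values 0 and 1, which supplies a
    constant majorant; its eventual value gives the pointwise limit. *)
Lemma indic_partition_sum (T : Type) (F : (set T)^nat) (x : T) : trivIset [set: nat] F ->
  exists v : nat -> bool, (forall n, \sum_(k < n) (\1_(F k) x : R) = (v n)%:R) /\
    \forall n \near \oo, v n = (x \in \bigcup_k F k).
Proof.
move=> tF; have [[k0 _ Fx]|nF] := pselect ((\bigcup_k F k) x); last first.
  exists (fun=> false); split; last by apply: nearW => n; rewrite memNset.
  move=> n; rewrite big1// => k _; rewrite indicE memNset// => Fk.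
  by apply: nF; exists k.
exists (fun n => k0 < n)%N; split; last first.
  by exists k0.+1 => // n /= hn; rewrite hn mem_set//; exists k0.
have ind k : \1_(F k) x = (k == k0)%:R :> R.
  rewrite indicE; case: eqP => [->|nk]; first by rewrite mem_set.
  by rewrite memNset// => Fk; apply: nk; apply: (tF k k0) => //; exists x.
elim=> [|n IH]; first by rewrite big_ord0.
rewrite big_ord_recr IH ind /= -natrD; congr (_%:R).
by rewrite eq_sym ltnS; case: ltngtP.
Qed.

(** Dynkin's argument: open rays to the left are stable under intersection and generate the Borel
    sets, while approximable sets are stable under complements and countable disjoint unions. *)
Lemma rapprox_indic (A : set (measurableTypeR R)) : measurable A ->
  rapprox (\1_A : R -> R).
Proof.
move=> mA; pose P := fun S : set (measurableTypeR R) => rapprox (\1_S : R -> R).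
apply: (@dynkin_induction _ (measurableTypeR R) (@RGenInftyO.G R) P).
- exact: RGenInftyO.measurableE.
- move=> _ _ [x ->] [y ->]; exists (Num.min x y).
  by apply/seteqP; split=> z /=; rewrite !in_itv /= lt_min => /andP.
- by apply: rapprox_ext (rapprox_cst 1) => x; rewrite indicT.
- by move=> _ [x ->]; exact: rapprox_ray.
- move=> S _ hS; apply: rapprox_ext (rapprox_lin (-1) hS (rapprox_cst 1)) => x.
  by rewrite !indicE in_setC; case: (x \in S); rewrite ?mulr1 ?mulr0 ?addNr ?add0r.
- move=> F mF tF hF; have mU : measurable (\bigcup_k F k) by exact: bigcup_measurable.
  have bd (b c : bool) : (b%:R - c%:R) ^+ 2 <= (1 : R).
    by case: b c => -[]; rewrite ?subrr ?subr0 ?sub0r ?sqrrN ?expr0n ?expr1n.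
  apply: (@rapprox_dominated _ (fun n x => \sum_(k < n) \1_(F k) x) _ (fun=> 1)).
  + exact: rl2_indic.
  + by move=> n; apply: (@rapprox_sum n (fun k => \1_(F k) : R -> R)) => k; exact: hF.
  + by apply: (@rintegrable_bounded _ _ 1) => // x _; rewrite normr1.
  + move=> n x _; have [v [hv _]] := indic_partition_sum x tF.
    by rewrite hv indicE.
  move=> x _; have [v [hv nv]] := indic_partition_sum x tF.
  apply: (@cvg_trans _ ((fun=> \1_(\bigcup_k F k) x) @ \oo)); last exact: cvg_cst.
  by apply: near_eq_cvg; apply: filterS nv => n nv; rewrite hv nv indicE.
- by move: mA; rewrite [measurable]RGenInftyO.measurableE.
Qed.

Import HBNNSimple.

Lemma rapprox_nnsfun (g : {nnsfun (measurableTypeR R) >-> R}) : rapprox (g : R -> R).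
Proof.
apply: rapprox_ext (fun x => esym (fimfunEord g x)) _.
move: (finmap.enum_fset (fset_set (range g))) => s.
apply: (@rapprox_sum _ (fun i x => s`_i * \1_(g @^-1` [set s`_i]) x)) => k.
have h : rapprox (\1_(g @^-1` [set s`_k]) : R -> R) by exact: rapprox_indic.
by apply: rapprox_ext (rapprox_lin s`_k h (rapprox_cst 0)) => x; rewrite addr0.
Qed.

Lemma rapprox_ge0 f : rl2 f -> (forall x, 0 <= f x) -> rapprox f.
Proof.
move=> lf f0; have [mf i2] := lf.
have mF : measurable_fun D (EFin \o f) by apply/measurable_EFinP.
have F0 x : D x -> (0 <= (EFin \o f) x)%E by move=> _; rewrite lee_fin.
pose g := nnsfun_approx measurable_period mF.
have g0 n x : 0 <= g n x by [].
have gf n x : D x -> g n x <= f x.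
  move=> Dx; have := le_approx n F0 Dx.
  by rewrite -nnsfun_approxE lee_fin.
apply: (@rapprox_dominated _ (fun n x => g n x) _ (fun x => f x ^+ 2)) => //.
- by move=> n; exact: rapprox_nnsfun.
- move=> n x Dx; have := g0 n x; have := gf n x Dx.
  by move=> h1 h2; rewrite lerXn2r ?nnegrE//; lra.
move=> x Dx; have := cvg_nnsfun_approx measurable_period mF F0 Dx.
by move=> /fine_cvgP[].
Qed.

Theorem inl2_approx (u : R -> R[i]) : inl2 u -> approx u.
Proof.
(* [f] is the difference of [|f| + f] and [|f|], both nonnegative and square integrable. *)
have H f : rl2 f -> rapprox f.
  move=> lf; have [mf i2] := lf.
  have part (h : R -> R) : measurable_fun D h -> (forall x, `|h x| <= `|f x|) -> rl2 h.
    move=> mh le; split=> //; apply: rintegrable_le i2 _.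
      by under eq_fun do rewrite expr2; exact: measurable_funM.
    move=> x _; rewrite ger0_norm ?sqr_ge0//.
    by rewrite -[h x ^+ 2]real_normK ?num_real// -[f x ^+ 2]real_normK ?num_real// lerXn2r ?nnegrE.
  have mn : measurable_fun D (fun x => `|f x|).
    by apply: measurableT_comp => //; exact: measurable_normr.
  have rn : rapprox (fun x => `|f x|).
    by apply: rapprox_ge0 => //; apply: part => // x; rewrite normr_id.
  have rp : rapprox (fun x => `|f x| + f x).
    apply: rapprox_ge0 => [|x]; last by rewrite -lerBlDr sub0r ler_normr lexx orbT.
    by apply: rl2D => //; apply: part => // x; rewrite normr_id.
  by apply: rapprox_ext (rapprox_lin (-1) rn rp) => x; ring.
move=> [/H h1 /H h2]; apply: approx_ext (approx_lin 'i%C h2 h1) => x.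
by apply: complex_ext; rewrite !(ReD, ImD, ReM, ImM) /=; ring.
Qed.

End TrigDensityL2.

(** * Basis of eigenvectors *)

Section ModeEigen.
Context {R : realType}.
Local Open Scope complex_scope.
Local Notation bfun := ((R -> R[i]^o) * (R -> R[i]^o))%type.
Implicit Types (nu rho a alpha beta : R) (m : int).

Definition delta_coef m (c : R[i]) (n : int) : R[i] := if n == m then c else 0.

Lemma sobolev_delta (s : R) m (c : R[i]) :
  sobolev_sqnorm s (delta_coef m c) = ((1 + m%:~R ^+ 2) `^ s * sqmod c)%:E.
Proof.
rewrite /sobolev_sqnorm.
rewrite -(@esum_set1 R int m (fun n => ((1 + n%:~R ^+ 2) `^ s * sqmod c)%:E)).
  rewrite [RHS]esum_mkcond; apply: eq_esum => n _; rewrite /delta_coef.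
  case: eqP => [->|/eqP nm]; first by rewrite mem_set.
  rewrite memNset; first by rewrite /sqmod /= expr0n addr0 mulr0.
  by move=> /= h; rewrite h eqxx in nm.
by rewrite lee_fin mulr_ge0 ?powR_ge0 ?sqmod_ge0.
Qed.

(** At a single frequency the squared Sobolev norm of any order is a fixed multiple of the squared
    modulus, so convergence is that of one real number. *)
Lemma sobolev_delta_cvg (s : R) m (F : set_system R) {FF : Filter F}
    (c : R -> int -> R[i]) (h : R -> R) (l : R) :
  (\forall r \near F, c r = delta_coef m (h r - l)%:C) -> h @ F --> l ->
  sobolev_sqnorm s (c r) @[r --> F] --> 0%E.
Proof.
move=> hc hl.
apply: (@cvg_trans _ ((fun r => ((1 + m%:~R ^+ 2) `^ s * (h r - l) ^+ 2)%:E) @ F)).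
  apply: near_eq_cvg; apply: filterS hc => r ->.
  by rewrite sobolev_delta /sqmod /= expr0n addr0.
apply: cvg_EFin.
  exact: nearW.
have -> : 0 = (1 + m%:~R ^+ 2) `^ s * (0 * 0) :> R by rewrite !mulr0.
apply: cvgMr; under eq_fun do rewrite expr2.
have z : (fun r => h r - l) @ F --> (0 : R).
  by rewrite -(subrr l); apply: cvgB => //; exact: cvg_cst.
exact: cvgM.
Qed.

Definition mode_vec m alpha beta : bfun :=
  (fun x => alpha%:C * cis (m%:~R * x), fun x => beta%:C * cis (m%:~R * x)).

Lemma inl2_mode (c : R[i]) m : inl2 (fun x => c * cis (m%:~R * x)).
Proof.
have rl0 : inl2 (fun=> 0 : R[i]).
  by split; apply: (@rl2_bounded _ _ 0) => //= x _; rewrite normr0.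
have := inl2_lin c (@inl2_cis R m%:~R) rl0.
by under eq_fun do rewrite addr0.
Qed.

Lemma inL2_mode_vec rho m alpha beta : 0 < rho -> inL2 rho (mode_vec m alpha beta).
Proof. by move=> r0; apply/inL2P => //; split; exact: inl2_mode. Qed.

Lemma fourier_mode_vec (c : R[i]) m :
  fourier (fun x => c * cis (m%:~R * x)) = delta_coef m c.
Proof. by apply/funext => n; rewrite fourier_mode. Qed.

Lemma derivative_along_ray (f g : R -> R) (v : R * R -> R[i]) m (r x : R) : 0 < r ->
  (forall s y : R, 0 < s -> v (polar s y) = (f s)%:C * cis (m%:~R * y)) ->
  is_derive r (1 : R) f (g r) ->
  dr v r x = (g r)%:C * cis (m%:~R * x).
Proof.
move=> r0 hv hf.
have nr : \forall s \near r, 0 < s.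
  by apply: open_nbhs_nbhs; split; [exact: open_gt|].
have h (k c : R) (F : R -> R) : (forall s, 0 < s -> F s = f s * c) ->
   derive1 F r = g r * c.
  move=> FE; rewrite derive1E.
  have /@derive_val <- // : is_derive r (1 : R) F (g r * c).
  apply: (@is_derive_near _ (fun s => f s * c)).
    by apply: filterS nr => s s0; rewrite FE.
  by apply: is_derive_eq; rewrite /GRing.scale /=; ring.
rewrite /dr; apply: complex_ext; rewrite [LHS]/=.
  by rewrite Re_realM; apply: (h 0) => s s0; rewrite hv// Re_realM.
by rewrite Im_realM; apply: (h 0) => s s0; rewrite hv// Im_realM.
Qed.

(** The solution has the single frequency [m] on every circle, so the four Sobolev limits reduce to
    continuity of [f] and [g] at 1 and [rho]. *)
Theorem DtN_eigen_mode nu rho a m alpha beta lam : 0 <= nu < 1 -> 0 < a ->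
  rho = expR (- a) ->
  modeA a (m%:~R - nu) * alpha - modeB a (m%:~R - nu) * beta = lam * alpha ->
  (modeA a (m%:~R - nu) * beta - modeB a (m%:~R - nu) * alpha) / rho = lam * beta ->
  DtN_eigen nu rho lam (mode_vec m alpha beta).
Proof.
move=> hnu a0 rE h1 h2.
have r0 : 0 < rho by rewrite rE expR_gt0.
have r1 : rho < 1 by rewrite rE expR_lt1 oppr_lt0.
have [v [f [g [Cv Hv hv [df cg] [f1 fr g1 gr]]]]] :=
  mode_solution m alpha beta hnu a0 rE.
have cf r : 0 < r -> {for r, continuous f}.
  move=> rp; apply: differentiable_continuous; apply/derivable1_diffP.
  by case: (df r rp).
have near1 : \forall r \near (1 : R)^'-, 0 < r by exact: nbhs_left_gt.
have nearr : \forall r \near rho^'+, 0 < r.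
  by near=> r; apply: lt_trans r0 _; near: r; exact: nbhs_right_gt.
have F r : 0 < r -> fourier (v \o polar r) = delta_coef m (f r)%:C.
  by move=> rp; rewrite -fourier_mode_vec; congr fourier; apply/funext => x /=; exact: hv.
have dF r : 0 < r -> dr v r = (fun x => (g r)%:C * cis (m%:~R * x)).
  by move=> rp; apply/funext => x; exact: (derivative_along_ray x rp hv (df r rp)).
have subE (x y : R) n : delta_coef m x%:C n - delta_coef m y%:C n =
    delta_coef m (x - y)%:C n.
  by rewrite /delta_coef; case: eqP => _; rewrite ?subr0// rmorphB.
have lamE (y : R) n : lam%:C * delta_coef m y%:C n = delta_coef m (lam * y)%:C n.
  by rewrite /delta_coef; case: eqP => _; rewrite ?mulr0// rmorphM.
rewrite /DtN_eigen /mode_vec /= !fourier_mode_vec; split => //.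
- exact: inL2_mode_vec.
- by rewrite fourier_mode_vec sobolev_delta ltry.
- by rewrite fourier_mode_vec sobolev_delta ltry.
exists v; split => //; rewrite ?fourier_mode_vec; split.
- apply: (@sobolev_delta_cvg _ m _ _ _ f alpha).
    apply: filterS near1 => r rp; apply/funext => n.
    by rewrite F// fourier_mode_vec subE.
  by rewrite -f1; apply: cvg_at_left_filter; exact: cf.
- apply: (@sobolev_delta_cvg _ m _ _ _ f beta).
    apply: filterS nearr => r rp; apply/funext => n.
    by rewrite F// fourier_mode_vec subE.
  by rewrite -fr; apply: cvg_at_right_filter; exact: cf.
- apply: (@sobolev_delta_cvg _ m _ _ _ g (lam * alpha)).
    apply: filterS near1 => r rp; apply/funext => n.
    by rewrite dF// !fourier_mode_vec lamE subE.
  by rewrite -h1 -g1; apply: cvg_at_left_filter; exact: cg.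
- apply: (@sobolev_delta_cvg _ m _ _ _ (fun r => - g r) (lam * beta)).
    apply: filterS nearr => r rp; apply/funext => n.
    rewrite dF//; have -> : (fun x => - ((g r)%:C * cis (m%:~R * x))) =
       (fun x => (- g r)%:C * cis (m%:~R * x)).
      by apply/funext => x; rewrite rmorphN mulNr.
    by rewrite !fourier_mode_vec lamE subE.
  rewrite -h2 -gr; apply: cvgN; apply: cvg_at_right_filter; exact: cg.
Unshelve. all: by end_near.
Qed.

End ModeEigen.

(** * The Hilbert basis of eigenvectors *)

Section ModeBasis.
Context {R : realType}.
Local Open Scope complex_scope.
Local Notation mu := (@lebesgue_measure R).
Local Notation D := (@period R : set (measurableTypeR R)).
Local Notation bfun := ((R -> R[i]^o) * (R -> R[i]^o))%type.
Implicit Types (nu rho a t alpha beta : R) (b c : bool) (m n : int).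

Lemma conjc_cis (x : R) : conjc (cis x) = cis (- x).
Proof. by rewrite /cis cosN sinN. Qed.

Lemma cintegral_mode alpha beta m n :
  cintegral (fun x => alpha%:C * cis (m%:~R * x) * conjc (beta%:C * cis (n%:~R * x))) =
  if m == n then (2 * pi * (alpha * beta))%:C else 0.
Proof.
rewrite (@eq_cintegral _ _ (fun x => (alpha * beta)%:C * cis ((m - n)%:~R * x))); last first.
  move=> x; have -> : conjc (beta%:C * cis (n%:~R * x)) = beta%:C * cis (- (n%:~R * x)).
    by rewrite -conjc_cis; apply: complex_ext; rewrite !(ReJ, ImJ, ReM, ImM) /=; ring.
  have -> : (m - n)%:~R * x = m%:~R * x + - (n%:~R * x) by rewrite intrB; ring.
  by rewrite cisD rmorphM; ring.
rewrite cintegralZ ?cintegral_cis; last exact: cintegrable_cis.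
rewrite subr_eq0; case: eqP => _; last by rewrite mulr0.
by rewrite -rmorphM mulrC.
Qed.

Lemma binner_mode_vec rho m n alpha beta alpha' beta' :
  binner rho (mode_vec m alpha beta) (mode_vec n alpha' beta') =
  if m == n then (2 * pi * (alpha * alpha' + rho * (beta * beta')))%:C else 0.
Proof.
rewrite binnerE !cintegral_mode; case: eqP => _; last by rewrite mulr0 addr0.
by rewrite -rmorphM -rmorphD; congr (_%:C); ring.
Qed.

(** The eigenvector [(B, A - lam)] is read off the first row of the matrix and is nonzero as
    [B > 0]. Its norm uses the arc length weights [2 pi] and [2 pi rho] of the two circles. *)
Definition mode_norm2 a rho x b :=
  2 * pi * (modeB a x ^+ 2 + rho * (modeA a x - mode_eig a rho x b) ^+ 2).
Definition mode_alpha a rho x b := modeB a x / Num.sqrt (mode_norm2 a rho x b).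
Definition mode_beta a rho x b :=
  (modeA a x - mode_eig a rho x b) / Num.sqrt (mode_norm2 a rho x b).

Lemma mode_norm2_gt0 a rho x b : 0 < a -> 0 < rho -> 0 < mode_norm2 a rho x b.
Proof.
move=> a0 r0; rewrite mulr_gt0 ?pi2_gt0// ltr_wpDr ?exprn_gt0 ?modeB_gt0//.
by rewrite mulr_ge0 ?sqr_ge0// ltW.
Qed.

(** The first row holds by the choice of the vector; the second is the characteristic equation. *)
Lemma mode_eigenvector a rho x b : 0 < a -> 0 < rho ->
  modeA a x * mode_alpha a rho x b - modeB a x * mode_beta a rho x b =
    mode_eig a rho x b * mode_alpha a rho x b /\
  (modeA a x * mode_beta a rho x b - modeB a x * mode_alpha a rho x b) / rho =
    mode_eig a rho x b * mode_beta a rho x b.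
Proof.
move=> a0 r0; have h := mode_eig_charpoly x b a0 r0.
have h2 := modeABB x a0; rewrite /mode_alpha /mode_beta.
move: (mode_norm2 _ _ _ _) => N; move: h h2.
move: (mode_eig _ _ _ _) (modeA _ _) (modeB _ _) => L A B h h2; split; first by ring.
apply: (mulIf (lt0r_neq0 r0)); rewrite divfK ?lt0r_neq0//.
have e : A * (A - L) - B * B = rho * L * (A - L).
  by apply/eqP; rewrite -subr_eq0; apply/eqP; rewrite -[RHS]h -h2; ring.
transitivity ((A * (A - L) - B * B) * (Num.sqrt N)^-1); first by ring.
by rewrite e; ring.
Qed.

(** For the two eigenvalues, [(A - lam) (A - lam')] is the characteristic polynomial at [A], equal
    to [- B^2 / rho]; this is orthogonality for the weights 1 and [rho]. *)
Lemma mode_orthonormal a rho x b c : 0 < a -> 0 < rho ->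
  2 * pi * (mode_alpha a rho x b * mode_alpha a rho x c +
    rho * (mode_beta a rho x b * mode_beta a rho x c)) = (b == c)%:R.
Proof.
move=> a0 r0.
have ortho : modeB a x ^+ 2 + rho * ((modeA a x - mode_eig a rho x false) *
    (modeA a x - mode_eig a rho x true)) = 0.
  have h := mode_eig_charpoly x false a0 r0.
  have h2 := modeABB x a0.
  have h3 := mode_eig_sum a rho x.
  have {h3} -> : mode_eig a rho x true =
     modeA a x * (1 + rho^-1) - mode_eig a rho x false by rewrite -h3; ring.
  move: (mode_eig _ _ _ _) (modeA _ _) (modeB _ _) h h2 => L A B h h2.
  by rewrite -[RHS]oppr0 -h -h2; field; rewrite lt0r_neq0.
have E : 2 * pi * (mode_alpha a rho x b * mode_alpha a rho x c +
    rho * (mode_beta a rho x b * mode_beta a rho x c)) =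
    2 * pi * (modeB a x ^+ 2 + rho * ((modeA a x - mode_eig a rho x b) *
    (modeA a x - mode_eig a rho x c))) /
    (Num.sqrt (mode_norm2 a rho x b) * Num.sqrt (mode_norm2 a rho x c)).
  by rewrite /mode_alpha /mode_beta invfM; ring.
rewrite E; case: eqP => [<-|bc].
  have N0 := mode_norm2_gt0 x b a0 r0.
  rewrite -!expr2 sqr_sqrtr ?(ltW N0)// -/(mode_norm2 a rho x b).
  by rewrite divff// gt_eqF.
suff -> : modeB a x ^+ 2 + rho * ((modeA a x - mode_eig a rho x b) *
    (modeA a x - mode_eig a rho x c)) = 0 by rewrite mulr0 mul0r.
by case: b c bc {E} => -[] // _; rewrite // mulrC [_ * (_ - _)]mulrC [_ * rho]mulrC.
Qed.

(** Up to normalisation the determinant is [B] times the difference of the two distinct eigenvalues;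
    hence the two eigenvectors span their whole mode. *)
Lemma mode_det_neq0 a rho x : 0 < a -> 0 < rho ->
  mode_alpha a rho x false * mode_beta a rho x true -
  mode_alpha a rho x true * mode_beta a rho x false != 0.
Proof.
move=> a0 r0; rewrite /mode_alpha /mode_beta.
have h := mode_eig_lt x a0 r0; have B0 := modeB_gt0 x a0.
have N1 : 0 < Num.sqrt (mode_norm2 a rho x false) by rewrite sqrtr_gt0 mode_norm2_gt0.
have N2 : 0 < Num.sqrt (mode_norm2 a rho x true) by rewrite sqrtr_gt0 mode_norm2_gt0.
move: (Num.sqrt _) (Num.sqrt _) N1 N2 => N M N1 N2.
rewrite (_ : _ - _ = modeB a x * (mode_eig a rho x false - mode_eig a rho x true) / (N * M));
  last by field; rewrite !lt0r_neq0.
by rewrite mulf_neq0 ?invr_eq0 ?mulf_neq0 ?(lt0r_neq0 N1) ?(lt0r_neq0 N2) ?(lt0r_neq0 B0)//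
  subr_eq0 lt_eqF.
Qed.

Definition mode_basis nu rho a k : bfun :=
  mode_vec (modeZ k./2) (mode_alpha a rho (mode_mu nu k./2) (odd k))
    (mode_beta a rho (mode_mu nu k./2) (odd k)).

Lemma mode_basis_eigen nu rho a k : 0 <= nu < 1 -> 0 < a -> rho = expR (- a) ->
  DtN_eigen nu rho (heat_eig nu rho a k) (mode_basis nu rho a k).
Proof.
move=> hnu a0 rE; have r0 : 0 < rho by rewrite rE expR_gt0.
have [h1 h2] := mode_eigenvector (mode_mu nu k./2) (odd k) a0 r0.
exact: DtN_eigen_mode hnu a0 rE h1 h2.
Qed.

Lemma mode_basis_orthonormal nu rho a j k : 0 < a -> 0 < rho ->
  binner rho (mode_basis nu rho a j) (mode_basis nu rho a k) = (j == k)%:R.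
Proof.
move=> a0 r0; rewrite binner_mode_vec; case: eqP => [e|ne].
  have [_ inj _] := modeZ_bij.
  have {e inj}e : j./2 = k./2 by apply: inj => //; rewrite inE.
  rewrite e mode_orthonormal// (_ : (j == k) = (odd j == odd k)) ?rmorph_nat//.
  apply/eqP/eqP => [->//|o].
  by rewrite -(odd_double_half j) -(odd_double_half k) o e.
by case: eqP => // jk; case: ne; rewrite jk.
Qed.

(** The normalisation gives [alpha^2 + rho beta^2 <= 1], so one bound serves all modes, as
    [diag_operator_exists] requires. *)
Lemma mode_basis_bounded nu rho a k : 0 < a -> 0 < rho < 1 ->
  cbounded rho^-1 (mode_basis nu rho a k).1 /\ cbounded rho^-1 (mode_basis nu rho a k).2.
Proof.
move=> a0 /andP[r0 r1]; have := mode_orthonormal (mode_mu nu k./2) (odd k) (odd k) a0 r0.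
rewrite eqxx /mode_basis /=.
move: (mode_alpha _ _ _ _) (mode_beta _ _ _ _) => al be h.
have p1 : 1 <= 2 * pi :> R by have := @pi_ge2 R; lra.
have n : al ^+ 2 + rho * be ^+ 2 <= 1.
  rewrite -[leRHS]h -!expr2 ler_peMl//.
  by rewrite addr_ge0 ?sqr_ge0// mulr_ge0 ?sqr_ge0// ltW.
have al2 := sqr_ge0 al; have be2 := sqr_ge0 be.
have rb : 0 <= rho * be ^+ 2 by rewrite mulr_ge0// ltW.
have ri1 : 1 <= rho^-1 by rewrite invr_ge1// ?unitfE ?gt_eqF// ltW.
have le_r (y : R) : y ^+ 2 <= rho^-1 -> `|y| <= rho^-1.
  move=> hy; rewrite -(@ler_pXn2r _ 2)// ?nnegrE ?invr_ge0 ?(ltW r0)//.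
  rewrite real_normK ?num_real//; apply: le_trans hy _.
  by rewrite expr2 ler_peMl// invr_ge0 ltW.
have bd (y : R) : y ^+ 2 <= rho^-1 -> cbounded rho^-1
    (fun x => y%:C * cis ((modeZ k./2)%:~R * x)).
  move=> hy x; rewrite Re_realM Im_realM !normrM; split; apply: le_trans (le_r _ hy).
    by rewrite ler_piMr//; exact: norm_cos_le1.
  by rewrite ler_piMr//; exact: norm_sin_le1.
split; apply: bd; first by apply: le_trans ri1; lra.
rewrite -[leRHS]mul1r ler_pdivlMr//; lra.
Qed.

(** Asking for the equality at all lengths [n >= N] lets two combinations be added at a common
    length. *)
Definition in_span (e : nat -> bfun) (v : bfun) :=
  exists N (d : nat -> R[i]), forall n : nat, (N <= n)%N -> v = \sum_(k < n) d k *: e k.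

Lemma in_span_lin e (s : R[i]) (u v : bfun) : in_span e u -> in_span e v ->
  in_span e (s *: u + v).
Proof.
move=> [N [d hd]] [M [d' hd']]; exists (maxn N M), (fun k => s * d k + d' k) => n.
rewrite geq_max => /andP[hN hM]; rewrite (hd n hN) (hd' n hM) scaler_sumr -big_split /=.
by apply: eq_bigr => k _; rewrite scalerDl scalerA.
Qed.

Lemma in_span_basis (e : nat -> bfun) j : in_span e (e j).
Proof.
exists j.+1, (fun k => (k == j)%:R) => n jn.
rewrite (bigD1 (Ordinal jn))//= eqxx scale1r big1 ?addr0// => k.
by rewrite -val_eqE /= => /negbTE ->; rewrite scale0r.
Qed.

Lemma in_span0 e : in_span e 0.
Proof. by exists 0, (fun=> 0) => n _; rewrite big1// => k _; rewrite scale0r. Qed.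

Lemma in_span_mode nu rho a m (x y : R[i]) : 0 < a -> 0 < rho ->
  in_span (mode_basis nu rho a)
    (fun s => x * cis (m%:~R * s), fun s => y * cis (m%:~R * s)).
Proof.
move=> a0 r0; have [_ _ surj] := modeZ_bij; have [j _ mE] := surj m Logic.I.
have d0 := mode_det_neq0 (mode_mu nu j) a0 r0.
have h1 := in_span_basis (mode_basis nu rho a) j.*2.
have h2 := in_span_basis (mode_basis nu rho a) j.*2.+1.
move: h1 h2; rewrite /mode_basis /= !odd_double /= uphalf_double doubleK mE.
move: (mode_alpha _ _ _ _) (mode_alpha _ _ _ _) (mode_beta _ _ _ _) (mode_beta _ _ _ _) d0.
move=> a2 a1 b1 b2 d0 h1 h2; pose d := (a1 * b2 - a2 * b1)%:C : R[i].
have dn0 : d != 0.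
  by apply/eqP => h; move/eqP: d0; apply; exact: (congr1 (@complex.Re R) h).
have dE : d = a1%:C * b2%:C - a2%:C * b1%:C by rewrite /d rmorphB !rmorphM.
(* Coordinates of [(x, y)] on the two eigenvectors of the mode, by Cramer's rule. *)
pose s := (x * b2%:C - y * a2%:C) / d; pose t := (y * a1%:C - x * b1%:C) / d.
have sx : x = s * a1%:C + t * a2%:C by rewrite /s /t; move: dn0; rewrite dE => ?; field.
have sy : y = s * b1%:C + t * b2%:C by rewrite /s /t; move: dn0; rewrite dE => ?; field.
have := in_span_lin s h1 (in_span_lin t h2 (in_span0 _)).
rewrite addr0; set u := _ + _; set v := (_, _); suff -> : u = v by [].
rewrite /u /v {1}sx {1}sy; congr pair; apply/funext => z.
  transitivity (s * (a1%:C * cis (m%:~R * z)) + t * (a2%:C * cis (m%:~R * z))) => //.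
  by ring.
transitivity (s * (b1%:C * cis (m%:~R * z)) + t * (b2%:C * cis (m%:~R * z))) => //.
by ring.
Qed.

Lemma in_span_trigpoly nu rho a (p q : R -> R[i]) : 0 < a -> 0 < rho ->
  trigpoly p -> trigpoly q -> in_span (mode_basis nu rho a) (p, q).
Proof.
move=> a0 r0 tp tq; set e := mode_basis _ _ _.
have add (u v : bfun) : in_span e u -> in_span e v -> in_span e (u + v).
  by move=> hu hv; rewrite -[u]scale1r; exact: in_span_lin.
have h1 : in_span e (p, 0).
  elim: tp => {p} [c m|p r _ hp _ hr].
    have := in_span_mode nu m c 0 a0 r0; congr in_span; congr pair.
    by apply/funext => s; rewrite mul0r.
  by have := add _ _ hp hr; congr in_span; congr pair; rewrite addr0.
have h2 : in_span e (0, q).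
  elim: tq => {q} [c m|q r _ hq _ hr].
    have := in_span_mode nu m 0 c a0 r0; congr in_span; congr pair.
    by apply/funext => s; rewrite mul0r.
  by have := add _ _ hq hr; congr in_span; congr pair; rewrite addr0.
by have := add _ _ h1 h2; congr in_span; congr pair; rewrite ?addr0 ?add0r.
Qed.

Theorem mode_hilbert_basis nu rho a : 0 < a -> 0 < rho ->
  hilbert_basis rho (mode_basis nu rho a).
Proof.
move=> a0 r0; split.
- by move=> k; exact: inL2_mode_vec.
- by move=> j k; exact: mode_basis_orthonormal.
move=> Psi /(inL2P _ r0)[l1 l2] eps e0.
have [_ /(_ (eps / 2))[|p tp hp]] := inl2_approx l1; first by rewrite divr_gt0.
have [_ /(_ (eps / 2 / rho))[|q tq hq]] := inl2_approx l2; first by rewrite !divr_gt0.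
have [N [c hN]] := in_span_trigpoly nu a0 r0 tp tq.
exists N, c; rewrite -(hN N (leqnn N)) bnorm2_fin//; first last.
- by apply: inl2B => //; exact: trigpoly_inl2.
- by apply: inl2B => //; exact: trigpoly_inl2.
rewrite lte_fin; move: hq; rewrite ltr_pdivlMr// => hq.
(* Each circle gets half of [eps], the inner share being divided by its weight [rho]. *)
have -> : eps = eps / 2 + rho * (eps / 2 / rho) by field; rewrite lt0r_neq0.
by apply: ltrD; rewrite // mulrCA divff ?mulr1 1?mulrC// lt0r_neq0.
Qed.

End ModeBasis.

Theorem mainTheorem7 (R : realType) (nu rho a : R)
    (hnu : 0 <= nu < 1) (hrho : 0 < rho < 1)
    (ha : 0 < a) (hrhoa : rho = expR (- a)) :
  exists Tr : R -> R,
    (forall t, 0 < t -> DtN_heat_trace nu rho t (Tr t)) /\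
    exists c : nat -> R,
      [/\ \forall t \near 0^'+,
            series (fun p => c p.+1 * t ^+ p.+1) @ \oo -->
              Tr t - cosh (t * (nu - 2^-1)) / sinh (t / 2)
                   - cosh (t / rho * (nu - 2^-1)) / sinh (t / (2 * rho)),
          (c 1)%:E = (- (1 + rho^-1)%:E *
             \esum_(m in [set: int]) (coth_defect a `|m%:~R - nu|)%:E)%E
        & exists K : R, \forall t \near 0^'+,
            `| Tr t - ((2 + 2 * rho) / t +
                 ((1 + rho - 6 * nu - 6 * rho * nu + 6 * nu ^+ 2
                    + 6 * rho * nu ^+ 2) / (6 * rho) + c 1) * t) |
            <= K * t ^+ 2].
Proof.
have /andP[r0 _] := hrho.
pose Tr t := limn (series (fun k => expR (- t * heat_eig nu rho a k))).
have hTr t : 0 < t -> series (fun k => expR (- t * heat_eig nu rho a k)) @ \oo --> Tr t.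
  by move=> t0; exact: cvg_series_heat.
exists Tr; split=> [t t0|]; last exact: heat_trace_expansion.
apply: DtN_heat_trace_basis r0 (mode_hilbert_basis nu ha r0) _ _ (hTr t t0) => k.
  exact: mode_basis_eigen.
exact: mode_basis_bounded.
Qed.
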